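(* Let $v:\mathbb{T}\to\mathbb{R}$ be continuous, let $\alpha\in\mathbb{T}$ be irrational, and let $p_n/q_n\to\alpha$ with $(p_n,q_n)=1$. Let $H_{\alpha,\theta}$ be the quasi-periodic Schrödinger operator with potential $v$. If its Lyapunov exponent satisfies $L(\alpha,E)=0$ for every $E$ in its spectrum $\Sigma(\alpha)$, then $$\lim_{p_n/q_n\to\alpha}\mathrm{Cap}\big(S_+(p_n/q_n)\big)=\mathrm{Cap}\big(\Sigma(\alpha)\big).$$
   Context: $\mathbb{T}=\mathbb{R}/\mathbb{Z}$. For $\alpha,\theta\in\mathbb{T}$, $H_{\alpha,\theta}$ acts on $\ell^2(\mathbb{Z})$ by $(H_{\alpha,\theta}\psi)_n=\psi_{n-1}+\psi_{n+1}+v(\alpha n+\theta)\psi_n$; its spectrum is $\sigma(\alpha,\theta)$. For irrational $\alpha$, $\sigma(\alpha,\theta)$ is independent of $\theta$ and denoted $\Sigma(\alpha)$. For rational $p/q$, $S_+(p/q)=\bigcup_{\theta\in\mathbb{T}}\sigma(p/q,\theta)$. Lyapunov exponent: with $A^E(\theta)=\begin{pmatrix}E-v(\theta)&-1\\1&0\end{pmatrix}$, $$L(\alpha,E)=\inf_{n\ge1}\frac1n\int_{\mathbb{T}}\log\big\|A^E(\theta+(n-1)\alpha)\cdots A^E(\theta+\alpha)A^E(\theta)\big\|\,d\theta.$$ Logarithmic capacity: for a Borel probability measure $\mu$ with compact support in $\mathbb{C}$, $I(\mu)=\iint\log\frac1{|z-w|}\,d\mu(w)\,d\mu(z)$, and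 $\mathrm{Cap}(E)=\sup\exp(-I(\mu))$ over Borel probability measures $\mu$ compactly supported in $E$. *)

(* Defs.v *)
From HB Require Import structures.
From mathcomp Require Import all_boot all_order all_algebra.
From mathcomp Require Import complex.
From mathcomp Require Import all_classical all_reals all_analysis.

Set Implicit Arguments.
Unset Strict Implicit.
Unset Printing Implicit Defensive.

Import Order.TTheory GRing.Theory Num.Theory.
Import numFieldNormedType.Exports.

Local Open Scope classical_set_scope.
Local Open Scope ring_scope.
Local Open Scope complex_scope.

(* Points of the circle R/Z are represented by real numbers, and functions on
   the circle by functions of period 1 on R. *)

Definition torus_fun (R : realType) (v : R -> R) : Prop :=
  forall x, v (x + 1) = v x.

Definition torus_cvg (R : realType) (u : nat -> R) (a : R) : Prop :=
  forall e : R, 0 < e ->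
    \forall n \near \oo, exists k : int, `|u n - a - k%:~R| < e.

(* Complex sequences indexed by Z; the l^2 norm is kept squared, with value
   +oo outside l^2(Z). *)

Definition l2normsq (R : realType) (psi : int -> R[i]) : \bar R :=
  \esum_(n in [set: int]) (Normc.normc (psi n) ^+ 2)%:E.

Definition l2 (R : realType) : set (int -> R[i]) :=
  [set psi | (l2normsq psi < +oo)%E].

Definition l2_linear (R : realType) (B : (int -> R[i]) -> (int -> R[i])) :=
  forall (a : R[i]) (f g : int -> R[i]), l2 f -> l2 g ->
    B (fun n => a * f n + g n) = (fun n => a * B f n + B g n).

(* Finiteness of the right-hand side on l^2 makes B map l^2 to itself. *)
Definition l2_bounded (R : realType) (B : (int -> R[i]) -> (int -> R[i])) :=
  exists M : R, forall f, l2 f -> (l2normsq (B f) <= M%:E * l2normsq f)%E.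

(* T is the action on sequences of an operator that is bounded on l^2(Z). *)
Definition resolvent_set (R : realType)
    (T : (int -> R[i]) -> (int -> R[i])) : set R[i] :=
  [set z | exists B : (int -> R[i]) -> (int -> R[i]),
     [/\ l2_linear B,
         l2_bounded B,
         forall f, l2 f -> (fun n => T (B f) n - z * B f n) = f
       & forall f, l2 f -> B (fun n => T f n - z * f n) = f]].

Definition l2_spectrum (R : realType)
    (T : (int -> R[i]) -> (int -> R[i])) : set R[i] :=
  ~` resolvent_set T.

Definition schrodinger (R : realType) (v : R -> R) (alpha theta : R)
    (psi : int -> R[i]) : int -> R[i] :=
  fun n => psi (n - 1) + psi (n + 1)
           + (v (alpha * n%:~R + theta))%:C * psi n.

Definition spectrum (R : realType) (v : R -> R) (alpha theta : R) : set R[i] :=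
  l2_spectrum (schrodinger v alpha theta).

(* Only meant for irrational alpha and continuous v, when the spectrum does not
   depend on the phase; the phase 0 is then an arbitrary choice. *)
Definition Sigma (R : realType) (v : R -> R) (alpha : R) : set R[i] :=
  spectrum v alpha 0.

Definition S_plus (R : realType) (v : R -> R) (alpha : R) : set R[i] :=
  \bigcup_(theta in [set: R]) spectrum v alpha theta.

Definition transfer (R : realType) (v : R -> R) (E : R[i]) (theta : R) :
    'M[R[i]]_2 :=
  \matrix_(i < 2, j < 2)
    if i == 0 then if j == 0 then E - (v theta)%:C else - 1
    else if j == 0 then 1 else 0.

(* A^E(theta + (n-1) alpha) ... A^E(theta + alpha) A^E(theta) *)
Fixpoint transfer_iter (R : realType) (v : R -> R) (alpha : R) (E : R[i])
    (n : nat) (theta : R) : 'M[R[i]]_2 :=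
  if n is m.+1 then
    transfer v E (theta + m%:R * alpha) *m transfer_iter v alpha E m theta
  else 1%:M.

Definition eucl_norm (R : realType) (x : 'cV[R[i]]_2) : R :=
  Num.sqrt (\sum_(i < 2) Normc.normc (x i 0) ^+ 2).

(* The library norm on matrices is the entrywise maximum, which is not
   submultiplicative. *)
Definition op_norm (R : realType) (A : 'M[R[i]]_2) : R :=
  sup [set eucl_norm (A *m x) | x in [set x | eucl_norm x <= 1]].

Definition lyapunov (R : realType) (v : R -> R) (alpha : R) (E : R[i]) : R :=
  inf [set n%:R^-1 * (\int[@lebesgue_measure R]_(theta in `[0, 1])
                        ln (op_norm (transfer_iter v alpha E n theta)))
      | n in [set n : nat | (1 <= n)%N]].

(* The complex plane is identified with R * R, which carries the product
   topology and the product (= Borel) sigma-algebra. *)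

Notation plane R := (measurableTypeR R * measurableTypeR R)%type.

Definition to_complex (R : realType) (z : R * R) : R[i] := z.1 +i* z.2.

(* The inverse is the one of \bar R: the kernel is +oo on the diagonal. *)
Definition energy (R : realType)
    (mu : probability (plane R) R) : \bar R :=
  (\int[mu]_z \int[mu]_w
     lne ((Normc.normc (to_complex z - to_complex w))%:E^-1))%E.

Definition compactly_supported_in (R : realType)
    (mu : probability (plane R) R)
    (E : set R[i]) : Prop :=
  exists K : set (R * R),
    [/\ compact K, K `<=` @to_complex R @^-1` E & mu K = 1%E].

(* Takes the value -oo on the empty set, and lies in [0, +oo[ for nonempty
   bounded sets. *)
Definition capacity (R : realType) (E : set R[i]) : \bar R :=
  ereal_sup [set expeR (- energy mu)%E | mu in
    [set mu : probability (plane R) R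
      | compactly_supported_in mu E]].

(* Main.v *)
(* Both capacities tend to 1.  Lower bound: the spectrum of any bounded
   discrete Schroedinger operator has capacity at least 1.  Indeed the
   Vandermonde determinant of the eigenvalues of an n x n truncation is at
   least 1, because the orthogonal polynomials are monic and orthogonal on the
   eigenvalues; the spectrum comes close to any three eigenvalues near each
   other, so a weak limit of the empirical measures (Helly selection) is
   supported on the spectrum, and its energy is at most 0.
   Upper bound: if L vanishes on Sigma(alpha), then for every e > 0 there are a
   monic polynomial Q of degree d and an eta > 0 with |Q| <= exp(e d) on the
   eta-neighbourhood of Sigma(alpha); Q is a product, over equally spaced
   phases, of characteristic polynomials of truncations, whose logarithms are
   bounded by Riemann sums of log |A_n^E|.  Hence sets in this neighbourhood have
   capacity at most exp(e).  For alpha irrational, S_+(p/q) lies in the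
   neighbourhood as soon as p/q is close to alpha: a tent cut-off localizes
   approximate eigenvectors and the density of the orbit of the rotation moves
   them to phase 0. *)


Require Import Defs.
From mathcomp Require Import all_boot all_order all_algebra.
From mathcomp Require Import perm complex finmap ring lra zify.
From mathcomp Require Import all_classical all_reals all_analysis measurable_realfun.

Set Implicit Arguments.
Unset Strict Implicit.
Unset Printing Implicit Defensive.

Import Order.TTheory GRing.Theory Num.Theory.
Import numFieldNormedType.Exports.

Local Open Scope classical_set_scope.
Local Open Scope ring_scope.

(** * Finitely supported sequences on Z *)

Section FiniteSupport.
Variable R : realType.
Implicit Types (f g h : int -> R) (N M : nat).

(** Spectra are handled through [rspec], that is, through finitely supported real approximate
    eigenvectors, and one spectral fact ([rspec_near]) serves both bounds: a vector with relative
    error r at c forces a point of the spectrum within r of c. Three eigenvalues of a truncation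
    combine to such a vector, and a translated piece of an approximate eigenvector at another
    frequency is one. The limit measure is the law of a monotone function of a uniform variable, so
    its energy is a double integral over the unit square, to which Fatou's lemma applies. In the
    upper bound, a capacity above exp(e) would give n points whose Vandermonde product exceeds exp(e
    n^2 / 2) by a factor exponential in n^2, whereas Q bounds it by exp(e n^2 / 2) up to exp(O(n log
    n)); all estimates may therefore be crude at the scale n log n. L = 0 yields, at each energy,
    some length n with a small mean of log |A_n^E|, and n depends on the energy. A single Q exists
    because the lengths found on a finite cover all divide their product, and because sums over
    equally spaced phases are controlled uniformly in the phase shift. *)

Fixpoint zsum N f : R :=
  if N is M.+1 then zsum M f + f (N%:Z) + f (- N%:Z) else f 0.

Definition supp N f := forall n : int, (N < `|n|)%N -> f n = 0.

Definition fsupp f := exists N, supp N f.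

(** By [tsumE] the window picked by [xget] is immaterial. Off finite support the result is the junk
    value [f 0]. *)
Definition tsum f : R := zsum (xget 0%N [set N | supp N f]) f.

Lemma eq_zsum N f g : (forall n : int, (`|n| <= N)%N -> f n = g n) ->
  zsum N f = zsum N g.
Proof.
elim: N => [|N IH] fg /=; first exact: fg.
rewrite IH => [|n nN]; last by apply: fg; lia.
by rewrite (fg N.+1%:Z) ?(fg (- N.+1%:Z)) //; lia.
Qed.

Lemma zsumD N f g : zsum N (fun n => f n + g n) = zsum N f + zsum N g.
Proof. by elim: N => //= N ->; ring. Qed.

Lemma zsumZ N a f : zsum N (fun n => a * f n) = a * zsum N f.
Proof. by elim: N => //= N ->; ring. Qed.

Lemma le_zsum N f g : (forall n : int, (`|n| <= N)%N -> f n <= g n) ->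
  zsum N f <= zsum N g.
Proof.
elim: N => [|N IH] fg /=; first exact: fg.
apply: lerD; last by apply: fg; lia.
apply: lerD; last by apply: fg; lia.
by apply: IH => n nN; apply: fg; lia.
Qed.

Lemma zsum0 N : zsum N (fun=> 0) = 0.
Proof. by elim: N => //= N ->; rewrite !addr0. Qed.

Lemma zsum_ge0 N f : (forall n, 0 <= f n) -> 0 <= zsum N f.
Proof. by move=> f0; rewrite -(zsum0 N); apply: le_zsum. Qed.

Lemma zsum_shift N f : zsum N (fun n => f (n + 1)) =
  zsum N f + f N.+1%:Z - f (- N%:Z).
Proof.
elim: N => [|N IH] /=; first by rewrite add0r oppr0; ring.
rewrite IH -PoszD addn1.
have -> : - N.+1%:Z + 1 = - N%:Z by lia.
by ring.
Qed.

Lemma zsum_supp N M f : supp N f -> (N <= M)%N -> zsum M f = zsum N f.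
Proof.
move=> fN; elim: M => [|M IH]; first by rewrite leqn0 => /eqP ->.
rewrite leq_eqVlt => /predU1P[-> //|]; rewrite ltnS => NM /=.
by rewrite IH // !fN ?addr0 //; lia.
Qed.

Lemma zsum_le_mono N M f : (forall n, 0 <= f n) -> (N <= M)%N ->
  zsum N f <= zsum M f.
Proof.
move=> f0; elim: M => [|M IH]; first by rewrite leqn0 => /eqP ->.
rewrite leq_eqVlt => /predU1P[-> //|]; rewrite ltnS => NM /=.
by rewrite -addrA ler_wpDr ?IH ?addr_ge0.
Qed.

Lemma supp_mono N M f : supp N f -> (N <= M)%N -> supp M f.
Proof. by move=> fN NM n Mn; apply: fN; lia. Qed.

Lemma tsumE N f : supp N f -> tsum f = zsum N f.
Proof.
move=> fN; rewrite /tsum; case: xgetP => [M _ /= fM|/(_ N) //].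
case: (leqP M N) => MN; first by rewrite (zsum_supp fM MN).
by rewrite -(zsum_supp fN (ltnW MN)).
Qed.

Lemma fsupp2 f g : fsupp f -> fsupp g -> exists N, supp N f /\ supp N g.
Proof.
move=> [N fN] [M gM]; exists (maxn N M).
by split; [apply: supp_mono fN _; lia|apply: supp_mono gM _; lia].
Qed.

Lemma fsuppD f g : fsupp f -> fsupp g -> fsupp (fun n => f n + g n).
Proof.
move=> ff fg; have [N [fN gN]] := fsupp2 ff fg.
by exists N => n nN; rewrite fN // gN // addr0.
Qed.

Lemma fsuppM f g : fsupp f -> fsupp (fun n => f n * g n).
Proof. by move=> [N fN]; exists N => n nN; rewrite fN // mul0r. Qed.

Lemma fsuppMr f g : fsupp g -> fsupp (fun n => f n * g n).
Proof. by move=> [N fN]; exists N => n nN; rewrite fN // mulr0. Qed.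

Lemma fsuppX f : fsupp f -> fsupp (fun n => f n ^+ 2).
Proof. by move=> [N fN]; exists N => n nN; rewrite fN // expr0n. Qed.

Lemma fsuppN f : fsupp f -> fsupp (fun n => - f n).
Proof. by move=> [N fN]; exists N => n nN; rewrite fN // oppr0. Qed.

Lemma fsupp_shift f (m : int) : fsupp f -> fsupp (fun n => f (n + m)).
Proof. by move=> [N fN]; exists (N + `|m|)%N => n nN; apply: fN; lia. Qed.

Lemma tsumD f g : fsupp f -> fsupp g ->
  tsum (fun n => f n + g n) = tsum f + tsum g.
Proof.
move=> ff fg; have [N [fN gN]] := fsupp2 ff fg.
rewrite (tsumE fN) (tsumE gN) -zsumD; apply: tsumE.
by move=> n nN; rewrite fN // gN // addr0.
Qed.

Lemma tsumZ a f : fsupp f -> tsum (fun n => a * f n) = a * tsum f.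
Proof.
move=> [N fN]; rewrite (tsumE fN) -zsumZ; apply: tsumE.
by move=> n nN; rewrite fN // mulr0.
Qed.

Lemma le_tsum f g : fsupp f -> fsupp g -> (forall n, f n <= g n) ->
  tsum f <= tsum g.
Proof.
move=> ff fg fgle; have [N [fN gN]] := fsupp2 ff fg.
by rewrite (tsumE fN) (tsumE gN) le_zsum.
Qed.

Lemma tsum_ge0 f : (forall n, 0 <= f n) -> 0 <= tsum f.
Proof. by move=> f0; apply: zsum_ge0. Qed.

Lemma tsum_sum (I : Type) (r : seq I) (F : I -> int -> R) :
  (forall i, fsupp (F i)) ->
  tsum (fun n => \sum_(i <- r) F i n) = \sum_(i <- r) tsum (F i).
Proof.
move=> fF; suff [E _] : tsum (fun n => \sum_(i <- r) F i n) =
  \sum_(i <- r) tsum (F i) /\ fsupp (fun n => \sum_(i <- r) F i n) by [].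
elim: r => [|i r [IH IHf]].
  have s0 : supp 0 (fun n => \sum_(i <- [::]) F i n).
    by move=> n _; rewrite big_nil.
  by split; [rewrite (tsumE s0) /= !big_nil|exists 0%N].
have E : (fun n => \sum_(j <- i :: r) F j n) =
    (fun n => F i n + \sum_(j <- r) F j n).
  by apply/funext => n; rewrite big_cons.
by split; rewrite E ?big_cons; [rewrite tsumD ?IH|apply: fsuppD].
Qed.

Lemma tsum_shift1 f : fsupp f -> tsum (fun n => f (n + 1)) = tsum f.
Proof.
move=> [N fN].
have fN1 : supp N.+1 (fun n => f (n + 1)) by move=> n nN; apply: fN; lia.
have fN2 : supp N.+1 f by apply: supp_mono fN _.
rewrite (tsumE fN1) (tsumE fN2) zsum_shift !fN ?addr0 ?subr0 //; lia.
Qed.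

Lemma tsum_shift f (m : int) : fsupp f -> tsum (fun n => f (n + m)) = tsum f.
Proof.
move=> ff; have shn (k : nat) g : fsupp g -> tsum (fun n => g (n + k%:Z)) = tsum g.
  elim: k g => [|k IH] g fg.
    by congr tsum; apply/funext => n; rewrite addr0.
  rewrite -(IH g fg) -(tsum_shift1 (fsupp_shift k%:Z fg)).
  by congr tsum; apply/funext => n; congr g; lia.
case: (intP m) => [|k|k].
- exact: (shn 0%N).
- exact: shn.
- rewrite -(shn k.+1 _ (fsupp_shift (- k.+1%:Z) ff)).
  by congr tsum; apply/funext => n; congr f; lia.
Qed.

Lemma tsum_sq_gt0 f : fsupp f -> (exists n, f n != 0) ->
  0 < tsum (fun n => f n ^+ 2).
Proof.
move=> [N fN] [m fm].
have s2 : supp N (fun n => f n ^+ 2) by move=> n nN; rewrite fN ?expr0n.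
have mN : (`|m| <= N)%N by rewrite leqNgt; apply: contra fm => /fN ->.
rewrite (tsumE s2) {s2 fN}.
have -> : zsum N (fun n => f n ^+ 2) =
    zsum N (fun n => if n == m then f m ^+ 2 else 0) +
    zsum N (fun n => if n == m then 0 else f n ^+ 2).
  rewrite -zsumD; apply: eq_zsum => n _.
  by case: eqP => [->|_]; rewrite ?addr0 ?add0r.
apply: ltr_pwDl; last by apply: zsum_ge0 => n; case: ifP => //; rewrite sqr_ge0.
have : 0 < f m ^+ 2 by rewrite lt_def sqr_ge0 sqrf_eq0 fm.
move: (f m ^+ 2) => a a0.
have z0 k : (k < `|m|)%N -> zsum k (fun n => if n == m then a else 0) = 0.
  elim: k => [|k IH] /= km; first by rewrite ifF //; apply/negP => /eqP E; lia.
  by rewrite IH ?ifF ?addr0 //; lia.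
apply: lt_le_trans (zsum_le_mono _ mN); last by move=> n; case: ifP => // _; apply: ltW.
have [E|] := eqVneq m 0; first by rewrite E.
rewrite -absz_eq0; case E : `|m|%N => [//|k] _ /=.
rewrite z0 ?E // add0r.
have [->|e1] := eqVneq k.+1%:Z m; first by case: ifP => _; rewrite ?addr0 // addr_gt0.
by rewrite ifT ?add0r //; apply/eqP; lia.
Qed.

End FiniteSupport.

Ltac fsup := first [ assumption | apply: fsuppD; fsup | apply: fsuppX; fsup
  | apply: fsuppN; fsup | apply: fsuppM; fsup | apply: fsuppMr; fsup
  | apply: fsupp_shift; fsup ].

(** * Jacobi operators and their approximate spectrum *)

Section JacobiOperator.
Variable R : realType.
Implicit Types (f g h V : int -> R) (c s t C K k : R).

Definition nsq f : R := tsum (fun n => f n ^+ 2).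

Definition jop V f : int -> R := fun n => f (n - 1) + f (n + 1) + V n * f n.

Definition pshift V c : int -> R := fun n => V n - c.

(* Weyl's criterion tested on real, finitely supported vectors only; it still
   detects the whole l^2 spectrum, see [l2_spectrumP]. *)
Definition rspec V : set R :=
  [set E | forall k, 0 < k -> exists f, fsupp f /\ nsq (jop (pshift V E) f) < k * nsq f].

Lemma fsupp_jop V f : fsupp f -> fsupp (jop V f).
Proof. by move=> ff; apply: fsuppD; try fsup. Qed.
Ltac fsup ::= first [ assumption | apply: fsupp_jop; fsup | apply: fsuppD; fsup
  | apply: fsuppX; fsup | apply: fsuppN; fsup | apply: fsuppM; fsup
  | apply: fsuppMr; fsup | apply: fsupp_shift; fsup ].

Lemma nsq_ge0 f : 0 <= nsq f.
Proof. by apply: tsum_ge0 => n; rewrite sqr_ge0. Qed.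

Lemma nsqDZ f g t : fsupp f -> fsupp g ->
  nsq (fun n => f n + t * g n) =
  nsq f + 2 * t * tsum (fun n => f n * g n) + t ^+ 2 * nsq g.
Proof.
move=> ff fg; rewrite /nsq.
rewrite -!tsumZ -?tsumD; try fsup.
by congr tsum; apply/funext => n; ring.
Qed.

Lemma nsq_shift f (m : int) : fsupp f -> nsq (fun n => f (n + m)) = nsq f.
Proof. by move=> ff; rewrite /nsq -(tsum_shift m (fsuppX ff)). Qed.

Lemma le_nsq f g : fsupp f -> fsupp g -> (forall n, f n ^+ 2 <= g n ^+ 2) ->
  nsq f <= nsq g.
Proof. by move=> ff fg fgle; apply: le_tsum; try fsup. Qed.

Lemma nsqZ f t : fsupp f -> nsq (fun n => t * f n) = t ^+ 2 * nsq f.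
Proof.
move=> ff; rewrite /nsq -tsumZ; try fsup.
by congr tsum; apply/funext => n; ring.
Qed.

Lemma sqrD_le (a b t : R) : 0 < t ->
  (a + b) ^+ 2 <= (1 + t^-1) * a ^+ 2 + (1 + t) * b ^+ 2.
Proof.
move=> t0; rewrite -subr_ge0.
have -> : (1 + t^-1) * a ^+ 2 + (1 + t) * b ^+ 2 - (a + b) ^+ 2 =
  t^-1 * (t * b - a) ^+ 2 by rewrite sqrrB; field; rewrite gt_eqF.
by rewrite mulr_ge0 ?sqr_ge0 // invr_ge0 ltW.
Qed.

Lemma nsqD_le f g (t : R) : 0 < t -> fsupp f -> fsupp g ->
  nsq (fun n => f n + g n) <= (1 + t) * nsq f + (1 + t^-1) * nsq g.
Proof.
move=> t0 ff fg; rewrite /nsq -!tsumZ -?tsumD; try fsup.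
apply: le_tsum; try fsup; move=> n.
by rewrite addrC [leRHS]addrC sqrD_le.
Qed.

Lemma jopDZ V f g t :
  jop V (fun n => f n + t * g n) = (fun n => jop V f n + t * jop V g n).
Proof. by apply/funext => n; rewrite /jop; ring. Qed.

Lemma jop_sym V f g : fsupp f -> fsupp g ->
  tsum (fun n => jop V f n * g n) = tsum (fun n => f n * jop V g n).
Proof.
move=> ff fg.
have -> : (fun n => jop V f n * g n) = (fun n => f (n - 1) * g n +
    (f (n + 1) * g n + f n * V n * g n)) by apply/funext => n; rewrite /jop; ring.
have -> : (fun n => f n * jop V g n) = (fun n => f n * g (n + 1) +
    (f n * g (n - 1) + f n * V n * g n)) by apply/funext => n; rewrite /jop; ring.
rewrite !tsumD; try fsup; congr (_ + (_ + _)).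
- rewrite -tsum_shift1; try fsup; congr tsum.
  by apply/funext => n; rewrite addrK.
- rewrite -[RHS]tsum_shift1; try fsup; congr tsum.
  by apply/funext => n; rewrite addrK.
Qed.

Lemma sqr3_le (x y z : R) : (x + y + z) ^+ 2 <= 3 * x ^+ 2 + 3 * y ^+ 2 + 3 * z ^+ 2.
Proof.
rewrite -subr_ge0.
have -> : 3 * x ^+ 2 + 3 * y ^+ 2 + 3 * z ^+ 2 - (x + y + z) ^+ 2 =
  (x - y) ^+ 2 + (y - z) ^+ 2 + (x - z) ^+ 2 by ring.
by rewrite !addr_ge0 ?sqr_ge0.
Qed.

Lemma jop_bound V f K : (forall n, `|V n| <= K) -> fsupp f ->
  nsq (jop V f) <= 3 * (2 + K ^+ 2) * nsq f.
Proof.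
move=> VK ff.
have E : 3 * (2 + K ^+ 2) * nsq f = tsum (fun n => 3 * f (n - 1) ^+ 2 +
    3 * f (n + 1) ^+ 2 + 3 * K ^+ 2 * f n ^+ 2).
  rewrite !tsumD ?tsumZ; try fsup.
  by rewrite -!/(nsq _) !nsq_shift //; ring.
rewrite E; apply: le_tsum; try fsup; move=> n.
rewrite /jop (le_trans (sqr3_le _ _ _)) // lerD2l exprMn mulrA.
rewrite ler_wpM2r ?sqr_ge0 // ler_pM2l // -(real_normK (num_real (V n))).
by rewrite lerXn2r ?nnegrE // (le_trans _ (VK n)).
Qed.

(** This is H^2 + s. For s = -m^2 it factors as (H - m)(H + m), which locates spectrum; for s = y^2
    as (H - iy)(H + iy), which yields resolvents. *)
Definition qop V s f : int -> R := fun n => jop V (jop V f) n + s * f n.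

Lemma fsupp_qop V s f : fsupp f -> fsupp (qop V s f).
Proof. by move=> ff; apply: fsuppD; try fsup. Qed.
Ltac fsup ::= first [ assumption | apply: fsupp_qop; fsup | apply: fsupp_jop; fsup
  | apply: fsuppD; fsup
  | apply: fsuppX; fsup | apply: fsuppN; fsup | apply: fsuppM; fsup
  | apply: fsuppMr; fsup | apply: fsupp_shift; fsup ].

(* For a nonnegative form Q with operator A this is |A f|^2 <= |A| Q(f),
   obtained from Q (f - C^-1 A f) >= 0. *)
Lemma qop_le V s C f : 0 < C ->
  (forall g, fsupp g -> 0 <= nsq (jop V g) + s * nsq g) ->
  (forall g, fsupp g -> nsq (jop V g) + s * nsq g <= C * nsq g) ->
  fsupp f -> nsq (qop V s f) <= C * (nsq (jop V f) + s * nsq f).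
Proof.
move=> C0 pos bnd ff.
have [q qE] : {q | q = qop V s f} by exists (qop V s f).
have fq : fsupp q by rewrite qE; fsup.
rewrite -qE; have := pos (fun n => f n + (- C^-1) * q n) ltac:(fsup).
rewrite jopDZ !nsqDZ; try fsup; move=> le1.
have le2 := bnd _ fq.
have E : tsum (fun n => jop V f n * jop V q n) +
   s * tsum (fun n => f n * q n) = nsq q.
  rewrite -jop_sym; try fsup; rewrite -tsumZ -?tsumD; try fsup.
  by congr tsum; apply/funext => n; rewrite qE /qop; ring.
set t : R := C^-1 in le1; have Ct : C * t = 1 by rewrite mulfV ?gt_eqF.
have t0 : 0 < t by rewrite invr_gt0.
have le3 : t ^+ 2 * (nsq (jop V q) + s * nsq q) <=
  t ^+ 2 * (C * nsq q) by rewrite ler_wpM2l ?sqr_ge0.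
have E2 : t ^+ 2 * (C * nsq q) = t * nsq q.
  by rewrite mulrA expr2 -(mulrA t t C) (mulrC t C) Ct mulr1.
rewrite {}E2 in le3; have {}E := congr1 ( *%R t) E.
have le4 : 0 <= (nsq (jop V f) + s * nsq f) - t * nsq q by lra.
have : C * (t * nsq q) <= C * (nsq (jop V f) + s * nsq f).
  by rewrite ler_pM2l //; lra.
by rewrite mulrA Ct mul1r.
Qed.

Lemma pshift_jop V c t f :
  jop (pshift V (c + t)) f = (fun n => jop (pshift V c) f n + (- t) * f n).
Proof. by apply/funext => n; rewrite /jop /pshift; ring. Qed.

Lemma pshift_bound V c K : (forall n, `|V n| <= K) ->
  forall n, `|pshift V c n| <= K + `|c|.
Proof. by move=> VK n; rewrite (le_trans (ler_normB _ _)) // lerD2r. Qed.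

(** The infimum [m2] of |(H - c) g|^2 / |g|^2 is the squared distance m^2 from c to the spectrum,
    and c + m or c - m belongs to the spectrum: otherwise H - c - m and H - c + m are both bounded
    below, so is their product (H - c)^2 - m^2, and [qop_le] turns this into (H - c)^2 >= m^2 + k1
    k2 / C, against the choice of m. *)
Lemma rspec_near V K f c r : (forall n, `|V n| <= K) -> fsupp f ->
  (exists n, f n != 0) -> 0 <= r ->
  nsq (jop (pshift V c) f) <= r ^+ 2 * nsq f ->
  exists2 E, rspec V E & `|E - c| <= r.
Proof.
move=> VK ff f0 r0 fr.
pose W := pshift V c.
pose ratios := [set x | exists g, [/\ fsupp g, 0 < nsq g &
  x = nsq (jop W g) / nsq g]].
have nf0 : 0 < nsq f by apply: tsum_sq_gt0.
have rf : ratios (nsq (jop W f) / nsq f) by exists f.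
have lb0 : lbound ratios 0.
  by move=> _ [g [_ g0 ->]]; rewrite divr_ge0 ?nsq_ge0 // ltW.
have hinf : has_inf ratios by split; [eexists; exact: rf|exists 0].
pose m2 := inf ratios; pose m := Num.sqrt m2.
have m20 : 0 <= m2 by apply: lb_le_inf => //; eexists; exact: rf.
have mm : m ^+ 2 = m2 by rewrite sqr_sqrtr.
have m0 : 0 <= m by apply: sqrtr_ge0.
have mr : m <= r.
  rewrite -(@ler_pXn2r _ 2) ?nnegrE // mm.
  apply: le_trans (inf_lbound _ rf) _; first by exists 0.
  by rewrite ler_pdivrMr.
have WK := pshift_bound c VK.
(* [jop_bound] for the shifted potential, so that [C] dominates the form of (H - c)^2 - m^2. *)
pose C := 3 * (2 + (K + `|c|) ^+ 2) + 1.
have C0 : 0 < C by rewrite ltr_wpDl // mulr_ge0 // addr_ge0 // sqr_ge0.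
have minl g : fsupp g -> m2 * nsq g <= nsq (jop W g).
  move=> fg; have [n0|] := ltrP 0 (nsq g).
    by rewrite -ler_pdivlMr //; apply: inf_lbound; [exists 0|exists g].
  move=> n0; have -> : nsq g = 0 by apply/le_anti; rewrite n0 nsq_ge0.
  by rewrite mulr0 nsq_ge0.
have bbP E : ~ rspec V E -> exists2 k, 0 < k &
    forall g, fsupp g -> k * nsq g <= nsq (jop (pshift V E) g).
  move=> nE; apply: contrapT => H; apply: nE => k k0.
  apply: contrapT => H2; apply: H; exists k => // g fg.
  by rewrite leNgt; apply/negP => lt; apply: H2; exists g.
have [s1|/bbP[k1 k10 bb1]] := pselect (rspec V (c + m)).
  by exists (c + m) => //; rewrite addrAC subrr add0r ger0_norm.
have [s2|/bbP[k2 k20 bb2]] := pselect (rspec V (c - m)).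
  by exists (c - m) => //; rewrite addrAC subrr add0r normrN ger0_norm.
exfalso.
have qE g : jop (pshift V (c + m)) (jop (pshift V (c - m)) g) = qop W (- m2) g.
  by rewrite !pshift_jop jopDZ -mm; apply/funext => n; rewrite /qop; ring.
have low g : fsupp g -> (m2 + k1 * k2 / C) * nsq g <= nsq (jop W g).
  move=> fg.
  have h1 : nsq (qop W (- m2) g) <= C * (nsq (jop W g) + (- m2) * nsq g).
    apply: qop_le => // u fu.
      by have := minl u fu; lra.
    have := jop_bound WK fu; have := mulr_ge0 m20 (nsq_ge0 u).
    have := nsq_ge0 u; rewrite /C -/W; nra.
  have h2 := bb1 _ (fsupp_jop (pshift V (c - m)) fg); rewrite qE in h2.
  have h3 := bb2 _ fg.
  have h4 : k1 * k2 * nsq g <= C * (nsq (jop W g) + - m2 * nsq g).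
    by rewrite (le_trans _ h1) // (le_trans _ h2) // -mulrA ler_pM2l.
  have -> : (m2 + k1 * k2 / C) * nsq g = m2 * nsq g + (k1 * k2 * nsq g) / C.
    by ring.
  rewrite -lerBrDl ler_pdivrMr // (mulrC _ C) (le_trans h4) //.
  by rewrite ler_pM2l // mulNr.
have : m2 + k1 * k2 / C <= m2.
  apply: lb_le_inf; first by eexists; exact: rf.
  by move=> _ [g [fg g0 ->]]; rewrite ler_pdivlMr // low.
by rewrite gerDl leNgt divr_gt0 // mulr_gt0.
Qed.

Lemma rspec_bounded V K E : (forall n, `|V n| <= K) -> rspec V E ->
  E ^+ 2 <= 2 * (3 * (2 + K ^+ 2)) + 2.
Proof.
move=> VK /(_ 1 ltr01)[f [ff]]; rewrite mul1r => lt.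
have := @nsqD_le (jop V f) (fun n => - jop (pshift V E) f n) 1 ltr01.
move=> /(_ ltac:(fsup) ltac:(fsup)).
have -> : (fun n => jop V f n - jop (pshift V E) f n) = (fun n => E * f n).
  by apply/funext => n; rewrite /jop /pshift; ring.
rewrite nsqZ // invr1.
have -> : nsq (fun n => - jop (pshift V E) f n) = nsq (jop (pshift V E) f).
  by congr tsum; apply/funext => n; rewrite sqrrN.
have := jop_bound VK ff => h1 h2.
(* Strictness in [rspec] excludes the zero vector. *)
have f0 : 0 < nsq f by apply: le_lt_trans lt; apply: nsq_ge0.
rewrite -(ler_pM2r f0); nra.
Qed.

Lemma rspec_closed V E : (forall e, 0 < e -> exists2 E', rspec V E' & `|E' - E| <= e) ->
  rspec V E.
Proof.
move=> H k k0.
pose e := Num.sqrt (k / 4).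
have e0 : 0 < e by rewrite sqrtr_gt0 divr_gt0.
have ee : e ^+ 2 = k / 4 by rewrite sqr_sqrtr // ltW // divr_gt0.
have [E' sE' EE] := H _ e0.
have [|f [ff lt]] := sE' (k / 4); first by rewrite divr_gt0.
exists f; split => //.
have := @nsqD_le (jop (pshift V E') f) (fun n => (E' - E) * f n) 1 ltr01.
move=> /(_ ltac:(fsup) ltac:(fsup)).
have -> : (fun n => jop (pshift V E') f n + (E' - E) * f n) = jop (pshift V E) f.
  by apply/funext => n; rewrite /jop /pshift; ring.
rewrite nsqZ // invr1 => h.
have f0 : 0 < nsq f.
  rewrite -(@pmulr_rgt0 _ (k / 4)) ?divr_gt0 //.
  by apply: le_lt_trans lt; apply: nsq_ge0.
have : (E' - E) ^+ 2 <= k / 4.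
  rewrite -ee -(real_normK (num_real (E' - E))).
  by rewrite lerXn2r ?nnegrE ?normr_ge0 ?(ltW e0).
nra.
Qed.

End JacobiOperator.


(** * Resolvents by Neumann series *)

Section Neumann.
Variables (R : realType) (W : int -> R) (s K k0 : R).
Hypothesis W_bnd : forall n, `|W n| <= K.
Hypothesis s_ge0 : 0 <= s.
Hypothesis k0_gt0 : 0 < k0.
Hypothesis low : forall f, fsupp f -> k0 * nsq f <= nsq (jop W f) + s * nsq f.
Implicit Types (f g : int -> R) (N m : nat) (M : R).

(** Stands for a squared l^2 norm at most [M]; estimates for finite support pass to such sequences
    by truncation to a window. *)
Definition l2b f M := forall N, zsum N (fun n => f n ^+ 2) <= M.

(** An upper bound for H^2 + s; the summand [k0] keeps [rho] nonnegative. *)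
Let C : R := 3 * (2 + K ^+ 2) + s + k0.

Let C_gt0 : 0 < C.
Proof. by rewrite ltr_wpDl // addr_ge0 // mulr_ge0 // addr_ge0 // sqr_ge0. Qed.

Let rho : R := 1 - k0 / C.

Let rho_lt1 : rho < 1.
Proof. by rewrite ltrBlDr ltrDl divr_gt0. Qed.

Let rho_ge0 : 0 <= rho.
Proof.
rewrite subr_ge0 ler_pdivrMr // mul1r /C lerDr addr_ge0 // mulr_ge0 //.
by rewrite addr_ge0 // sqr_ge0.
Qed.

(** T = 1 - (H^2 + s) / C. Expanding |T f|^2 and applying [qop_le] leaves at most |f|^2 - Q(f) / C,
    with Q the form of H^2 + s; hence the factor [rho] for squared norms. *)
Let T f : int -> R := fun n => f n - C^-1 * qop W s f n.

Let T_fsupp f : fsupp f -> nsq (T f) <= rho * nsq f.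
Proof.
move=> ff; have -> : T f = (fun n => f n + (- C^-1) * qop W s f n).
  by apply/funext => n; rewrite /T mulNr.
have pos g : fsupp g -> 0 <= nsq (jop W g) + s * nsq g.
  by move=> fg; rewrite addr_ge0 ?mulr_ge0 ?nsq_ge0.
have bnd g : fsupp g -> nsq (jop W g) + s * nsq g <= C * nsq g.
  move=> fg; have := jop_bound W_bnd fg.
  have := mulr_ge0 (ltW k0_gt0) (nsq_ge0 g).
  by rewrite /C; lra.
have := qop_le C_gt0 pos bnd ff; have := low ff.
rewrite (@nsqDZ _ f (qop W s f)); try fsup.
have -> : tsum (fun n => f n * qop W s f n) = nsq (jop W f) + s * nsq f.
  rewrite /nsq -tsumZ -?tsumD; try fsup.
  rewrite (_ : (fun n => _ * qop W s f n) =
     (fun n => f n * jop W (jop W f) n + s * f n ^+ 2)); last first.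
    by apply/funext => n; rewrite /qop; ring.
  rewrite !tsumD; try fsup.
  by rewrite -jop_sym //; fsup.
move: (nsq (jop W f) + s * nsq f) => Q; move: (nsq (qop W s f)) (nsq f) => A F h1 h2.
rewrite /rho; have Ct : C * C^-1 = 1 by rewrite mulfV ?gt_eqF.
set t : R := C^-1 in Ct *; have t0 : 0 < t by rewrite invr_gt0.
have h3 : t ^+ 2 * A <= t ^+ 2 * (C * Q) by rewrite ler_wpM2l ?sqr_ge0.
have E2 : t ^+ 2 * (C * Q) = t * Q.
  by rewrite mulrA expr2 -(mulrA t t C) (mulrC t C) Ct mulr1.
rewrite {}E2 in h3; have h4 : t * (k0 * F) <= t * Q by rewrite ler_pM2l.
by lra.
Qed.

(** T couples sites at distance at most 2, so on the window [N] it only sees f on the window [N.+2],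
    and the truncated f has finite support. *)
Lemma zsum_qop_trunc N f : zsum N (fun n => (T f) n ^+ 2) <=
  rho * zsum N.+2 (fun n => f n ^+ 2).
Proof.
pose h n := if (`|n| <= N.+2)%N then f n else 0.
have sh : supp N.+2 h by move=> n nN; rewrite /h leqNgt nN.
have fh : fsupp h by exists N.+2.
have sh2 : supp N.+2 (fun n => h n ^+ 2) by move=> n /sh ->; rewrite expr0n.
have E : zsum N.+2 (fun n => f n ^+ 2) = nsq h.
  by rewrite /nsq (tsumE sh2); apply: eq_zsum => n nN; rewrite /h nN.
rewrite E; apply: le_trans (T_fsupp fh).
have -> : zsum N (fun n => T f n ^+ 2) = zsum N (fun n => T h n ^+ 2).
  apply: eq_zsum => n nN; rewrite /T /qop /jop /h !ifT //; lia.
have s4 : supp (N + 4) (fun n => T h n ^+ 2).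
  move=> n nN; rewrite /T /qop /jop !sh; try lia.
  by rewrite !(mulr0, addr0, subr0) expr0n.
rewrite /nsq (tsumE s4); apply: zsum_le_mono; last by lia.
by move=> n; rewrite sqr_ge0.
Qed.

Let T_l2b f M : l2b f M -> l2b (T f) (rho * M).
Proof.
by move=> fM N; rewrite (le_trans (zsum_qop_trunc N f)) // ler_wpM2l.
Qed.

Let iterT_l2b f M m : l2b f M -> l2b (iter m T f) (rho ^+ m * M).
Proof.
move=> fM; elim: m => [|m IH]; first by rewrite mul1r.
by rewrite exprS -mulrA /=; apply: T_l2b.
Qed.

Lemma l2b_pt f M n : l2b f M -> `|f n| <= Num.sqrt M.
Proof.
move=> fM; rewrite -sqrtr_sqr; apply: ler_wsqrtr.
apply: le_trans (fM `|n|%N).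
case E : `|n|%N => [|m] /=.
  by have -> : n = 0 by lia.
have zg : 0 <= zsum m (fun n => f n ^+ 2).
  by apply: zsum_ge0 => j; rewrite sqr_ge0.
have [->|h] := eqVneq n m.+1%:Z; first by rewrite addrAC lerDr addr_ge0 // sqr_ge0.
have -> : n = - m.+1%:Z by lia.
by rewrite lerDr addr_ge0 // sqr_ge0.
Qed.

(** Partial sums of the Neumann series of T, in Horner form. Their limit divided by [C], [nlim],
    inverts H^2 + s. *)
Fixpoint nsol f m : int -> R :=
  if m is j.+1 then fun n => f n + T (nsol f j) n else fun=> 0.

Let T_DZ f g a : T (fun n => a * f n + g n) = (fun n => a * T f n + T g n).
Proof. by apply/funext => n; rewrite /T /qop /jop; ring. Qed.

Let T0 : T (fun=> 0) = (fun=> 0).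
Proof. by apply/funext => n; rewrite /T /qop /jop; ring. Qed.

Let T_jop f : T (jop W f) = jop W (T f).
Proof.
apply/funext => n; rewrite {1}/T.
have -> : jop W (T f) = (fun n => jop W f n + (- C^-1) * jop W (qop W s f) n).
  by rewrite -jopDZ; congr jop; apply/funext => j; rewrite /T mulNr.
rewrite mulNr; congr (_ - _ * _); rewrite /qop.
have -> : jop W (fun n => jop W (jop W f) n + s * f n) =
  fun n => jop W (jop W (jop W f)) n + s * jop W f n by apply: jopDZ.
by [].
Qed.

Lemma nsolD f g a m :
  nsol (fun n => a * f n + g n) m = (fun n => a * nsol f m n + nsol g m n).
Proof.
elim: m => [|m IH] /=; first by apply/funext => n; rewrite mulr0 addr0.
by apply/funext => n; rewrite IH T_DZ; ring.
Qed.

(** T is a polynomial in H and commutes with it. The inverse of H^2 + s inherits this, which is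
    needed to get a left inverse of H - z as well as a right one. *)
Lemma nsol_jop f m : nsol (jop W f) m = jop W (nsol f m).
Proof.
elim: m => [|m IH] /=.
  by apply/funext => n; rewrite /jop; ring.
rewrite IH; apply/funext => n.
have -> : jop W (fun n => f n + T (nsol f m) n) =
  (fun n => jop W f n + 1 * jop W (T (nsol f m)) n).
  by rewrite -jopDZ; congr jop; apply/funext => j; rewrite mul1r.
by rewrite mul1r -T_jop.
Qed.

Let nsol_T f m : nsol (T f) m = T (nsol f m).
Proof.
elim: m => [|m IH] /=; first by rewrite T0.
rewrite IH; have -> : (fun n => f n + T (nsol f m) n) = (fun n => 1 * f n + T (nsol f m) n).
  by apply/funext => n; rewrite mul1r.
by rewrite T_DZ; apply/funext => n; rewrite mul1r.
Qed.

Let nsolS f m n : nsol f m.+1 n = nsol f m n + iter m T f n.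
Proof.
elim: m n => [|m IH] n; first by rewrite /= T0 addr0 add0r.
have E : nsol f m.+1 = (fun n => 1 * nsol f m n + iter m T f n).
  by apply/funext => j; rewrite IH mul1r.
transitivity (f n + T (nsol f m.+1) n); first by [].
by rewrite {1}E T_DZ /= mul1r addrA.
Qed.

Let nsol_series f n : (fun m => nsol f m n) = series (fun m => iter m T f n).
Proof.
apply/funext; elim=> [|m IH]; first by rewrite /series /= big_geq.
by rewrite nsolS IH seriesSr.
Qed.

Let sqrt_rho_lt1 : Num.sqrt rho < 1.
Proof. by rewrite -sqrtr1 ltr_sqrt. Qed.

Let iterT_pt f M m n : l2b f M -> 0 <= M ->
  `|iter m T f n| <= geometric (Num.sqrt M) (Num.sqrt rho) m.
Proof.
move=> fM M0; apply: le_trans (l2b_pt n (iterT_l2b m fM)) _.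
rewrite sqrtrM ?exprn_ge0 //= mulrC ler_wpM2l ?sqrtr_ge0 //.
have := sqr_sqrtr rho_ge0; set r := Num.sqrt rho => <-.
by rewrite exprAC sqrtr_sqr ger0_norm // exprn_ge0 // sqrtr_ge0.
Qed.

Let geo_cvg M : cvgn (series (geometric (Num.sqrt M) (Num.sqrt rho))).
Proof. by apply: is_cvg_geometric_series; rewrite ger0_norm ?sqrtr_ge0. Qed.

Lemma nsol_cvg f M n : l2b f M -> 0 <= M -> cvgn (fun m => nsol f m n).
Proof.
move=> fM M0; rewrite nsol_series; apply: normed_cvg.
apply: (@series_le_cvg _ _ (geometric (Num.sqrt M) (Num.sqrt rho))) => [m|m|m|] //=.
exact: (iterT_pt m n fM M0).
Qed.

Let iterT_cvg0 f M n : l2b f M -> 0 <= M ->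
  iter m T f n @[m --> \oo] --> (0 : R).
Proof.
move=> fM M0; apply: cvg_series_cvg_0.
by rewrite -nsol_series; apply: nsol_cvg fM M0.
Qed.

Definition nlim f : int -> R := fun n => limn (fun m => nsol f m n) / C.

Lemma nlimP f M n : l2b f M -> 0 <= M ->
  nsol f m n @[m --> \oo] --> C * nlim f n.
Proof.
move=> fM M0; rewrite /nlim mulrC divfK ?gt_eqF //.
exact: nsol_cvg fM M0.
Qed.

Let cvg_jop (u : nat -> int -> R) l n :
  (forall n, u m n @[m --> \oo] --> (l n : R)) ->
  jop W (u m) n @[m --> \oo] --> jop W l n.
Proof.
move=> ul; rewrite /jop.
apply: cvgD; [apply: cvgD; exact: ul|].
by apply: cvgMr; exact: ul.
Qed.

Let jopZ f a : jop W (fun n => a * f n) = fun n => a * jop W f n.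
Proof. by apply/funext => n; rewrite /jop; ring. Qed.

Lemma qop_nlim f M : l2b f M -> 0 <= M -> qop W s (nlim f) = f.
Proof.
move=> fM M0; apply/funext => n.
suff : C * qop W s (nlim f) n = C * f n by apply/mulfI; rewrite gt_eqF.
have -> : C * qop W s (nlim f) n = jop W (jop W (fun n => C * nlim f n)) n +
    s * (C * nlim f n) by rewrite !jopZ /qop; ring.
have c1 : qop W s (nsol f m) n @[m --> \oo] -->
    (jop W (jop W (fun n => C * nlim f n)) n + s * (C * nlim f n) : R).
  apply: cvgD.
    apply: cvg_jop => j; apply: cvg_jop => i; exact: nlimP fM M0.
  by apply: cvgMr; exact: nlimP fM M0.
have c2 : qop W s (nsol f m) n @[m --> \oo] --> C * f n.
  have E : (fun m => qop W s (nsol f m) n) = (fun m => C * (f n - iter m T f n)).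
    apply/funext => m.
    have : nsol f m.+1 n = f n + (nsol f m n - C^-1 * qop W s (nsol f m) n) by [].
    rewrite nsolS.
    set q := qop _ _ _ _; set i := iter _ _ _ _ => h.
    have -> : q = C * (C^-1 * q) by rewrite mulrA mulfV ?gt_eqF ?mul1r.
    by congr (_ * _); lra.
  rewrite E -[X in _ --> X]/(C * f n) -{2}(subr0 (f n)).
  apply: cvgMr; apply: cvgB; first exact: cvg_cst.
  exact: iterT_cvg0 fM M0.
exact: (cvg_unique _ c1 c2).
Qed.

Lemma nlim_qop f M : l2b f M -> 0 <= M -> nlim (qop W s f) = f.
Proof.
move=> fM M0; apply/funext => n; rewrite /nlim.
have E : (fun m => nsol (qop W s f) m n) = (fun m => C * (f n - iter m T f n)).
  apply/funext => m.
  have -> : qop W s f = (fun n => C * f n + (- C * T f n)).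
    apply/funext => j; rewrite /T mulNr mulrBr opprB addrC subrK mulrA.
    by rewrite mulfV ?mul1r ?gt_eqF.
  have -> : (fun n => C * f n + - C * T f n) = (fun n => C * f n + (- C * T f n + 0)).
    by apply/funext => j; rewrite addr0.
  have n0 : nsol (fun=> 0) m = fun=> 0.
    by elim: m => //= m ->; rewrite T0; apply/funext => j; rewrite addr0.
  rewrite !nsolD n0 nsol_T.
  have : nsol f m.+1 n = f n + T (nsol f m) n by [].
  by rewrite nsolS => h; rewrite addr0 mulNr -mulrBr; congr (_ * _); lra.
rewrite E.
have c : C * (f n - iter m T f n) @[m --> \oo] --> C * f n.
  rewrite -{2}(subr0 (f n)).
  apply: cvgMr; apply: cvgB; first exact: cvg_cst.
  exact: iterT_cvg0 fM M0.
by rewrite (cvg_lim _ c) // mulrC mulKf // gt_eqF.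
Qed.

Lemma nlimD f g a M : l2b f M -> l2b g M -> 0 <= M ->
  nlim (fun n => a * f n + g n) = fun n => a * nlim f n + nlim g n.
Proof.
move=> fM gM M0; apply/funext => n; rewrite /nlim.
have -> : (fun m => nsol (fun n => a * f n + g n) m n) =
  (fun m => a * nsol f m n + nsol g m n) by apply/funext => m; rewrite nsolD.
have c : a * nsol f m n + nsol g m n @[m --> \oo] -->
    (a * (C * nlim f n) + C * nlim g n : R).
  by apply: cvgD; [apply: cvgMr|]; [exact: nlimP fM M0|exact: nlimP gM M0].
rewrite (cvg_lim _ c) // /nlim; field.
by rewrite gt_eqF.
Qed.

Lemma nlim_jop f M : l2b f M -> 0 <= M -> nlim (jop W f) = jop W (nlim f).
Proof.
move=> fM M0; apply/funext => n; rewrite {1}/nlim.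
have -> : (fun m => nsol (jop W f) m n) = (fun m => jop W (nsol f m) n).
  by apply/funext => m; rewrite nsol_jop.
have c : jop W (nsol f m) n @[m --> \oo] --> jop W (fun n => C * nlim f n) n.
  by apply: cvg_jop => i; exact: nlimP fM M0.
by rewrite (cvg_lim _ c) // jopZ mulrC mulKf // gt_eqF.
Qed.

Lemma zsum_cvg N (u : nat -> int -> R) l :
  (forall n, u m n @[m --> \oo] --> (l n : R)) ->
  zsum N (u m) @[m --> \oo] --> zsum N l.
Proof. by move=> ul; elim: N => [|N IH] /=; [exact: ul|do 2?apply: cvgD]. Qed.

Lemma nlim_bound : exists2 B, 0 <= B &
  forall f M, l2b f M -> 0 <= M -> l2b (nlim f) (B * M).
Proof.
(* Chosen so that (1 + t) rho = (1 + rho) / 2 < 1; for rho = 0 the quotient would be 0, hence the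
   separate value. *)
pose t := if rho == 0 then 1 else (1 - rho) / (2 * rho).
have t0 : 0 < t.
  rewrite /t; case: ifP => // /negbT r0; rewrite divr_gt0 ?subr_gt0 //.
  by rewrite mulr_gt0 // lt_def r0.
pose r1 := (1 + t) * rho.
have r1_lt : r1 < 1.
  rewrite /r1 /t; case: ifP => [/eqP ->|/negbT r0]; first by rewrite mulr0.
  have rp : 0 < rho by rewrite lt_def r0.
  have -> : (1 + (1 - rho) / (2 * rho)) * rho = (1 + rho) / 2 by field.
  by rewrite ltr_pdivrMr //; have := rho_lt1; lra.
(* The fixed point of b -> (1 + 1/t) + r1 b, the recursion that [sqrD_le] gives for the squared
   norms of the partial sums. *)
pose B1 := (1 + t^-1) / (1 - r1).
have B10 : 0 <= B1.
  by rewrite divr_ge0 ?subr_ge0 ?(ltW r1_lt) // addr_ge0 // invr_ge0 ltW.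
exists (B1 / C ^+ 2); first by rewrite divr_ge0 // sqr_ge0.
move=> f M fM M0.
have sm m : l2b (nsol f m) (B1 * M).
  elim: m => [|m IH] N.
    rewrite (_ : (fun n => nsol f 0 n ^+ 2) = (fun=> 0)) ?zsum0 1?mulr_ge0 //.
    by apply/funext => n; rewrite /= expr0n.
  have h1 : zsum N (fun n => nsol f m.+1 n ^+ 2) <=
      (1 + t^-1) * zsum N (fun n => f n ^+ 2) +
      (1 + t) * zsum N (fun n => T (nsol f m) n ^+ 2).
    rewrite -!zsumZ -zsumD; apply: le_zsum => n _ /=.
    exact: sqrD_le.
  apply: (le_trans h1).
  have h2 := T_l2b IH N; have h3 := fM N.
  apply: (@le_trans _ _ ((1 + t^-1) * M + (1 + t) * (rho * (B1 * M)))).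
    by rewrite lerD // ler_wpM2l // addr_ge0 // ?invr_ge0 ltW.
  suff -> : (1 + t^-1) * M + (1 + t) * (rho * (B1 * M)) = B1 * M by [].
  have -> : 1 + t^-1 = (1 - r1) * B1.
    by rewrite /B1 mulrC divfK // subr_eq0 gt_eqF.
  by rewrite /r1; ring.
move=> N.
have c : zsum N (fun n => nsol f m n ^+ 2) @[m --> \oo] -->
    zsum N (fun n => (C * nlim f n) ^+ 2).
  by apply: zsum_cvg => n; apply: cvgM; exact: nlimP fM M0.
have : zsum N (fun n => (C * nlim f n) ^+ 2) <= B1 * M.
  rewrite -(cvg_lim _ c) //; apply: limr_le; first by apply: cvgP c.
  by apply: nearW => m; exact: sm.
rewrite (_ : (fun n => (C * nlim f n) ^+ 2) = (fun n => C ^+ 2 * nlim f n ^+ 2)); last first.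
  by apply/funext => n; rewrite exprMn.
by rewrite zsumZ mulrC -ler_pdivlMr ?exprn_gt0 // mulrAC.
Qed.

End Neumann.

(** * The l^2 spectrum in terms of finitely supported vectors *)

Section Spectrum.
Local Notation Re := complex.Re.
Local Notation Im := complex.Im.
Variable R : realType.
Implicit Types (V : int -> R) (psi : int -> R[i]) (N : nat) (f g : int -> R).
Local Open Scope complex_scope.

Fixpoint zlist N : seq int :=
  if N is M.+1 then N%:Z :: - N%:Z :: zlist M else [:: 0].

Lemma mem_zlist N (n : int) : (n \in zlist N) = (`|n| <= N)%N.
Proof.
elim: N => [|N IH]; rewrite !inE ?IH; first by lia.
by apply/idP/idP; lia.
Qed.

Lemma zlist_uniq N : uniq (zlist N).
Proof.
elim: N => //= N ->; rewrite !inE !mem_zlist !andbT.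
by apply/andP; split; lia.
Qed.

Lemma zsum_zlist N f : zsum N f = \sum_(n <- zlist N) f n.
Proof.
elim: N => [|N IH]; first by rewrite big_seq1.
by rewrite [LHS]/= IH /= !big_cons; ring.
Qed.

(** Every finite set of integers lies in a window, so unordered sums of nonnegative terms are
    suprema of window sums. *)
Lemma esum_zsum f K : (forall n, 0 <= f n) ->
  (\esum_(n in [set: int]) (f n)%:E <= K%:E)%E <-> (forall N, zsum N f <= K).
Proof.
move=> f0; have zs N : (zsum N f)%:E = (\sum_(n \in [set` zlist N]) (f n)%:E)%E.
  rewrite fsumEFin; last exact: finite_seq.
  by rewrite zsum_zlist (fsbig_seq _ _ (zlist_uniq N)).
split => [le N|le].
  rewrite -lee_fin (le_trans _ le) // zs.
  apply: esum_ge; exists [set` zlist N] => //.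
  by split => //; exact: finite_seq.
rewrite /esum; apply: ge_ereal_sup => _ [A [fA _] <-].
have [N AN] : exists N, forall n, A n -> (`|n| <= N)%N.
  have [s ->] := (finite_seqP A).1 fA.
  elim: s => [|x s [N IH]]; first by exists 0%N.
  exists (maxn `|x| N) => n /=; rewrite inE => /orP[/eqP -> | /IH]; lia.
apply: le_trans (_ : ((zsum N f)%:E <= K%:E)%E); last by rewrite lee_fin.
rewrite zs; apply: lee_fsum_nneg_subset => //; first exact: finite_seq.
- by move=> n; rewrite !inE => /AN; rewrite -mem_zlist.
- by move=> n _; rewrite lee_fin.
Qed.

Lemma normc_sqr (z : R[i]) : Normc.normc z ^+ 2 = Re z ^+ 2 + Im z ^+ 2.
Proof. by case: z => a b /=; rewrite sqr_sqrtr // addr_ge0 // sqr_ge0. Qed.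

Lemma l2normsq_le psi K : (l2normsq psi <= K%:E)%E <->
  (forall N, zsum N (fun n => Re (psi n) ^+ 2) + zsum N (fun n => Im (psi n) ^+ 2) <= K).
Proof.
rewrite /l2normsq esum_zsum => [|n]; last by rewrite sqr_ge0.
split=> H N; have := H N.
  by rewrite -zsumD; under eq_zsum do rewrite normc_sqr.
by rewrite -zsumD; under [X in _ -> X <= _]eq_zsum do rewrite normc_sqr.
Qed.

Lemma l2normsq_ge0 psi : (0 <= l2normsq psi)%E.
Proof. by apply: esum_ge0 => n _; rewrite lee_fin sqr_ge0. Qed.

Lemma l2_l2b psi : l2 psi -> exists M, [/\ 0 <= M, l2b (fun n => Re (psi n)) M,
  l2b (fun n => Im (psi n)) M & l2normsq psi = M%:E].
Proof.
rewrite /l2 /= => h.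
have fin : l2normsq psi \is a fin_num by rewrite ge0_fin_numE // l2normsq_ge0.
exists (fine (l2normsq psi)).
have := proj1 (l2normsq_le psi (fine (l2normsq psi))).
rewrite fineK // => /(_ (lexx _)) H.
split => // [|N|N]; first by rewrite fine_ge0 // l2normsq_ge0.
- by apply: le_trans (H N); rewrite lerDl; apply: zsum_ge0 => n; rewrite sqr_ge0.
- by apply: le_trans (H N); rewrite lerDr; apply: zsum_ge0 => n; rewrite sqr_ge0.
Qed.

Lemma l2b_comb f g (a b M : R) : l2b f M -> l2b g M ->
  l2b (fun n => a * f n + b * g n) (2 * (a ^+ 2 + b ^+ 2) * M).
Proof.
move=> fM gM N.
apply: (@le_trans _ _ (2 * a ^+ 2 * zsum N (fun n => f n ^+ 2) +
    2 * b ^+ 2 * zsum N (fun n => g n ^+ 2))).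
  rewrite -!zsumZ -zsumD; apply: le_zsum => n _.
  rewrite -subr_ge0.
  have -> : 2 * a ^+ 2 * f n ^+ 2 + 2 * b ^+ 2 * g n ^+ 2 -
    (a * f n + b * g n) ^+ 2 = (a * f n - b * g n) ^+ 2 by ring.
  by rewrite sqr_ge0.
have -> : 2 * (a ^+ 2 + b ^+ 2) * M = 2 * a ^+ 2 * M + 2 * b ^+ 2 * M by ring.
have c0 (c : R) : 0 <= 2 * c ^+ 2 by rewrite mulr_ge0 // sqr_ge0.
by apply: lerD; apply: ler_wpM2l.
Qed.

Lemma l2b_jop V f (K M : R) : (forall n, `|V n| <= K) -> l2b f M ->
  l2b (jop V f) (3 * (2 + K ^+ 2) * M).
Proof.
move=> VK fM N.
pose h n := if (`|n| <= N.+1)%N then f n else 0.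
have sh : supp N.+1 h by move=> n nN; rewrite /h leqNgt nN.
have fh : fsupp h by exists N.+1.
have sh2 : supp N.+1 (fun n => h n ^+ 2) by move=> n /sh ->; rewrite expr0n.
apply: (@le_trans _ _ (3 * (2 + K ^+ 2) * nsq h)); last first.
  rewrite ler_wpM2l ?mulr_ge0 ?addr_ge0 ?sqr_ge0 //.
  rewrite /nsq (tsumE sh2); apply: le_trans (fM N.+1).
  by apply: le_zsum => n _; rewrite /h; case: ifP; rewrite ?expr0n ?sqr_ge0.
apply: le_trans (jop_bound VK fh).
have -> : zsum N (fun n => jop V f n ^+ 2) = zsum N (fun n => jop V h n ^+ 2).
  by apply: eq_zsum => n nN; rewrite /jop /h !ifT //; lia.
have s4 : supp N.+2 (fun n => jop V h n ^+ 2).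
  move=> n nN; rewrite /jop !sh; try lia.
  by rewrite !(mulr0, addr0, subr0) expr0n.
rewrite /nsq (tsumE s4); apply: zsum_le_mono; last by lia.
by move=> n; rewrite sqr_ge0.
Qed.

Definition cop V psi : int -> R[i] :=
  fun n => psi (n - 1) + psi (n + 1) + (V n)%:C * psi n.

Definition cfun f g : int -> R[i] := fun n => f n +i* g n.

Lemma cfunE psi : psi = cfun (fun n => Re (psi n)) (fun n => Im (psi n)).
Proof. by apply/funext => n; rewrite /cfun; case: (psi n). Qed.

(** Real and imaginary parts are coupled only through Im z; the factors 1 put both components into
    the shape required by [l2b_comb]. *)
Lemma cop_cfun V f g (z : R[i]) :
  (fun n => cop V (cfun f g) n - z * cfun f g n) =
  cfun (fun n => 1 * jop (pshift V (Re z)) f n + Im z * g n)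
       (fun n => 1 * jop (pshift V (Re z)) g n + (- Im z) * f n).
Proof.
apply/funext => n; case: z => a b; rewrite /cop /cfun /jop /pshift /=.
by congr (_ +i* _); rewrite /=; ring.
Qed.

Lemma l2normsq_cfun_le f g (M : R) : l2b f M -> l2b g M ->
  (l2normsq (cfun f g) <= (2 * M)%:E)%E.
Proof.
by move=> fM gM; apply/l2normsq_le => N; rewrite mulr2n mulrDl mul1r lerD.
Qed.

(** With z = E + iy, (H - E - iy)(H - E + iy) = (H - E)^2 + y^2. If G inverts the right-hand side,
    the resolvent is [B] = (H - E + iy) G; G is a real operator and acts on real and imaginary parts
    separately. *)
Lemma resolvent_of_low V (K k0 : R) (z : R[i]) : (forall n, `|V n| <= K) -> 0 < k0 ->
  (forall f, fsupp f ->
     k0 * nsq f <= nsq (jop (pshift V (Re z)) f) + Im z ^+ 2 * nsq f) ->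
  resolvent_set (cop V) z.
Proof.
move=> VK k00 low.
set E := Re z in low *; set y := Im z in low *; pose W := pshift V E.
pose K1 := K + `|E|.
have WK : forall n, `|W n| <= K1 by exact: pshift_bound.
have y0 : 0 <= y ^+ 2 by rewrite sqr_ge0.
pose G := nlim W (y ^+ 2) K1 k0.
have [Bn Bn0 GB] := nlim_bound WK y0 k00 low.
pose re psi : int -> R := fun n => Re (psi n).
pose im psi : int -> R := fun n => Im (psi n).
have GD f g a M : l2b f M -> l2b g M -> 0 <= M ->
  G (fun n => a * f n + g n) = fun n => a * G f n + G g n.
  exact: nlimD.
have GJ f M : l2b f M -> 0 <= M -> G (jop W f) = jop W (G f) by exact: nlim_jop.
have QG f M : l2b f M -> 0 <= M -> qop W (y ^+ 2) (G f) = f by exact: qop_nlim.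
have GQ f M : l2b f M -> 0 <= M -> G (qop W (y ^+ 2) f) = f by exact: nlim_qop.
pose B psi := cfun
  (fun n => 1 * jop W (G (re psi)) n + (- y) * G (im psi) n)
  (fun n => 1 * jop W (G (im psi)) n + y * G (re psi) n).
exists B; split.
- move=> a f g /l2_l2b[M [M0 f1 f2 _]] /l2_l2b[M' [M'0 g1 g2 _]].
  (* [nlimD] asks for one bound common to both sequences; this crude one covers f, g and every
     combination of their parts that occurs. *)
  pose M2 := (`|Re a| + `|Im a| + 1) ^+ 2 * 4 * (M + M').
  have M20 : 0 <= M2 by rewrite mulr_ge0 ?addr_ge0 // mulr_ge0 // sqr_ge0.
  have mono (h : int -> R) (u w : R) : l2b h u -> u <= w -> l2b h w.
    by move=> hu uw N; apply: le_trans (hu N) uw.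
  have Mle : M <= M2 /\ M' <= M2.
    have h1 : 1 <= (`|Re a| + `|Im a| + 1) ^+ 2 * 4.
      have := normr_ge0 (Re a); have := normr_ge0 (Im a); nra.
    by split; rewrite /M2; nra.
  have f1' := mono _ _ _ f1 Mle.1; have f2' := mono _ _ _ f2 Mle.1.
  have g1' := mono _ _ _ g1 Mle.2; have g2' := mono _ _ _ g2 Mle.2.
  have mix (c : R) (h k : int -> R) : `|c| <= `|Re a| + `|Im a| ->
     l2b h M -> l2b k M' -> l2b (fun n => c * h n + k n) M2.
    move=> ca hM kM.
    have hM' := mono _ _ (M + M') hM ltac:(lra).
    have kM' := mono _ _ (M + M') kM ltac:(lra).
    have := l2b_comb c 1 hM' kM'.
    rewrite (_ : (fun n => c * h n + 1 * k n) = (fun n => c * h n + k n)).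
      move=> H; apply: (mono _ _ _ H); rewrite /M2 ler_wpM2r ?addr_ge0 //.
      have c2 : c ^+ 2 <= (`|Re a| + `|Im a| + 1) ^+ 2.
        rewrite -(real_normK (num_real c)) lerXn2r ?nnegrE ?addr_ge0 //; lra.
      have : 1 <= (`|Re a| + `|Im a| + 1) ^+ 2.
        have := normr_ge0 (Re a); have := normr_ge0 (Im a); nra.
      by rewrite expr1n; lra.
    by apply/funext => n; rewrite mul1r.
  have ra : `|Re a| <= `|Re a| + `|Im a| by rewrite lerDl.
  have ia : `|- Im a| <= `|Re a| + `|Im a| by rewrite normrN lerDr.
  have ia' : `|Im a| <= `|Re a| + `|Im a| by rewrite lerDr.
  have E1 : G (re (fun n => a * f n + g n)) =
      fun n => Re a * G (re f) n + (- Im a * G (im f) n + G (re g) n).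
    rewrite (_ : re _ = fun n => Re a * re f n + (- Im a * im f n + re g n)).
      rewrite (GD _ _ _ M2) //; last exact: mix.
      by rewrite (GD _ _ _ M2).
    apply/funext => n; rewrite /re /im; case: (a) (f n) (g n) => [a1 a2] [u1 u2] [w1 w2] /=.
    by ring.
  have E2 : G (im (fun n => a * f n + g n)) =
      fun n => Re a * G (im f) n + (Im a * G (re f) n + G (im g) n).
    rewrite (_ : im _ = fun n => Re a * im f n + (Im a * re f n + im g n)).
      rewrite (GD _ _ _ M2) //; last exact: mix.
      by rewrite (GD _ _ _ M2).
    apply/funext => n; rewrite /re /im; case: (a) (f n) (g n) => [a1 a2] [u1 u2] [w1 w2] /=.
    by ring.
  rewrite /B E1 E2; apply/funext => n; rewrite /cfun /jop.
  by case: (a) => a1 a2 /=; congr (_ +i* _); ring.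
- exists (2 * (2 * (1 + y ^+ 2) * (3 * (2 + K1 ^+ 2) * Bn + Bn))) => f.
  move=> /l2_l2b[M [M0 f1 f2 ->]]; set X : R := 3 * (2 + K1 ^+ 2) * Bn + Bn.
  rewrite -EFinM (_ : _ * M = 2 * (2 * (1 + y ^+ 2) * (X * M))); last by ring.
  have H g : l2b g M -> l2b (jop W (G g)) (X * M) /\ l2b (G g) (X * M).
    move=> gM; have b := GB _ _ gM M0.
    have BM : 0 <= Bn * M by rewrite mulr_ge0.
    have c0 : 0 <= 3 * (2 + K1 ^+ 2) * Bn * M.
      by rewrite !mulr_ge0 // addr_ge0 // sqr_ge0.
    split=> N.
      apply: le_trans (l2b_jop WK b N) _; rewrite /X; lra.
    by apply: le_trans (b N) _; rewrite /X; lra.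
  have [H1 H2] := H _ f1; have [H3 H4] := H _ f2.
  rewrite /B; apply: l2normsq_cfun_le.
    by have := l2b_comb 1 (- y) H1 H4; rewrite expr1n sqrrN.
  by have := l2b_comb 1 y H3 H2; rewrite expr1n.
- move=> f /l2_l2b[M [M0 f1 f2 _]].
  rewrite cop_cfun -/E -/y -/W [RHS]cfunE.
  have H1 := QG _ _ f1 M0; have H2 := QG _ _ f2 M0.
  congr cfun; [rewrite -{1}H1|rewrite -{1}H2]; apply/funext => n.
    by rewrite /qop /jop /re /im; ring.
  by rewrite /qop /jop /re /im; ring.
- move=> f /l2_l2b[M [M0 f1 f2 _]].
  have fE : cfun (re f) (im f) = f by rewrite [RHS]cfunE.
  have := cop_cfun V (re f) (im f) z; rewrite fE -/E -/y -/W => ->.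
  rewrite -[RHS]fE.
  have j1 := l2b_jop WK f1; have j2 := l2b_jop WK f2.
  pose M2 := 2 * (1 + y ^+ 2) * (3 * (2 + K1 ^+ 2) * M + M).
  have c0 : 0 <= 3 * (2 + K1 ^+ 2) * M.
    by rewrite !mulr_ge0 // addr_ge0 // sqr_ge0.
  have M20 : 0 <= M2 by rewrite mulr_ge0 ?addr_ge0 // mulr_ge0 // addr_ge0.
  have mono (h : int -> R) (u w : R) : l2b h u -> u <= w -> l2b h w.
    by move=> hu uw N; apply: le_trans (hu N) uw.
  have k1 : l2b (fun n => 1 * jop W (re f) n + y * im f n) M2.
    have := l2b_comb 1 y (mono _ _ (3 * (2 + K1 ^+ 2) * M + M) j1 ltac:(lra))
      (mono _ _ (3 * (2 + K1 ^+ 2) * M + M) f2 ltac:(lra)).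
    by rewrite expr1n.
  have k2 : l2b (fun n => 1 * jop W (im f) n + - y * re f n) M2.
    have := l2b_comb 1 (- y) (mono _ _ (3 * (2 + K1 ^+ 2) * M + M) j2 ltac:(lra))
      (mono _ _ (3 * (2 + K1 ^+ 2) * M + M) f1 ltac:(lra)).
    by rewrite expr1n sqrrN.
  set u1 := (fun n => 1 * jop W (re f) n + y * im f n) in k1 *.
  set u2 := (fun n => 1 * jop W (im f) n + - y * re f n) in k2 *.
  have j1' := l2b_jop WK k1; have j2' := l2b_jop WK k2.
  have M30 : 0 <= 3 * (2 + K1 ^+ 2) * M2.
    by rewrite !mulr_ge0 // addr_ge0 // sqr_ge0.
  have E1 : re (cfun u1 u2) = u1 by [].
  have E2 : im (cfun u1 u2) = u2 by [].
  rewrite /B E1 E2 -!(GJ _ M2) //.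
  have big h : l2b h (3 * (2 + K1 ^+ 2) * M2) ->
    l2b h (3 * (2 + K1 ^+ 2) * M2 + M2) by move=> H; apply: (mono _ _ _ H); lra.
  have big' h : l2b h M2 ->
    l2b h (3 * (2 + K1 ^+ 2) * M2 + M2) by move=> H; apply: (mono _ _ _ H); lra.
  have MM : 0 <= 3 * (2 + K1 ^+ 2) * M2 + M2 by lra.
  congr cfun.
    transitivity (fun n => (- y) * G u2 n + G (jop W u1) n).
      by apply/funext => n; rewrite mul1r addrC.
    rewrite -(GD _ _ _ _ (big' _ k2) (big _ j1')) //.
    rewrite -[RHS](GQ _ _ f1 M0); congr G; apply/funext => n.
    by rewrite /u1 /u2 /qop /jop /re /im; ring.
  transitivity (fun n => y * G u1 n + G (jop W u2) n).
    by apply/funext => n; rewrite mul1r addrC.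
  rewrite -(GD _ _ _ _ (big' _ k1) (big _ j2')) //.
  rewrite -[RHS](GQ _ _ f2 M0); congr G; apply/funext => n.
  by rewrite /u1 /u2 /qop /jop /re /im; ring.
Qed.

(** Off the real axis, y^2 itself is a lower bound for (H - E)^2 + y^2; on the axis, the failure of
    [rspec] provides one. Conversely, a bounded inverse is contradicted by a vector with |(H - E)
    f|^2 < |f|^2 / M1, where [M1] is a positive bound on its squared norm. *)
Lemma l2_spectrumP V (K : R) (z : R[i]) : (forall n, `|V n| <= K) ->
  l2_spectrum (cop V) z <-> Im z = 0 /\ rspec V (Re z).
Proof.
move=> VK; split => [sp|[y0 sp] [B [_ [M BM] _ BT]]].
  apply: contrapT => H; apply: sp.
  have [y0|y0] := eqVneq (Im z) 0; last first.
    apply: (resolvent_of_low (k0 := Im z ^+ 2) VK) => [|f ff].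
      by rewrite lt_def sqr_ge0 sqrf_eq0 y0.
    by rewrite lerDr nsq_ge0.
  have [k [k0 low]] : exists k, 0 < k /\
      forall f, fsupp f -> k * nsq f <= nsq (jop (pshift V (Re z)) f).
    apply: contrapT => H2; apply: H; split => // k k0.
    apply: contrapT => H3; apply: H2; exists k; split => // f ff.
    by rewrite leNgt; apply/negP => lt; apply: H3; exists f.
  apply: (resolvent_of_low (k0 := k) VK) => // f ff.
  by rewrite (le_trans (low f ff)) // lerDl mulr_ge0 ?sqr_ge0 ?nsq_ge0.
pose M1 := `|M| + 1.
have M10 : 0 < M1 by rewrite ltr_wpDl.
have [|f [ff lt]] := sp M1^-1; first by rewrite invr_gt0.
have zs N (h : int -> R) : fsupp h -> zsum N (fun n => h n ^+ 2) <= nsq h.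
  move=> [N' hN].
  have h2 : supp (maxn N N') (fun n => h n ^+ 2).
    by move=> n nN; rewrite hN ?expr0n //; lia.
  rewrite /nsq (tsumE h2); apply: zsum_le_mono; last exact: leq_maxl.
  by move=> n; rewrite sqr_ge0.
pose z0 : int -> R := fun=> 0.
have ln h : fsupp h -> (l2normsq (cfun h z0) <= (nsq h)%:E)%E.
  move=> fh; apply/l2normsq_le => N.
  rewrite /cfun /= (_ : (fun n => z0 n ^+ 2) = z0) ?zsum0 ?addr0 ?zs //.
  by apply/funext => n; rewrite /z0 expr0n.
have l2h h : fsupp h -> l2 (cfun h z0).
  by move=> fh; rewrite /l2 /=; apply: le_lt_trans (ln _ fh) _; rewrite ltry.
have E1 := BT _ (l2h _ ff).
have E2 : (fun n => cop V (cfun f z0) n - z * cfun f z0 n) =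
    cfun (jop (pshift V (Re z)) f) z0.
  rewrite cop_cfun y0; congr cfun; apply/funext => n.
    by rewrite mul1r mul0r addr0.
  by rewrite /jop /z0 !(oppr0, mul0r, mulr0, addr0).
rewrite E2 in E1; set h := jop _ _ in E1 lt E2.
have fh : fsupp h by fsup.
have := BM _ (l2h _ fh); rewrite E1 => le1.
have le2 : (l2normsq (cfun f z0) <= (M1 * nsq h)%:E)%E.
  apply: (le_trans le1); rewrite EFinM.
  apply: (@le_trans _ _ (M1%:E * l2normsq (cfun h z0))%E).
    rewrite lee_wpmul2r ?l2normsq_ge0 // lee_fin /M1.
    by rewrite (le_trans (ler_norm _)) // lerDl.
  by rewrite lee_wpmul2l ?ln // lee_fin ltW.
have [N fN] := ff.
have := proj1 (l2normsq_le _ _) le2 N.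
have f2 : supp N (fun n => f n ^+ 2) by move=> n nN; rewrite fN // expr0n.
rewrite /cfun /= (_ : (fun n => z0 n ^+ 2) = z0); last first.
  by apply/funext => n; rewrite /z0 expr0n.
rewrite zsum0 addr0 -(tsumE f2) -/(nsq f) leNgt => /negP; apply.
by rewrite mulrC -ltr_pdivlMr // mulrC.
Qed.

End Spectrum.

(** * Continuous periodic functions and semicontinuity of the spectrum *)

Section PeriodicFunctions.
Variable R : realType.
Implicit Types (v r : R -> R) (e : R).

Lemma segment_finite_cover (a b : R) r : (forall x, 0 < r x) ->
  exists s : seq R, forall y, a <= y <= b -> exists2 x, x \in s & `|y - x| < r x.
Proof.
move=> r0; have := @segment_compact R a b; rewrite compact_cover.
move=> /(_ R setT (fun x => ball x (r x))) [].
- by move=> x _; apply: ball_open.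
- by move=> x _; exists x => //; apply: ballxx.
move=> D _ H; exists (enum_fset D) => y yab.
have [|x xD] := H y; first by rewrite /= in_itv.
by rewrite /ball /= distrC; exists x.
Qed.

Lemma floorR_gt (x : R) : x < (Num.floor x)%:~R + 1.
Proof. by have := floorD1_gt x; rewrite intrD. Qed.

Lemma seq_min_pos (s : seq R) r : (forall x, 0 < r x) ->
  exists2 d, 0 < d & forall x, x \in s -> d <= r x.
Proof.
move=> r0; elim: s => [|x s [d d0 IH]]; first by exists 1.
exists (Num.min d (r x)); first by rewrite lt_min d0 r0.
move=> y; rewrite inE => /orP[/eqP -> |/IH h]; first by rewrite ge_min lexx orbT.
by rewrite ge_min h.
Qed.

Lemma seq_max_ub (s : seq R) r : exists M, forall x, x \in s -> r x <= M.
Proof.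
elim: s => [|x s [M IH]]; first by exists 0.
exists (Num.max M (r x)) => y; rewrite inE => /orP[/eqP -> |/IH h].
  by rewrite le_max lexx orbT.
by rewrite le_max h.
Qed.

Lemma torus_fun_int v (x : R) (k : int) : torus_fun v -> v (x + k%:~R) = v x.
Proof.
move=> vp; have vn (n : nat) y : v (y + n%:R) = v y.
  elim: n y => [|n IH] y; first by rewrite addr0.
  by rewrite -natr1 addrA vp.
case: (intP k) => [|n|n]; first by rewrite addr0.
  exact: vn.
by rewrite -(vn n.+1 (x + _)) mulrNz -pmulrn subrK.
Qed.

Lemma torus_fun_unif v : torus_fun v -> continuous v ->
  forall e, 0 < e -> exists2 d, 0 < d & forall x y, `|x - y| < d -> `|v x - v y| < e.
Proof.
move=> vp vc e e0.
(* The factor 2 leaves a point within d of x a margin d for its own neighbour. *)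
have H (x : R) : exists d, 0 < d /\ forall y, `|y - x| < 2 * d -> `|v y - v x| < e / 2.
  have e2 : 0 < e / 2 by rewrite divr_gt0.
  have /cvgrPdist_lt /(_ _ e2) := vc x.
  move=> /nbhs_ballP [d /= d0 dH]; exists (d / 2); split; first by rewrite divr_gt0.
  move=> y xy; rewrite distrC; apply: dH; rewrite /ball /= distrC.
  by apply: lt_le_trans xy _; rewrite mulrC divfK.
have [r rH] := choice H.
have r0 x : 0 < r x by have [] := rH x.
have [s sH] := segment_finite_cover 0 1 r0.
have [d d0 dH] := seq_min_pos s r0.
exists d => // x y xy.
pose k := Num.floor x.
have vk z : v z = v (z - k%:~R).
  by rewrite -[LHS](torus_fun_int _ (- k)) // mulrNz.
(* Both points move by the integer part of x; only x has to end up in [0, 1]. *)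
rewrite (vk x) (vk y).
have [|t ts xt] := sH (x - k%:~R).
  by rewrite subr_ge0 floor_le lerBlDr addrC ltW // floorR_gt.
have rt := dH _ ts.
have h1 : `|v (x - k%:~R) - v t| < e / 2.
  by apply: (rH t).2; apply: lt_trans xt _; have := r0 t; lra.
have h2 : `|v (y - k%:~R) - v t| < e / 2.
  apply: (rH t).2.
  have -> : y - k%:~R - t = (x - k%:~R - t) - (x - y) by ring.
  by apply: le_lt_trans (ler_normB _ _) _; lra.
have -> : v (x - k%:~R) - v (y - k%:~R) =
  (v (x - k%:~R) - v t) - (v (y - k%:~R) - v t) by ring.
by apply: le_lt_trans (ler_normB _ _) _; lra.
Qed.

Lemma torus_fun_bounded v : torus_fun v -> continuous v ->
  exists K, forall x, `|v x| <= K.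
Proof.
move=> vp vc; have [d d0 dH] := torus_fun_unif vp vc ltr01.
have [s sH] := segment_finite_cover 0 1 (fun=> d0).
have [M MH] := seq_max_ub s (fun x => `|v x|).
exists (M + 1) => x; pose k := Num.floor x.
have -> : v x = v (x - k%:~R).
  by rewrite -[LHS](torus_fun_int _ (- k)) // mulrNz.
have [|t ts xt] := sH (x - k%:~R).
  by rewrite subr_ge0 floor_le lerBlDr addrC ltW // floorR_gt.
have := dH _ _ xt; have := MH _ ts.
have : `|v (x - k%:~R)| <= `|v t| + `|v (x - k%:~R) - v t|.
  by rewrite -{1}(subrK (v t) (v (x - k%:~R))) addrC ler_normD.
lra.
Qed.

(** Pigeonhole on the fractional parts of alpha i, i < N + 2, gives a step b = alpha j - k with |b|
    < e, nonzero by irrationality; some multiple of b comes within |b| of x. Since m ranges over Z,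
    the sign of b does not matter. *)
Lemma irrational_orbit_dense (alpha x e : R) : irrational alpha -> 0 < e ->
  exists m k : int, `|alpha * m%:~R - x - k%:~R| < e.
Proof.
move=> ai e0.
suff [j [k [b0 be]]] : exists j k : int, let b := alpha * j%:~R - k%:~R in b != 0 /\ `|b| < e.
  set b := alpha * j%:~R - k%:~R in b0 be.
  pose m := Num.floor (x / b).
  exists (j * m), (k * m).
  have -> : alpha * (j * m)%:~R - x - (k * m)%:~R = - b * (x / b - m%:~R).
    by rewrite mulrBr mulNr mulrCA mulfV // mulr1 !intrM /b; ring.
  rewrite normrM normrN.
  apply: le_lt_trans be; rewrite ler_piMr // ger0_norm.
    by rewrite lerBlDr addrC ltW // floorR_gt.
  by rewrite subr_ge0 floor_le.
have [N N1] : exists N : nat, N.+1%:R^-1 < e.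
  exists (Num.truncn e^-1).
  rewrite invf_plt ?posrE //.
  exact: truncnS_gt.
pose fr (i : nat) := alpha * i%:R - (Num.floor (alpha * i%:R))%:~R.
have fr0 i : 0 <= fr i by rewrite subr_ge0 floor_le.
have fr1 i : fr i < 1 by rewrite ltrBlDr addrC floorR_gt.
pose bin (i : 'I_N.+2) : 'I_N.+1 := inord (Num.truncn (fr i * N.+1%:R)).
have bE i : (bin i : nat) = Num.truncn (fr i * N.+1%:R).
  rewrite inordK // -(@ltr_nat R).
  apply: le_lt_trans (_ : fr i * N.+1%:R < _).
    by rewrite truncn_le // mulr_ge0.
  by rewrite gtr_pMl.
have /injectivePn[i [i' ii' bii]] : ~~ injectiveb bin.
  apply/injectiveP => binj; have := leq_card bin binj.
  by rewrite !card_ord ltnn.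
have near : `|fr i - fr i'| < N.+1%:R^-1.
  have N0 : 0 < N.+1%:R :> R by [].
  have h j : (bin j)%:R <= fr j * N.+1%:R < (bin j)%:R + 1.
    by rewrite bE natr1 truncn_le ?truncnS_gt // mulr_ge0.
  rewrite -[X in _ < X]div1r ltr_pdivlMr // -{1}(gtr0_norm N0) -normrM mulrBl.
  rewrite ltr_norml; have := h i; have := h i'; rewrite bii; lra.
exists (i%:Z - i'%:Z), (Num.floor (alpha * i%:R) - Num.floor (alpha * i'%:R)).
have E : alpha * (i%:Z - i'%:Z)%:~R -
    (Num.floor (alpha * i%:R) - Num.floor (alpha * i'%:R))%:~R = fr i - fr i'.
  by rewrite /fr !intrB /= -!pmulrn; ring.
rewrite /= E; split; last exact: lt_trans near N1.
rewrite -E; apply/negP => /eqP eq0; apply: ai.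
have ne : i%:Z - i'%:Z != 0 :> int.
  by rewrite subr_eq0; apply: contra ii' => /eqP[/val_inj ->].
exists (((Num.floor (alpha * i%:R) - Num.floor (alpha * i'%:R))%:~R / (i%:Z - i'%:Z)%:~R) : rat) => //.
rewrite fmorph_div !rmorph_int.
apply/eqP; rewrite eq_sym -(inj_eq (mulIf (_ : (i%:Z - i'%:Z)%:~R != 0 :> R))) ?intr_eq0 //.
by rewrite divfK ?intr_eq0 // -subr_eq0 eq0.
Qed.

End PeriodicFunctions.

(** * Localized approximate eigenvectors and change of frequency *)

Section Localization.
Variable R : realType.
Implicit Types (f g V W : int -> R) (e : R) (l : nat).

Lemma zsum_le_tsum N f : fsupp f -> (forall n, 0 <= f n) -> zsum N f <= tsum f.
Proof.
move=> [N' fN'] f0.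
rewrite (tsumE (supp_mono fN' (leq_maxr N N'))).
by apply: zsum_le_mono => //; exact: leq_maxl.
Qed.

(** The truncated subtraction of natural numbers makes it vanish for |n| >= l. *)
Definition tent l : int -> R := fun n => (l - `|n|)%N%:R.

Lemma tent_supp l : supp l (tent l).
Proof. by move=> n ln; rewrite /tent (_ : (l - `|n|)%N = 0%N) //; lia. Qed.

Lemma tent_fsupp l : fsupp (tent l).
Proof. by exists l; exact: tent_supp. Qed.

Definition box l : int -> R := fun n => if (`|n| <= l)%N then 1 else 0.

Lemma box_supp l : supp l (box l).
Proof. by move=> n ln; rewrite /box leqNgt ln. Qed.

Lemma tsum_box l : tsum (box l) = l.*2.+1%:R.
Proof.
rewrite (tsumE (@box_supp l)).
rewrite (@eq_zsum _ l _ (fun=> 1)) => [|n nl]; last by rewrite /box nl.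
elim: l => //= l ->.
by rewrite doubleS -!natr1; ring.
Qed.

Lemma tent_lip l (n : int) : (tent l (n + 1) - tent l n) ^+ 2 <= box l.+1 n.
Proof.
rewrite /box; case: ifPn => nl.
  rewrite -(@real_normK _ (_ - _)) ?num_real // /tent.
  apply: exprn_ile1 => //.
  have h a b : (a <= b.+1)%N -> (b <= a.+1)%N -> `|a%:R - b%:R| <= (1 : R).
    rewrite -!(ler_nat R) -!natr1 => ab ba; rewrite ler_norml; lra.
  apply: h; lia.
by rewrite !tent_supp ?subrr ?expr0n //; lia.
Qed.

Definition tsq l : R := nsq (tent l).

(** On the inner half of its support the tent of width 2 l is at least l. *)
Lemma tsq_ge l : (0 < l)%N -> (l%:R) ^+ 2 * (2 * l%:R + 1) <= tsq l.*2.
Proof.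
move=> l0; rewrite /tsq /nsq.
apply: le_trans (zsum_le_tsum l _ _); last 2 first.
- by apply: fsuppX; exact: tent_fsupp.
- by move=> n; rewrite sqr_ge0.
have -> : l%:R ^+ 2 * (2 * l%:R + 1) = zsum l (fun=> l%:R ^+ 2 : R).
  rewrite -[LHS]/(l%:R ^+ 2 * (2 * l%:R + 1)).
  rewrite (_ : (fun=> _) = (fun n : int => l%:R ^+ 2 * 1)); last first.
    by apply/funext => n; rewrite mulr1.
  rewrite zsumZ; congr (_ * _); elim: (l) => [|k IH] /=; first by rewrite mulr0 add0r.
  by rewrite -IH -natr1; ring.
apply: le_zsum => n nl.
rewrite lerXn2r ?nnegrE ?ler0n // ler_nat; lia.
Qed.

Lemma tent_even l n : tent l (- n) = tent l n.
Proof. by rewrite /tent abszN. Qed.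

Lemma zsum_conv_eq f M (n : int) N : (forall k, f (- k) = f k) -> supp N f ->
  (N + `|n| <= M)%N -> zsum M (fun a => f (n - a)) = tsum f.
Proof.
move=> fe fN NM; have ff : fsupp f by exists N.
rewrite -(tsum_shift (- n) ff).
have -> : (fun a => f (n - a)) = (fun a => f (a - n)).
  by apply/funext => a; rewrite -fe opprB.
have s : supp (N + `|n|) (fun a => f (a - n)) by move=> a an; apply: fN; lia.
by rewrite (tsumE s) (zsum_supp s NM).
Qed.

Lemma zsum_conv_le f M (n : int) : (forall k, f (- k) = f k) -> fsupp f ->
  (forall k, 0 <= f k) -> zsum M (fun a => f (n - a)) <= tsum f.
Proof.
move=> fe [N fN] f0; rewrite -(@zsum_conv_eq f (maxn M (N + `|n|)) n N) //.
  by apply: zsum_le_mono => //; exact: leq_maxl.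
exact: leq_maxr.
Qed.

(* Averaging over all translates of a tent of width 2 l costs a commutator
   of relative size 1 / l^2. *)
Lemma localize W f l k e : (0 < l)%N -> fsupp f ->
  nsq (jop W f) < k * nsq f -> 3 * k + 18 / l%:R ^+ 2 <= e ->
  exists (a : int) g, [/\ forall n, (l.*2 < `|(n - a)%R|)%N -> g n = 0,
    0 < nsq g & nsq (jop W g) < e * nsq g].
Proof.
move=> l0 ff fk ke.
have f0 : 0 < nsq f.
  rewrite lt_def nsq_ge0 andbT; apply: contraTneq fk => ->.
  by rewrite mulr0 -leNgt nsq_ge0.
pose g (a n : int) := tent l.*2 (n - a) * f n.
have gs a : fsupp (g a) by fsup.
have gz a n : (l.*2 < `|(n - a)%R|)%N -> g a n = 0.
  by move=> h; rewrite /g tent_supp ?mul0r.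
have [N fN] := ff.
pose M := (l.*2 + N)%N.
pose c := tsq l.*2.
have lR : 0 < l%:R :> R by rewrite ltr0n.
have c0 : 0 < c.
  apply: lt_le_trans (tsq_ge l0).
  by apply: mulr_gt0; [exact: exprn_gt0|lra].
have te2 n : tent l.*2 (- n) ^+ 2 = tent l.*2 n ^+ 2 by rewrite tent_even.
have tf2 : fsupp (fun n => tent l.*2 n ^+ 2) by apply: fsuppX; exact: tent_fsupp.
have sumg : \sum_(a <- zlist M) nsq (g a) = c * nsq f.
  rewrite -tsum_sum => [|a]; last by fsup.
  rewrite /nsq -tsumZ; last by fsup.
  congr tsum; apply/funext => n.
  have [nN|nN] := leqP `|n| N; last first.
    rewrite fN // expr0n mulr0 big1 // => a _.
    by rewrite /g fN // mulr0 expr0n.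
  under eq_bigr do rewrite /g exprMn.
  rewrite -mulr_suml -(zsum_zlist M (fun a => tent l.*2 (n - a) ^+ 2)).
  congr (_ * _).
  rewrite (@zsum_conv_eq (fun k => tent l.*2 k ^+ 2) M n l.*2) //.
    by move=> j jl; rewrite tent_supp ?expr0n.
  by rewrite leq_add2l.
pose b := tsum (box l.*2.+1).
have bE n : box l.*2.+1 (- n) = box l.*2.+1 n by rewrite /box abszN.
have bs : fsupp (box l.*2.+1) by exists l.*2.+1; exact: box_supp.
have b0 n : 0 <= box l.*2.+1 n by rewrite /box; case: ifP.
have sumj : \sum_(a <- zlist M) nsq (jop W (g a)) <=
    3 * c * nsq (jop W f) + 6 * b * nsq f.
  rewrite -tsum_sum => [|a]; last by fsup.
  have E : 3 * c * nsq (jop W f) + 6 * b * nsq f = tsum (fun n =>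
      3 * c * jop W f n ^+ 2 + 3 * b * f (n - 1) ^+ 2 + 3 * b * f (n + 1) ^+ 2).
    rewrite !tsumD ?tsumZ; try fsup.
    by rewrite -!/(nsq _) !nsq_shift //; ring.
  rewrite E; apply: le_tsum; try fsup.
    by exists N.+1 => n nN; rewrite big1 // => a _; rewrite /jop /g !fN ?(mulr0, addr0, expr0n) //; lia.
  move=> n.
  apply: (@le_trans _ _ (\sum_(a <- zlist M) (3 * tent l.*2 (n - a) ^+ 2 * jop W f n ^+ 2 +
     3 * box l.*2.+1 (n - 1 - a) * f (n - 1) ^+ 2 + 3 * box l.*2.+1 (n - a) * f (n + 1) ^+ 2))).
    apply: ler_sum => a _.
    (* Discrete Leibniz rule: the commutator only contains increments of the tent, which [tent_lip]
       bounds by boxes. *)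
    have -> : jop W (g a) n = tent l.*2 (n - a) * jop W f n +
      - (tent l.*2 (n - 1 - a + 1) - tent l.*2 (n - 1 - a)) * f (n - 1) +
      (tent l.*2 (n - a + 1) - tent l.*2 (n - a)) * f (n + 1).
      rewrite (_ : n - 1 - a + 1 = n - a); last by lia.
      rewrite (_ : n - a + 1 = n + 1 - a); last by lia.
      by rewrite /jop /g; ring.
    apply: le_trans (sqr3_le _ _ _) _.
    have h (x y w : R) : x <= y -> 3 * (x * w ^+ 2) <= 3 * y * w ^+ 2.
      by move=> xy; rewrite -(mulrA 3 y) ler_pM2l // ler_wpM2r ?sqr_ge0.
    rewrite !exprMn sqrrN; apply: lerD; first by apply: lerD; [exact: h|exact/h/tent_lip].
    exact/h/tent_lip.
  rewrite !big_split /= -!mulr_suml -!mulr_sumr.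
  rewrite -(zsum_zlist M (fun a => tent l.*2 (n - a) ^+ 2)).
  rewrite -(zsum_zlist M (fun a => box l.*2.+1 (n - 1 - a))).
  rewrite -(zsum_zlist M (fun a => box l.*2.+1 (n - a))).
  apply: lerD; [apply: lerD|]; apply: ler_wpM2r; rewrite ?sqr_ge0 ?ler_pM2l //.
  - by apply: (@zsum_conv_le (fun k => tent l.*2 k ^+ 2)) => // j; rewrite sqr_ge0.
  - exact: zsum_conv_le.
  - exact: zsum_conv_le.
(* The box has 4 l + 3 <= 3 (2 l + 1) points and c >= l^2 (2 l + 1), whence 18 = 6 * 3. *)
have bc : 6 * b <= 18 / l%:R ^+ 2 * c.
  rewrite mulrAC ler_pdivlMr ?exprn_gt0 //.
  have := tsq_ge l0; rewrite -/c => h.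
  have lR1 : 1 <= l%:R :> R by rewrite ler1n.
  have -> : b = 4 * l%:R + 3.
    rewrite /b tsum_box (_ : (l.*2.+1).*2.+1 = 4 * l + 3)%N; last by lia.
    by rewrite natrD natrM.
  apply: (@le_trans _ _ (18 * (l%:R ^+ 2 * (2 * l%:R + 1)))); last by rewrite ler_pM2l.
  have l20 : 0 <= l%:R ^+ 2 :> R by rewrite sqr_ge0.
  nra.
have fin : \sum_(a <- zlist M) nsq (jop W (g a)) < e * \sum_(a <- zlist M) nsq (g a).
  apply: (le_lt_trans sumj); rewrite sumg.
  have h1 : 3 * c * nsq (jop W f) < 3 * c * (k * nsq f) by rewrite ltr_pM2l // mulr_gt0.
  have h2 : 6 * b * nsq f <= 18 / l%:R ^+ 2 * c * nsq f by rewrite ler_pM2r.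
  have h3 : (3 * k + 18 / l%:R ^+ 2) * (c * nsq f) <= e * (c * nsq f).
    by rewrite ler_pM2r // mulr_gt0.
  by move: h1 h2 h3; move: (18 / _) => q; lra.
have [a _ ae] : exists2 a, a \in zlist M & nsq (jop W (g a)) < e * nsq (g a).
  apply: contrapT => H; move: fin; apply/negP; rewrite -leNgt mulr_sumr.
  rewrite !big_seq; apply: ler_sum => a aM; rewrite leNgt; apply/negP => lt.
  by apply: H; exists a.
exists a, (g a); split => //; first exact: gz.
rewrite lt_def nsq_ge0 andbT; apply: contraTneq ae => ->.
by rewrite mulr0 -leNgt nsq_ge0.
Qed.

Lemma nsq_mul_le f g (c : R) : fsupp g -> (forall n, g n != 0 -> `|f n| <= c) ->
  nsq (fun n => f n * g n) <= c ^+ 2 * nsq g.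
Proof.
move=> fg fc; rewrite -nsqZ //.
apply: le_nsq => [||n]; [exact: fsuppMr|exact: fsuppMr|].
have [->|gn] := eqVneq (g n) 0; first by rewrite !mulr0.
have h := fc n gn.
rewrite !exprMn ler_wpM2r ?sqr_ge0 // -(real_normK (num_real (f n))).
by rewrite lerXn2r ?nnegrE // (le_trans _ h).
Qed.

Lemma jop_shift V g (m : int) : jop V (fun n => g (n - m)) =
  fun n => jop (fun n => V (n + m)) g (n - m).
Proof.
apply/funext => n; rewrite /jop subrK.
by rewrite (addrAC n (- m)) (addrAC n (- m) 1).
Qed.

Lemma jop_perturb V V' E g : jop (pshift V E) g =
  fun n => jop (pshift V' E) g n + (V n - V' n) * g n.
Proof. by apply/funext => n; rewrite /jop /pshift; ring. Qed.

(** The half-length 2 l of the window depends on [eta] alone, so d is uniform in theta and E. Over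
    such a window the phases beta n + theta and alpha (n + m) drift apart, modulo 1, by at most 2 l
    d once m aligns them at the centre a; the localized vector translated by m is then an
    approximate eigenvector at phase 0. *)
Lemma rspec_semicont (v : R -> R) (alpha eta : R) : torus_fun v -> continuous v ->
  irrational alpha -> 0 < eta -> exists2 d, 0 < d &
    forall (beta theta : R), (exists k : int, `|beta - alpha - k%:~R| < d) ->
    forall E, rspec (fun n => v (beta * n%:~R + theta)) E ->
    exists2 E0, rspec (fun n => v (alpha * n%:~R)) E0 & `|E0 - E| <= eta.
Proof.
move=> vp vc ai eta0.
have [K vK] := torus_fun_bounded vp vc.
have e0 : 0 < eta ^+ 2 / 4 by rewrite divr_gt0 // exprn_gt0.
have [l l0 le] : exists2 l : nat, (0 < l)%N & 18 / l%:R ^+ 2 <= eta ^+ 2 / 8.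
  pose l := (Num.truncn (144 / eta ^+ 2)).+1; exists l => //.
  have lR : 1 <= l%:R :> R by rewrite ler1n.
  have := truncnS_gt (144 / eta ^+ 2); rewrite -/l ltr_pdivrMr ?exprn_gt0 // => h.
  rewrite ler_pdivrMr; last by rewrite exprn_gt0 // (lt_le_trans ltr01).
  have : eta ^+ 2 * l%:R <= eta ^+ 2 * l%:R ^+ 2.
    by rewrite ler_pM2l ?exprn_gt0 // expr2 ler_peMr // (le_trans _ lR).
  lra.
have [r r0 rH] := torus_fun_unif vp vc (divr_gt0 eta0 (ltr0Sn R 1)).
pose L : R := l.*2%:R + 1.
have L0 : 0 < L by rewrite /L ltr_wpDl.
exists (r / 2 / L); first by rewrite !divr_gt0.
move=> beta theta [k0 hk] E sE.
(* Error budget: [localize] turns eta^2/24 into eta^2/8 and the cut-off adds at most eta^2/8; the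
   last triangle inequality doubles this eta^2/4 and the potential error (eta/2)^2, in all eta^2. *)
have [|f [ff fE]] := sE (eta ^+ 2 / 24); first by rewrite divr_gt0 // exprn_gt0.
have [|a [g [gs g0 gE]]] := localize (e := eta ^+ 2 / 4) l0 ff fE; first lra.
have fg : fsupp g by exists (l.*2 + `|a|)%N => n nN; apply: gs; lia.
have [m [k hm]] := irrational_orbit_dense (beta * a%:~R + theta - alpha * a%:~R) ai
   (divr_gt0 r0 (ltr0Sn R 1)).
pose V := fun n : int => v (alpha * n%:~R).
pose V' := fun n : int => v (beta * n%:~R + theta).
have close n : (`|(n - a)%R| <= l.*2)%N -> `|V (n + m) - V' n| <= eta / 2.
  move=> na; rewrite /V /V' -(torus_fun_int (beta * n%:~R + theta) (k - k0 * (n - a)) vp).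
  apply/ltW/rH.
  have -> : alpha * (n + m)%:~R - (beta * n%:~R + theta + (k - k0 * (n - a))%:~R) =
    (alpha * m%:~R - (beta * a%:~R + theta - alpha * a%:~R) - k%:~R) -
    (beta - alpha - k0%:~R) * (n - a)%:~R.
    by rewrite !(intrD, intrM, intrN, mulrNz); ring.
  apply: le_lt_trans (ler_normB _ _) _.
  have h : `|(beta - alpha - k0%:~R) * (n - a)%:~R| < r / 2.
    rewrite normrM -intr_norm; apply: (@le_lt_trans _ _ (`|beta - alpha - k0%:~R| * l.*2%:R)).
      by rewrite ler_wpM2l // -[l.*2%:R]/((l.*2%:Z)%:~R) ler_int; lia.
    apply: (@le_lt_trans _ _ ((r / 2 / L) * l.*2%:R)); first by rewrite ler_wpM2r // ltW.
    rewrite mulrAC ltr_pdivrMr // ltr_pM2l ?divr_gt0 //.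
    by rewrite /L ltrDl.
  by lra.
have [|||||E0 sE0 hE0] := @rspec_near _ V K (fun n => g (n - m)) E eta.
- by move=> n; exact: vK.
- exact: fsupp_shift.
- apply: contrapT => H; move: g0; rewrite ltNge => /negP; apply.
  rewrite (_ : g = fun n => 0 * g n) ?nsqZ ?expr0n ?mul0r //; last first.
  apply/funext => n; rewrite mul0r; apply/eqP; apply: contrapT => /negP gn.
  by apply: H; exists (n + m); rewrite addrK.
- exact: ltW.
- rewrite (nsq_shift (- m) fg) jop_shift.
  rewrite (nsq_shift (- m)); last exact: fsupp_jop.
  rewrite (jop_perturb (fun n => V (n + m)) V').
  apply: le_trans (nsqD_le ltr01 (fsupp_jop _ fg) (fsuppMr _ fg)) _.
  rewrite invr1.
  have h1 : nsq (fun n => (V (n + m) - V' n) * g n) <= (eta / 2) ^+ 2 * nsq g.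
    apply: nsq_mul_le => // n gn0; apply: close; rewrite leqNgt.
    by apply: contra gn0 => h; rewrite gs.
  have h2 : (eta / 2) ^+ 2 = eta ^+ 2 / 4 by field.
  rewrite h2 in h1; move: gE h1; lra.
by exists E0.
Qed.

End Localization.

(** * Orthogonal polynomials and eigenvalues of truncations *)

Section MonicDeterminant.
Variable F : comNzRingType.

(** The matrix is the Vandermonde matrix multiplied by the triangular matrix of coefficients, whose
    diagonal entries are 1. *)
Lemma det_monic_family (n : nat) (p : 'I_n -> {poly F}) (x : 'I_n -> F) :
  (forall k, p k \is monic) -> (forall k, size (p k) = k.+1) ->
  \det (\matrix_(k, i) (p k).[x i]) =
  \prod_(i < n) \prod_(j < n | (i < j)%N) (x j - x i).
Proof.
move=> pm ps.
pose a : 'rV[F]_n := \row_i x i.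
pose T : 'M[F]_n := \matrix_(k, j) (p k)`_j.
have -> : \matrix_(k, i) (p k).[x i] = T *m Vandermonde n a.
  apply/matrixP => k i; rewrite !mxE.
  rewrite (horner_coef_wide _ (_ : (size (p k) <= n)%N)) ?ps //.
  by apply: eq_bigr => j _; rewrite !mxE.
have Ttrig : is_trig_mx T.
  by apply/is_trig_mxP => k j kj; rewrite mxE nth_default // ps.
rewrite det_mulmx (det_trig Ttrig) big1 ?mul1r => [|k _]; last first.
  by have /monicP := pm k; rewrite mxE lead_coefE ps.
rewrite det_Vandermonde; apply: eq_bigr => i _; apply: eq_bigr => j _.
by rewrite !mxE.
Qed.

End MonicDeterminant.

Section OrthogonalPolynomials.
Variable F : comNzRingType.
Implicit Types (W : nat -> F) (x y : F) (n k : nat).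

(* The pair [(P_n(x), P_(n-1)(x))] of orthogonal polynomials of the half-line
   Jacobi matrix with diagonal [W]. *)
Fixpoint jval W x n : F * F :=
  if n is m.+1 then
    let: (a, b) := jval W x m in ((x - W m) * a - b, a)
  else (1, 0).

Lemma jvalS W x n : jval W x n.+1 = ((x - W n) * (jval W x n).1 - (jval W x n).2, (jval W x n).1).
Proof. by rewrite /=; case: jval. Qed.

(** At y = conj x it gives the reality of the roots of P_n, and at two distinct roots the
    orthogonality of the truncated eigenvectors. *)
Lemma christoffel_darboux W x y n :
  (x - y) * \sum_(k < n) ((jval W x k).1 * (jval W y k).1) =
  (jval W x n).1 * (jval W y n).2 - (jval W x n).2 * (jval W y n).1.
Proof.
elim: n => [|n IH]; first by rewrite big_ord0 /=; ring.
by rewrite big_ord_recr mulrDr IH !jvalS /=; ring.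
Qed.

End OrthogonalPolynomials.

Section JacobiPolynomials.
Variable R : realType.
Implicit Types (W : nat -> R) (x y c r : R) (n k : nat).
Local Open Scope complex_scope.

(** [jval] in the polynomial ring. [jval] is kept over any commutative ring so that the recursion
    can also be run at complex points. *)
Fixpoint jpair W n : {poly R} * {poly R} :=
  if n is m.+1 then
    let: (a, b) := jpair W m in (('X - (W m)%:P) * a - b, a)
  else (1, 0).

Definition jpol W n : {poly R} := (jpair W n).1.

Lemma jpairS W n : jpair W n.+1 = (('X - (W n)%:P) * (jpair W n).1 - (jpair W n).2, (jpair W n).1).
Proof. by rewrite /=; case: jpair. Qed.

Lemma jpol_size W n : size (jpair W n).1 = n.+1 /\ (size (jpair W n).2 <= n)%N /\
  (jpair W n).1 \is monic.
Proof.
elim: n => [|n [s1 [s2 m1]]]; first by rewrite /= size_poly1 size_poly0 monic1.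
have mm : ('X - (W n)%:P) * (jpair W n).1 \is monic.
  by rewrite monicMl // monicXsubC.
have ss : size (('X - (W n)%:P) * (jpair W n).1) = n.+2.
  by rewrite size_monicM ?monicXsubC ?size_XsubC ?s1 // -size_poly_eq0 s1.
have lt : (size (- (jpair W n).2) < size (('X - (W n)%:P) * (jpair W n).1)%R)%N.
  by rewrite ss size_polyN ltnS (leq_trans s2) // ltnW.
rewrite jpairS /= s1 size_polyDl // ss; split => //; split => //.
by rewrite monicE lead_coefDl // -monicE.
Qed.

Lemma jpair_horner W x n :
  (jpair W n).1.[x] = (jval W x n).1 /\ (jpair W n).2.[x] = (jval W x n).2.
Proof.
elim: n => [|n [h1 h2]]; first by rewrite /= !hornerE.
by rewrite jpairS jvalS /= !hornerE h1 h2.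
Qed.

Lemma jpol_horner W x n : (jpol W n).[x] = (jval W x n).1.
Proof. by have [] := jpair_horner W x n. Qed.

(** Christoffel-Darboux on the diagonal, with derivatives in place of difference quotients. The left
    side is at least 1 pointwise for n > 0, so the roots of P_n are simple. *)
Lemma jpol_wronskian W n :
  \sum_(k < n) jpol W k ^+ 2 =
  (jpair W n).1^`() * (jpair W n).2 - (jpair W n).1 * (jpair W n).2^`().
Proof.
elim: n => [|n IH]; first by rewrite big_ord0 /= derivC; ring.
rewrite big_ord_recr IH !jpairS /jpol /= derivB derivM derivB derivX derivC; ring.
Qed.

Lemma jval_sum_ge1 W x n : (0 < n)%N -> 1 <= \sum_(k < n) (jval W x k).1 ^+ 2.
Proof.
case: n => // n _; rewrite big_ord_recl /= expr1n lerDl sumr_ge0 // => i _.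
by rewrite sqr_ge0.
Qed.

Lemma jpair_complex W (z : R[i]) n :
  (map_poly (real_complex R) (jpair W n).1).[z] = (jval (fun k => (W k)%:C) z n).1 /\
  (map_poly (real_complex R) (jpair W n).2).[z] = (jval (fun k => (W k)%:C) z n).2.
Proof.
elim: n => [|n [h1 h2]]; first by rewrite /= rmorph1 rmorph0 !hornerE.
by rewrite jpairS jvalS /= !(rmorphB, rmorphM) /= map_polyX map_polyC /= !hornerE h1 h2.
Qed.

Lemma jval_conj W (z : R[i]) n :
  jval (fun k => (W k)%:C) (conjc z) n =
  (conjc (jval (fun k => (W k)%:C) z n).1, conjc (jval (fun k => (W k)%:C) z n).2).
Proof.
elim: n => [|n IH]; first by rewrite /= !oppr0.
rewrite !jvalS IH.
move: (jval _ z n) => [a b].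
case: (z) a b => [z1 z2] [a1 a2] [b1 b2] /=.
by congr (_, _); congr (_ +i* _); ring.
Qed.

(** At a root z, Christoffel-Darboux for z and its conjugate reads (z - conj z) times the sum of
    |P_k(z)|^2 = 0, and the sum is at least 1 because P_0 = 1. *)
Lemma jpol_root_real W (z : R[i]) n :
  root (map_poly (real_complex R) (jpol W n)) z -> complex.Im z = 0.
Proof.
case: n => [|n]; first by rewrite /root /jpol /= rmorph1 hornerC oner_eq0.
move=> /eqP; rewrite /jpol (jpair_complex W z n.+1).1 => z0.
have := christoffel_darboux (fun k => (W k)%:C) z (conjc z) n.+1.
rewrite jval_conj z0 [conjc 0]/= oppr0 mul0r mulr0 subr0 => /eqP.
rewrite mulf_eq0 => /orP[|].
  rewrite subr_eq0; case: (z) => a b /= /eqP[] /eqP.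
  by rewrite -addr_eq0 -mulr2n mulrn_eq0 /= => /eqP.
have -> : \sum_(k < n.+1) (jval (fun k => (W k)%:C) z k).1 *
    (jval (fun k => (W k)%:C) (conjc z) k).1 =
    (\sum_(k < n.+1) Normc.normc (jval (fun k => (W k)%:C) z k).1 ^+ 2)%:C.
  rewrite rmorph_sum; apply: eq_bigr => k _; rewrite jval_conj /=.
  case: (jval _ _ _).1 => a b /=; rewrite sqr_sqrtr ?addr_ge0 ?sqr_ge0 //.
  by congr (_ +i* _); ring.
rewrite (inj_eq (@complexI R)) => /eqP s0.
have : 1 <= \sum_(k < n.+1) Normc.normc (jval (fun k => (W k)%:C) z k).1 ^+ 2.
  rewrite big_ord_recl /= expr1n expr0n /= addr0 sqrtr1 expr1n lerDl sumr_ge0 // => i _.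
  by rewrite sqr_ge0.
by rewrite s0 ler10.
Qed.

Lemma jpol_splits W n : exists s : seq R,
  [/\ size s = n, sorted <%R s & jpol W n = \prod_(x <- s) ('X - x%:P)].
Proof.
pose P := map_poly (real_complex R) (jpol W n).
have [sz [_ mo]] := jpol_size W n.
have mP : P \is monic by rewrite map_monic.
have [rs Pr] := closed_field_poly_normal P.
rewrite (monicP mP) scale1r in Pr.
pose s := sort <=%R (map (@complex.Re R) rs).
have rsE : rs = map (real_complex R) (map (@complex.Re R) rs).
  rewrite -map_comp -[LHS]map_id; apply/eq_in_map => z zr /=.
  have : root P z by rewrite Pr root_prod_XsubC.
  by move=> /jpol_root_real; case: (z) => a b /= ->.
have PE : jpol W n = \prod_(x <- s) ('X - x%:P).
  apply: (@map_poly_inj _ _ (real_complex R)).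
  rewrite -/P Pr rsE rmorph_prod big_map.
  rewrite (perm_big _ (permEl (perm_sort <=%R _))) /=.
  by apply: eq_bigr => x _; rewrite rmorphB /= map_polyX map_polyC.
have us : uniq s.
  have sep x : x \in s -> (jpol W n)^`().[x] != 0.
    move=> xs; have r0 : (jpol W n).[x] = 0.
      by apply/eqP; rewrite -/(root _ _) PE root_prod_XsubC.
    have n0 : (0 < n)%N.
      move: r0; rewrite /jpol; case: (n) => //=; rewrite hornerC => /eqP.
      by rewrite oner_eq0.
    have := congr1 (horner^~ x) (jpol_wronskian W n).
    rewrite hornerD hornerN !hornerM -/(jpol W n) r0 mul0r subr0 horner_sum.
    move=> E; apply/eqP => d0; move: E; rewrite d0 mul0r.
    have := jval_sum_ge1 W x n0.
    under [in X in _ -> X -> _]eq_bigr do rewrite horner_exp jpol_horner.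
    by move=> h e0; move: h; rewrite e0 ler10.
  rewrite PE in sep.
  move: sep; elim: (s) => //= x t IH sep; apply/andP; split.
    apply/negP => xt; have := sep x; rewrite mem_head => /(_ isT) /eqP; apply.
    rewrite big_cons derivM derivXsubC mul1r hornerD hornerM !hornerE subrr mul0r addr0.
    by apply/eqP; rewrite -/(root _ _) root_prod_XsubC.
  apply: IH => y yt; have := sep y; rewrite inE yt orbT => /(_ isT).
  rewrite big_cons derivM derivXsubC mul1r hornerD hornerM.
  have -> : (\prod_(j <- t) ('X - j%:P)).[y] = 0.
    by apply/eqP; rewrite -/(root _ _) root_prod_XsubC.
  by rewrite add0r mulf_eq0 negb_or => /andP[].
exists s; split => //.
  by apply: succn_inj; rewrite -sz -/(jpol W n) PE size_prod_XsubC.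
by rewrite lt_sorted_uniq_le us /= sort_sorted // => a b; exact: le_total.
Qed.

Definition jroots W n : seq R := xget [::] [set s : seq R |
  [/\ size s = n, sorted <%R s & jpol W n = \prod_(x <- s) ('X - x%:P)]].

Lemma jrootsP W n : [/\ size (jroots W n) = n, sorted <%R (jroots W n) &
  jpol W n = \prod_(x <- jroots W n) ('X - x%:P)].
Proof.
rewrite /jroots; case: xgetP => [s _ //|H].
by have [s sP] := jpol_splits W n; case: (H s).
Qed.

Lemma jroots_root W n x : x \in jroots W n -> (jval W x n).1 = 0.
Proof.
have [_ _ E] := jrootsP W n => xs.
by apply/eqP; rewrite -jpol_horner -/(root _ _) E root_prod_XsubC.
Qed.

(** Beyond K + 2 each factor |x - W n| is at least 2, so |P_n(x)| is nondecreasing in n and never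
    vanishes. *)
Lemma jroots_bound W n K x : (forall k, `|W k| <= K) -> x \in jroots W n ->
  `|x| <= K + 2.
Proof.
move=> WK /jroots_root r0; rewrite leNgt; apply/negP => xK.
suff [h1 h2] : 1 <= `|(jval W x n).1| /\ `|(jval W x n).2| <= `|(jval W x n).1|.
  by move: h1; rewrite r0 normr0 ler10.
elim: n {r0} => [|n [h1 h2]]; first by rewrite /= normr1 normr0.
rewrite jvalS /=.
set a := (jval W x n).1 in h1 h2 *; set b := (jval W x n).2 in h2 *.
have h3 : 2 <= `|x - W n|.
  have := WK n; have := lerB_dist x (W n); lra.
have h4 : `|(x - W n) * a| - `|b| <= `|(x - W n) * a - b| by exact: lerB_dist.
rewrite normrM in h4; have : 2 * `|a| <= `|x - W n| * `|a| by rewrite ler_wpM2r.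
by split; lra.
Qed.

Lemma jroots_orth W n x y : x \in jroots W n -> y \in jroots W n -> x != y ->
  \sum_(k < n) ((jval W x k).1 * (jval W y k).1) = 0.
Proof.
move=> xs ys xy; have := christoffel_darboux W x y n.
rewrite !jroots_root // mul0r mulr0 subr0 => /eqP.
by rewrite mulf_eq0 subr_eq0 (negbTE xy) => /eqP.
Qed.

Lemma jroots_lt W n (i j : 'I_n) : (i < j)%N ->
  nth 0 (jroots W n) i < nth 0 (jroots W n) j.
Proof.
move=> ij; have [sz so _] := jrootsP W n.
by rewrite lt_sorted_ltn_nth // ?inE ?sz.
Qed.

Lemma jroots_mem W n (i : 'I_n) : nth 0 (jroots W n) i \in jroots W n.
Proof. by have [sz _ _] := jrootsP W n; rewrite mem_nth // sz. Qed.

(* The rows of the matrix (P_k(x_i)) are orthogonal with norms at least 1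
   because P_0 = 1. *)
Lemma jroots_vandermonde W n :
  1 <= \prod_(i < n) \prod_(j < n | (i < j)%N)
    (nth 0 (jroots W n) j - nth 0 (jroots W n) i).
Proof.
set x : 'I_n -> R := fun i => nth 0 (jroots W n) i.
have xn (i j : 'I_n) : i != j -> x i != x j.
  rewrite -val_eqE neq_ltn => /orP[h|h]; first by rewrite lt_eqF // jroots_lt.
  by rewrite gt_eqF // jroots_lt.
pose M : 'M[R]_n := \matrix_(k, i) (jpol W k).[x i].
have dM : \det M = \prod_(i < n) \prod_(j < n | (i < j)%N) (x j - x i).
  by apply: det_monic_family => k; have [? [? ?]] := jpol_size W k.
have D : \det (M^T *m M) = \prod_(i < n) (\sum_(k < n) (jval W (x i) k).1 ^+ 2).
  have -> : M^T *m M = diag_mx (\row_i \sum_(k < n) (jval W (x i) k).1 ^+ 2).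
    apply/matrixP => i j; rewrite !mxE.
    have [->|ij] := eqVneq i j.
      by rewrite mulr1n; apply: eq_bigr => k _; rewrite !mxE !jpol_horner expr2.
    rewrite mulr0n -[RHS](jroots_orth (jroots_mem W i) (jroots_mem W j) (xn _ _ ij)).
    by apply: eq_bigr => k _; rewrite !mxE !jpol_horner.
  by rewrite det_diag; apply: eq_bigr => i _; rewrite mxE.
have D1 : 1 <= \det (M^T *m M).
  rewrite D; have h (i : 'I_n) : 1 <= \sum_(k < n) (jval W (x i) k).1 ^+ 2.
    by apply: jval_sum_ge1; apply: leq_ltn_trans (ltn_ord i).
  elim/big_rec: _ => // i z _ z1.
  by rewrite -[1]mul1r; apply: ler_pM.
have d0 : 0 <= \det M.
  rewrite dM; apply: prodr_ge0 => i _; apply: prodr_ge0 => j ij.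
  by rewrite subr_ge0 ltW // jroots_lt.
move: D1; rewrite det_mulmx det_tr -expr2 -dM => D1.
by rewrite -(@ler_pXn2r _ 2) ?nnegrE // expr1n.
Qed.

End JacobiPolynomials.

(** * Clusters of truncated eigenvalues and the spectrum *)

Section EigenvaluesInGaps.
Variable R : realType.
Implicit Types (V f g h : int -> R) (x y z c r : R) (k N : nat).

Lemma nsq_orth3 f g h (a b c : R) : fsupp f -> fsupp g -> fsupp h ->
  tsum (fun n => f n * g n) = 0 -> tsum (fun n => f n * h n) = 0 ->
  tsum (fun n => g n * h n) = 0 ->
  nsq (fun n => a * f n + b * g n + c * h n) =
  a ^+ 2 * nsq f + b ^+ 2 * nsq g + c ^+ 2 * nsq h.
Proof.
move=> ff fg fh fg0 fh0 gh0.
have -> : nsq (fun n => a * f n + b * g n + c * h n) = tsum (fun n =>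
    (a ^+ 2 * f n ^+ 2 + b ^+ 2 * g n ^+ 2 + c ^+ 2 * h n ^+ 2) +
    (2 * a * b * (f n * g n) + 2 * a * c * (f n * h n) + 2 * b * c * (g n * h n))).
  by congr tsum; apply/funext => n; ring.
rewrite !tsumD; try fsup.
by rewrite !tsumZ ?fg0 ?fh0 ?gh0 ?mulr0 ?addr0 //; try fsup.
Qed.

Definition natfun N (u : nat -> R) : int -> R :=
  fun n => if n is Posz k then (if (k < N)%N then u k else 0) else 0.

Lemma natfun_supp N u : supp N (natfun N u).
Proof. by case=> [k|k] //= Nk; rewrite ltnNge (ltnW Nk). Qed.

Lemma natfun_fsupp N u : fsupp (natfun N u).
Proof. by exists N; exact: natfun_supp. Qed.

Lemma tsum_natfun N u : tsum (natfun N u) = \sum_(k < N) u k.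
Proof.
have H M : zsum M (natfun N u) = \sum_(k < M.+1) (natfun N u k%:Z).
  elim: M => [|M IH]; first by rewrite big_ord_recl big_ord0 addr0.
  by rewrite big_ord_recr -IH /= addr0.
rewrite (tsumE (@natfun_supp N u)) H big_ord_recr /= ltnn addr0.
by apply: eq_bigr => k _; rewrite ltn_ord.
Qed.

Variable V : int -> R.
Let W k : R := V k%:Z.

Definition evec N x : int -> R := natfun N (fun k => (jval W x k).1).

Lemma evec_ip N x y : tsum (fun n => evec N x n * evec N y n) =
  \sum_(k < N) ((jval W x k).1 * (jval W y k).1).
Proof.
rewrite -(tsum_natfun N (fun k => (jval W x k).1 * (jval W y k).1)).
congr tsum; apply/funext => -[k|k] /=; last by rewrite mul0r.
by case: ifP => _; rewrite ?mul0r.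
Qed.

(** Extended by 0, the truncated eigenvector fails the full equation only at the sites -1 and N, by
    the adjacent values P_0 = 1 and P_(N-1)(x); at N - 1 the equation holds because P_N(x) = 0. *)
Lemma evec_jop N x (n : int) : (0 < N)%N -> (jval W x N).1 = 0 ->
  jop V (evec N x) n = x * evec N x n +
    ((n == -1)%:R + (n == N%:Z)%:R * (jval W x N).2).
Proof.
move=> N0 rN; case: n => [k|[|k]]; last 2 first.
- rewrite /jop (_ : Negz 0 - 1 = Negz 1) // (_ : Negz 0 + 1 = 0) //.
  rewrite /evec /= N0.
  by rewrite !(mulr0, mul0r, addr0, add0r).
- rewrite /jop (_ : Negz k.+1 - 1 = Negz k.+2); last by rewrite !NegzE; lia.
  rewrite (_ : Negz k.+1 + 1 = Negz k); last by rewrite !NegzE; lia.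
  by rewrite /evec /= !(mulr0, mul0r, addr0, add0r).
rewrite /jop (_ : (k%:Z == -1) = false) // add0r.
rewrite (_ : k%:Z + 1 = k.+1%:Z); last by lia.
have prev : (k <= N)%N -> evec N x (k%:Z - 1) = (jval W x k).2.
  case: k => [|k] kN; first by [].
  rewrite (_ : k.+1%:Z - 1 = k%:Z); last by lia.
  by rewrite /evec /= kN; case: jval.
have next : (k < N)%N -> evec N x k.+1%:Z = (jval W x k.+1).1.
  move=> kN; rewrite /evec [LHS]/=; case: ifPn => //; rewrite -leqNgt => Nk.
  by have <- : N = k.+1 by lia.
have [kN|kN|kN] := ltngtP k N.
- rewrite prev ?(ltnW kN) // next // jvalS /= /evec /natfun kN /W.
  rewrite (_ : (k%:Z == N%:Z) = false); last by apply/eqP; lia.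
  by rewrite /=; ring.
- rewrite (_ : (k%:Z == N%:Z) = false); last by apply/eqP; lia.
  rewrite /evec; case: k kN {prev next} => // k kN.
  rewrite (_ : k.+1%:Z - 1 = k%:Z); last by lia.
  rewrite /natfun !ifF; try lia.
  by rewrite !(mulr0, mul0r, addr0, add0r).
- rewrite prev ?kN // eqxx /evec /natfun !ifF; try lia.
  by rewrite !(mulr0, mul0r, mul1r, addr0, add0r).
Qed.

(* Three eigenvectors of the truncated matrix have a combination vanishing at
   both ends, on which the truncated and the full operator agree. *)
Lemma rspec_near_roots K N c r x y z : (forall n, `|V n| <= K) ->
  x \in jroots W N -> y \in jroots W N -> z \in jroots W N ->
  x != y -> x != z -> y != z ->
  `|x - c| <= r -> `|y - c| <= r -> `|z - c| <= r ->
  exists2 E, rspec V E & `|E - c| <= r.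
Proof.
move=> VK xN yN zN xy xz yz xr yr zr.
have N0 : (0 < N)%N.
  by have [sz _ _] := jrootsP W N; rewrite -sz; case: (jroots W N) xN.
pose b t := (jval W t N).2.
(* The cross product of (1, 1, 1) with the vector of values [b]; it vanishes only if the three
   values agree, and then (1, -1, 0) does. *)
have [a1 [a2 [a3 [s0 sb nz]]]] : exists a1 a2 a3 : R, [/\ a1 + a2 + a3 = 0,
    a1 * b x + a2 * b y + a3 * b z = 0 & (a1 != 0) || (a2 != 0)].
  have [e|ne] := eqVneq (b x) (b y); last first.
    exists (b z - b y), (b x - b z), (b y - b x); split; try ring.
    apply: contraNT ne; rewrite negb_or !negbK !subr_eq0 => /andP[/eqP <- /eqP ->].
    by [].
  have [e'|ne] := eqVneq (b x) (b z); last first.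
    exists (b z - b y), (b x - b z), (b y - b x); split; try ring.
    by rewrite (subr_eq0 (b x)) ne orbT.
  exists 1, (-1), 0; split; [ring|by rewrite e; ring|by rewrite oner_eq0].
pose f n := a1 * evec N x n + a2 * evec N y n + a3 * evec N z n.
have fe t : fsupp (evec N t) by exact: natfun_fsupp.
have ff : fsupp f by apply: fsuppD; [apply: fsuppD|]; apply: fsuppMr; exact: fe.
have i1 : tsum (fun n => evec N x n * evec N y n) = 0 by rewrite evec_ip jroots_orth.
have i2 : tsum (fun n => evec N x n * evec N z n) = 0 by rewrite evec_ip jroots_orth.
have i3 : tsum (fun n => evec N y n * evec N z n) = 0 by rewrite evec_ip jroots_orth.
have ge1 t : 1 <= nsq (evec N t).
  have -> : nsq (evec N t) = \sum_(k < N) (jval W t k).1 ^+ 2.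
    under eq_bigr do rewrite expr2.
    by rewrite -evec_ip; congr tsum; apply/funext => n; rewrite expr2.
  exact: jval_sum_ge1.
have nf : nsq f = a1 ^+ 2 * nsq (evec N x) + a2 ^+ 2 * nsq (evec N y) +
    a3 ^+ 2 * nsq (evec N z) by exact: nsq_orth3.
have f0 : 0 < nsq f.
  have h (a t : R) : 0 <= a ^+ 2 * nsq (evec N t) by rewrite mulr_ge0 ?sqr_ge0 ?nsq_ge0.
  have h' (a t : R) : a != 0 -> 0 < a ^+ 2 * nsq (evec N t).
    move=> a0; apply: mulr_gt0; last exact: lt_le_trans (ge1 t).
    by rewrite lt_def sqr_ge0 sqrf_eq0 a0.
  rewrite nf; case/orP: nz => /h' H.
    by have := H x; have := h a2 y; have := h a3 z; lra.
  by have := H y; have := h a1 x; have := h a3 z; lra.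
apply: (@rspec_near _ V K f) => //.
- apply: contrapT => H; move: f0; rewrite ltNge => /negP; apply.
  rewrite (_ : f = fun n => 0 * f n) ?nsqZ ?expr0n ?mul0r //.
  apply/funext => n; rewrite mul0r; apply/eqP; apply: contrapT => /negP fn.
  by apply: H; exists n.
- exact: le_trans (normr_ge0 _) xr.
have -> : jop (pshift V c) f = fun n => a1 * (x - c) * evec N x n +
    a2 * (y - c) * evec N y n + a3 * (z - c) * evec N z n.
  apply/funext => n.
  have jx := @evec_jop N x n N0 (jroots_root xN).
  have jy := @evec_jop N y n N0 (jroots_root yN).
  have jz := @evec_jop N z n N0 (jroots_root zN).
  have -> : jop (pshift V c) f n = a1 * jop V (evec N x) n + a2 * jop V (evec N y) n +
    a3 * jop V (evec N z) n - c * f n by rewrite /jop /pshift /f; ring.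
  rewrite jx jy jz /f -/(b x) -/(b y) -/(b z).
  set d1 := (_ == -1)%:R; set d2 := (_ == N%:Z)%:R.
  transitivity (a1 * (x - c) * evec N x n + a2 * (y - c) * evec N y n +
     a3 * (z - c) * evec N z n + d1 * (a1 + a2 + a3) + d2 * (a1 * b x + a2 * b y + a3 * b z)).
    by ring.
  by rewrite s0 sb !mulr0 !addr0.
rewrite nsq_orth3 // nf.
have r0 : 0 <= r by exact: le_trans (normr_ge0 _) xr.
have h (a t : R) : `|t - c| <= r -> (a * (t - c)) ^+ 2 * nsq (evec N t) <=
    r ^+ 2 * (a ^+ 2 * nsq (evec N t)).
  move=> tr.
  have -> : (a * (t - c)) ^+ 2 * nsq (evec N t) = (t - c) ^+ 2 * (a ^+ 2 * nsq (evec N t)).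
    by ring.
  apply: ler_wpM2r; first by rewrite mulr_ge0 ?sqr_ge0 ?nsq_ge0.
  by rewrite -(real_normK (num_real (t - c))) lerXn2r ?nnegrE.
by rewrite 2!(mulrDr (r ^+ 2)); apply: lerD; [apply: lerD|]; apply: h.
Qed.

End EigenvaluesInGaps.

(** * The capacity of a Schroedinger spectrum is at least 1 *)

Section EnergyOnTheRealLine.
Variable R : realType.
Local Open Scope ereal_scope.

Lemma ae_imp d (T : measurableType d) (mu : {measure set T -> \bar R}) (P Q : T -> Prop) :
  {ae mu, forall x, P x} -> (forall x, P x -> Q x) -> {ae mu, forall x, Q x}.
Proof. by move=> aeP PQ; apply: filterS aeP => x /PQ. Qed.

(** The integral of g may be infinite, so the identity is written as f^+ + c = g + f^- and
    integrated between nonnegative functions; f^- <= c keeps the subtracted part finite. *)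
Lemma integral_shift d (T : measurableType d) (mu : probability T R)
    (f g : T -> \bar R) (c : R) :
  measurable_fun setT f -> measurable_fun setT g -> (0 <= c)%R ->
  (forall x, 0 <= g x) -> {ae mu, forall x, f x = g x - c%:E} ->
  \int[mu]_x f x = \int[mu]_x g x - c%:E.
Proof.
move=> mf mg c0 g0 fg.
have mfp : measurable_fun setT f^\+ by exact: measurable_funepos.
have mfn : measurable_fun setT f^\- by exact: measurable_funeneg.
have ic : \int[mu]_x (cst c%:E x) = c%:E.
  rewrite integral_cst; last exact: measurableT.
  by rewrite -[RHS]mule1; congr (_ * _); exact: probability_setT.
have E : \int[mu]_x (g x + f^\- x) = \int[mu]_x (f^\+ x + cst c%:E x).
  apply: ge0_ae_eq_integral => //.
  - by apply: emeasurable_funD.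
  - by apply: emeasurable_funD.
  - by move=> x _; rewrite adde_ge0.
  - by move=> x _; rewrite adde_ge0 // lee_fin.
  apply: filterS fg => x fx _ /=; rewrite funeposE funenegE fx.
  case: (g x) (g0 x) => [r r0| |//] /=; last by rewrite maxNye maxye.
  rewrite -(EFinD r) -!EFin_max -!EFinD; congr EFin.
  by rewrite /Num.max; do 2!case: ifP; lra.
have {}E : \int[mu]_x g x + \int[mu]_x f^\- x = \int[mu]_x f^\+ x + c%:E.
  rewrite -ge0_integralD // E ge0_integralD // ?ic //.
rewrite integralE.
have M0 : 0 <= \int[mu]_x f^\- x by apply: integral_ge0.
have Mc : \int[mu]_x f^\- x <= c%:E.
  rewrite -ic; apply: ae_ge0_le_integral => //.
  apply: filterS fg => x fx _ /=; rewrite funenegE fx.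
  case: (g x) (g0 x) => [r r0| |//] /=; last by rewrite maxNye lee_fin.
  by rewrite -EFin_max lee_fin ge_max c0 andbT; move: r0; rewrite lee_fin; lra.
have Mf : \int[mu]_x f^\- x \is a fin_num.
  by rewrite ge0_fin_numE // (le_lt_trans Mc) // ltry.
move: E Mf; set P := \int[mu]_x f^\+ x; set G := \int[mu]_x g x.
set M := \int[mu]_x f^\- x => E Mf.
have P0 : 0 <= P by apply: integral_ge0.
have G0 : 0 <= G by apply: integral_ge0.
move: E Mf P0 G0; case: P => [p| |//]; case: G => [q| |//]; case: M {M0 Mc} => [m| |//] //=.
by move=> [E] _ _ _; congr EFin; lra.
Qed.

(* [ln (D / |x|)], truncated to be nonnegative for [|x| > D]. *)
Definition kap (D x : R) : \bar R :=
  if x == 0%R then +oo else (Num.max 0 (ln D - ln `|x|))%:E.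

Lemma kap_ge0 D x : 0 <= kap D x.
Proof. by rewrite /kap; case: ifP => // _; rewrite lee_fin le_max lexx. Qed.

Lemma kapE D x : x != 0%R -> (`|x| <= D)%R -> kap D x = (ln D - ln `|x|)%:E.
Proof.
move=> x0 xD; rewrite /kap (negbTE x0) max_r // subr_ge0 ler_ln ?posrE ?normr_gt0 //.
by apply: lt_le_trans xD; rewrite normr_gt0.
Qed.

Lemma measurable_eq0 : measurable_fun [set: R] (fun x : R => x == 0%R).
Proof.
apply: (@measurable_fun_eqr _ _ _ setT (fun x : R => x) (fun=> 0%R)) => //.
Qed.

Lemma measurable_kap D : measurable_fun [set: R] (kap D).
Proof.
apply: measurable_fun_ifT; [exact: measurable_eq0|by []|].
apply/measurable_EFinP; apply: measurable_maxr; first by [].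
apply: measurable_funB; first by [].
apply: (measurableT_comp (f := @ln R)); [exact: measurable_ln|exact: normr_measurable].
Qed.

(** The logarithmic kernel -ln |z - w| as a function of the squared distance. *)
Definition ker2 (s : R) : \bar R :=
  if s == 0%R then +oo else (- (ln s / 2))%:E.

Lemma measurable_ker2 : measurable_fun [set: R] ker2.
Proof.
apply: measurable_fun_ifT; [exact: measurable_eq0|by []|].
apply/measurable_EFinP; apply: measurableT_comp => //.
by apply: measurable_funM => //; exact: measurable_ln.
Qed.

Definition sqd (z w : R * R) : R := ((z.1 - w.1) ^+ 2 + (z.2 - w.2) ^+ 2)%R.

Lemma energy_kernelE (z w : R * R) :
  lne ((Normc.normc (to_complex z - to_complex w))%:E^-1) = ker2 (sqd z w).
Proof.
have s0 : (0 <= sqd z w)%R by rewrite addr_ge0 ?sqr_ge0.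
rewrite (_ : Normc.normc _ = Num.sqrt (sqd z w)); last first.
  by case: z w {s0} => [z1 z2] [w1 w2].
rewrite /ker2; case: eqP => [->|/eqP sn0].
  by rewrite sqrtr0 inve0.
have r0 : (0 < Num.sqrt (sqd z w))%R by rewrite sqrtr_gt0 lt_def sn0.
rewrite inver gt_eqF // lneV // lne_EFin // -EFinN; congr (- _)%:E.
have -> : ln (sqd z w) = (ln (Num.sqrt (sqd z w)) *+ 2)%R.
  by rewrite -lnXn // sqr_sqrtr.
by field.
Qed.

Lemma ker2_kap (D : R) (z w : R * R) : z.2 = 0%R -> w.2 = 0%R ->
  (`|z.1 - w.1| <= D)%R -> ker2 (sqd z w) = kap D (z.1 - w.1) - (ln D)%:E.
Proof.
move=> z0 w0 zw; rewrite /ker2 /sqd z0 w0 subrr expr0n addr0 sqrf_eq0.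
have [->|ne] := eqVneq (z.1 - w.1)%R 0%R; first by rewrite /kap eqxx.
rewrite kapE // -EFinB; congr EFin.
have -> : ln ((z.1 - w.1) ^+ 2) = (ln `|z.1 - w.1| *+ 2)%R.
  by rewrite -lnXn ?normr_gt0 // real_normK ?num_real.
by field.
Qed.

Definition kenergy (D : R) (mu : probability (plane R) R) : \bar R :=
  \int[mu]_z \int[mu]_w kap D (z.1 - w.1).

Lemma measurable_kap2 (D : R) :
  measurable_fun [set: plane R * plane R] (fun p => kap D (p.1.1 - p.2.1)).
Proof.
apply: (measurableT_comp (measurable_kap D)).
by apply: measurable_funB; exact: measurableT_comp.
Qed.

Lemma measurable_ker22 :
  measurable_fun [set: plane R * plane R] (fun p => ker2 (sqd p.1 p.2)).
Proof.
apply: (measurableT_comp measurable_ker2).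
apply: measurable_funD; apply: measurable_funX; apply: measurable_funB;
  exact: measurableT_comp.
Qed.

Lemma measurable_inner (mu : probability (plane R) R) (f : plane R * plane R -> \bar R) :
  measurable_fun setT f -> (forall p, 0 <= f p) ->
  measurable_fun [set: plane R] (fun z => \int[mu]_w f (z, w)).
Proof. exact: (@measurable_fun_fubini_tonelli_F _ _ (plane R) (plane R) R mu). Qed.

Lemma measurable_kap_int (D : R) (mu : probability (plane R) R) :
  measurable_fun [set: plane R] (fun z => \int[mu]_w kap D (z.1 - w.1)).
Proof.
have := @measurable_inner mu (fun p => kap D (p.1.1 - p.2.1)).
by apply; [exact: measurable_kap2|move=> p; exact: kap_ge0].
Qed.

Lemma measurable_section_l (f : plane R * plane R -> \bar R) z :
  measurable_fun setT f -> measurable_fun setT (fun w => f (z, w)).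
Proof. by move=> mf; apply: (measurableT_comp mf); exact: measurable_pair1. Qed.

(** D bounds the diameter of K, so the truncation in [kap] is inactive; D >= 1 makes the constant ln
    D nonnegative, as [integral_shift] requires in each of the two integrations. *)
Lemma energy_kenergy (D C : R) (mu : probability (plane R) R) (K : set (R * R)) :
  (2 * C <= D)%R -> (1 <= D)%R -> measurable (K : set (plane R)) -> mu K = 1 ->
  (forall z, K z -> z.2 = 0%R /\ (`|z.1| <= C)%R) ->
  energy mu = kenergy D mu - (ln D)%:E.
Proof.
move=> CD D1 mK K1 KC.
have aeK : {ae mu, forall z, K z}.
  exists (~` K); split; [exact: measurableC| |by []].
  by rewrite probability_setC // K1 subee.
have lD : (0 <= ln D)%R by exact: ln_ge0.
rewrite /energy /kenergy.
under eq_integral do under eq_integral do rewrite energy_kernelE.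
have mk : measurable_fun setT (fun z : plane R => \int[mu]_w ker2 (sqd z w)).
  pose f (p : plane R * plane R) := ker2 (sqd p.1 p.2).
  have mf : measurable_fun setT f by exact: measurable_ker22.
  have -> : (fun z : plane R => \int[mu]_w ker2 (sqd z w)) =
    (fun z => \int[mu]_w f^\+ (z, w) - \int[mu]_w f^\- (z, w)).
    apply/funext => z; rewrite integralE.
    by congr (_ - _); apply: eq_integral => w _; rewrite ?funeposE ?funenegE.
  apply: emeasurable_funB; apply: measurable_inner => //.
    exact: measurable_funepos.
  exact: measurable_funeneg.
apply: integral_shift => //.
- exact: measurable_kap_int.
- by move=> z; apply: integral_ge0 => w _; exact: kap_ge0.
apply: (ae_imp aeK) => z /KC [z2 zC].
apply: integral_shift => //.
- exact: (measurable_section_l z measurable_ker22).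
- exact: (measurable_section_l z (measurable_kap2 D)).
- by move=> w; exact: kap_ge0.
apply: (ae_imp aeK) => w /KC [w2 wC].
apply: ker2_kap => //; apply: le_trans (ler_normB _ _) _; lra.
Qed.

End EnergyOnTheRealLine.

(** * Selection of pointwise limits of monotone functions *)

Section Helly.
Variable R : realType.
Implicit Types (G : R -> R) (t : R).

Definition gcont G t := forall e, 0 < e -> exists a b : R,
  [/\ a < t, t < b & G b - G a < e].

(** For jumps of size at least 1/(m+1), the left limits [s] at distinct points differ by at least
    1/(m+1), so the integer part of (m+1) s(t) is injective on them. *)
Lemma countable_not_gcont G : nondecreasing_fun G -> countable [set t | ~ gcont G t].
Proof.
move=> ndG.
pose Dm (m : nat) := [set t | forall a b : R, a < t -> t < b -> m.+1%:R^-1 <= G b - G a].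
have sub : [set t | ~ gcont G t] `<=` \bigcup_(m in [set: nat]) Dm m.
  move=> t nt; apply: contrapT => H; apply: nt => e e0.
  apply: contrapT => H2; apply: H.
  exists (Num.truncn e^-1) => // a b at_ tb; rewrite leNgt; apply/negP => lt.
  apply: H2; exists a, b; split => //; apply: (lt_le_trans lt).
  by rewrite invf_ple ?posrE // ltW // truncnS_gt.
apply: (sub_countable (card_le_trans (subset_card_le sub) (card_lexx _))).
apply: bigcup_countable => // m _.
pose s t := sup [set G a | a in [set a | a < t]].
have hs t : has_sup [set G a | a in [set a | a < t]].
  split; first by exists (G (t - 1)), (t - 1) => //=; rewrite ltrBlDr ltrDl.
  by exists (G t) => _ [a /= at_ <-]; exact/ndG/ltW.
have sgap t t' : Dm m t -> Dm m t' -> t < t' -> s t + m.+1%:R^-1 <= s t'.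
  move=> Dt _ tt'; rewrite -lerBrDr; apply: sup_le_ub.
    by exists (G (t - 1)), (t - 1) => //=; rewrite ltrBlDr ltrDl.
  move=> _ [a /= at_ <-]; rewrite lerBrDr.
  have h1 : t < (t + t') / 2 by rewrite midf_lt.
  have h2 : (t + t') / 2 < t' by rewrite midf_lt.
  have := Dt _ _ at_ h1.
  have : G ((t + t') / 2) <= s t'.
    by apply: sup_upper_bound => //; exists ((t + t') / 2).
  by move=> h3 h4; rewrite (le_trans _ h3) // -lerBrDl.
apply/countable_injP.
pose F t : nat := choice.pickle (Num.floor (m.+1%:R * s t)).
exists F => t t'; rewrite !inE => Dt Dt' /(pcan_inj (@choice.pickleK _)) E.
have key u u' : Dm m u -> Dm m u' -> u < u' ->
    Num.floor (m.+1%:R * s u) = Num.floor (m.+1%:R * s u') -> False.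
  move=> Du Du' uu' EE; have := sgap _ _ Du Du' uu'.
  have m0 : 0 < m.+1%:R :> R by [].
  rewrite -(ler_pM2l m0) mulrDr mulfV ?gt_eqF //.
  have := floorR_gt (m.+1%:R * s u'); have := floor_le (m.+1%:R * s u).
  rewrite EE; lra.
have [lt|lt|//] := ltgtP t t'.
  by case: (key _ _ Dt Dt' lt E).
by case: (key _ _ Dt' Dt lt (esym E)).
Qed.

Lemma fmap_ultra (T T' : Type) (f : T -> T') (F : set_system T) :
  UltraFilter F -> UltraFilter (f x @[x --> F]).
Proof.
move=> UF; split; first exact: fmap_proper_filter.
move=> H PH FH; apply/seteqP; split => // A HA.
have [//|FA] := in_ultra_setVsetC (f @^-1` A) UF.
have HnA : H (~` A) by apply: FH.
have HH : H (A `&` ~` A) by exact: filterI.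
by have [x []] := filter_ex HH.
Qed.

(** A limit G at all points at once is taken along an ultrafilter; [phi] then picks indices where f
    is 1/(k+1)-close to G at the first k+1 rationals, and monotonicity squeezes the values at
    continuity points. Rationals stay in the conclusion because the neighbours chosen in
    [capacity_ge1] may be jumps of G. *)
Lemma helly (f : nat -> R -> R) (C : R) :
  (forall n, (0 < n)%N -> nondecreasing_fun (f n)) ->
  (forall n t, (0 < n)%N -> `|f n t| <= C) ->
  exists G (phi : nat -> nat), [/\ nondecreasing_fun G, forall t, `|G t| <= C,
    forall k, (k < phi k)%N &
    forall t, gcont G t \/ rational t -> f (phi k) t @[k --> \oo] --> G t].
Proof.
move=> ndf fC.
have [U [UU sU]] := ultraFilterLemma (eventually_filter : ProperFilter \oo).
have U0 : \forall n \near U, (0 < n)%N by apply: sU; exists 1%N.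
have ex2 (P Q : set nat) : U P -> U Q -> exists n, P n /\ Q n.
  move=> h1 h2; have h3 : U (P `&` Q) by exact: filterI.
  exact: filter_ex h3.
have lim t : exists l, `|l| <= C /\ f n t @[n --> U] --> l.
  have := @segment_compact R (- C) C; rewrite compact_ultra.
  move=> /(_ (f n t @[n --> U]) (fmap_ultra (f^~ t) UU))[].
    by apply: filterS U0 => n n0 /=; rewrite in_itv /= -ler_norml fC.
  move=> l [/=]; rewrite in_itv /= -ler_norml => lC fl.
  by exists l.
have [G GP] := choice lim.
have Gn t e : 0 < e -> \forall n \near U, `|f n t - G t| < e.
  by move=> e0; have [_ /cvgrPdist_lt /(_ _ e0)] := GP t; under eq_near do rewrite distrC.
have ndG : nondecreasing_fun G.
  move=> s t st; rewrite leNgt; apply/negP => lt.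
  pose e := (G s - G t) / 2; have e0 : 0 < e by rewrite divr_gt0 ?subr_gt0.
  have [n [[h1 h2] n0]] := ex2 _ _ (filterI (Gn s e e0) (Gn t e e0)) U0.
  have := ndf n n0 _ _ st; move: h1 h2; rewrite !ltr_norml /e; lra.
pose r (j : nat) : R := if choice.unpickle j is Some q then ratr (q : rat) else 0.
have ex k : exists n, (k < n)%N /\ forall j, (j <= k)%N -> `|f n (r j) - G (r j)| < k.+1%:R^-1.
  have h m : \forall n \near U, forall j, (j < m)%N -> `|f n (r j) - G (r j)| < k.+1%:R^-1.
    elim: m => [|m IH]; first by apply: nearW => n j; rewrite ltn0.
    have := Gn (r m) k.+1%:R^-1 ltac:(by rewrite invr_gt0).
    move: IH; apply: filterS2 => n IH h j; rewrite ltnS leq_eqVlt => /orP[/eqP -> //|].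
    exact: IH.
  have Uk : \forall n \near U, (k < n)%N by apply: sU; exists k.+1.
  have [n [h1 h2]] := ex2 _ _ (h k.+1) Uk.
  by exists n; split => // j jk; exact: h1.
have [phi phiP] := choice ex.
exists G, phi; split => //.
- by move=> t; have [] := GP t.
- by move=> k; have [] := phiP k.
have rP (x : rat) : r (choice.pickle x) = ratr x by rewrite /r choice.pickleK.
have near_r (x : rat) e : 0 < e -> \forall k \near \oo, `|f (phi k) (ratr x) - G (ratr x)| < e.
  move=> e0; exists (maxn (choice.pickle x) (Num.truncn e^-1)) => // k /=; rewrite geq_max => /andP[xk ek].
  rewrite -rP; have [_ /(_ _ xk) h] := phiP k; apply: (lt_le_trans h).
  rewrite invf_ple ?posrE //; apply: ltW; apply: (lt_le_trans (truncnS_gt _)).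
  by rewrite ler_nat ltnS.
move=> t gt; apply/cvgrPdist_lt => e e0.
case: gt => [gt|[q _ <-]]; last by apply: filterS (near_r q e e0) => k; rewrite distrC.
have e2 : 0 < e / 2 by rewrite divr_gt0.
have [a [b [at_ tb ab]]] := gt _ e2.
have [p ap] := rat_in_itvoo at_; have [q qb] := rat_in_itvoo tb.
near=> k.
have h1 : `|f (phi k) (ratr p) - G (ratr p)| < e / 2 by near: k; exact: near_r.
have h2 : `|f (phi k) (ratr q) - G (ratr q)| < e / 2 by near: k; exact: near_r.
have k0 : (0 < phi k)%N by have [h _] := phiP k; exact: leq_ltn_trans h.
move: ap qb; rewrite !in_itv /= => /andP[ap pt] /andP[tq qb].
have h3 := ndf _ k0 _ _ (ltW pt); have h4 := ndf _ k0 _ _ (ltW tq).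
have h5 := ndG _ _ (ltW ap); have h6 := ndG _ _ (ltW qb).
have h7 := ndG _ _ (ltW pt); have h8 := ndG _ _ (ltW tq).
move: h1 h2; rewrite !ltr_norml; lra.
Unshelve. all: by end_near.
Qed.

End Helly.

(** * Fatou's lemma in terms of real levels *)

Section FatouPointwise.
Variable R : realType.
Local Open Scope ereal_scope.

(** This is a <= liminf u (see [elowP]), tested on real levels below [a]: convenient for a kernel
    that takes the value +oo. *)
Definition elow (a : \bar R) (u : nat -> \bar R) :=
  forall M : R, M%:E < a -> \forall k \near \oo, M%:E <= u k.

Lemma elowP (a : \bar R) (u : nat -> \bar R) : elow a u <-> a <= limn_einf u.
Proof.
rewrite limn_einf_lim (cvg_lim _ (@cvg_einfs_sup _ u)) //; split=> [low|le M Ma].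
  have H (M : R) : M%:E < a -> M%:E <= ereal_sup (range (einfs u)).
    move=> /low [n _ un]; apply: (@le_trans _ _ (einfs u n)).
      by apply: le_ereal_inf_tmp => _ [k /= nk <-]; apply: un.
    by apply: ereal_sup_ubound; exists n.
  case: a {low} H => [r| |] H; last by rewrite leNye.
    apply/lee_addgt0Pr => e e0; rewrite -leeBlDr // -EFinB; apply: H.
    by rewrite lte_fin ltrBlDr ltrDl.
  rewrite leye_eq; apply/eqP/eqyP => M M0; apply: H; exact: ltry.
have /ereal_sup_gt[_ [n _ <-] Mn] := lt_le_trans Ma le.
exists n => // k /= nk; apply: (le_trans (ltW Mn)).
by apply: ereal_inf_lbound; exists k.
Qed.

Lemma fatou_elow d (T : measurableType d) (mu : {measure set T -> \bar R})
    (g : T -> \bar R) (f : nat -> T -> \bar R) (b : nat -> \bar R) :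
  measurable_fun setT g -> (forall n, measurable_fun setT (f n)) ->
  (forall x, 0 <= g x) -> (forall n x, 0 <= f n x) ->
  {ae mu, forall x, elow (g x) (f ^~ x)} ->
  (forall n, \int[mu]_x f n x <= b n) ->
  elow (\int[mu]_x g x) b.
Proof.
move=> mg mf g0 f0 gf fb; apply/elowP.
apply: (@le_trans _ _ (limn_einf (fun n => \int[mu]_x f n x))); last first.
  apply/elowP => M /(proj2 (elowP _ _) (lexx _)).
  by apply: filterS => k h; apply: le_trans (fb k).
apply: le_trans (fatou mu measurableT mf _); last by [].
apply: ae_ge0_le_integral => //.
- move=> x _; apply/elowP => M M0; apply: nearW => k; apply: le_trans (ltW M0) _ => //.
- have -> : (fun x => limn_einf (f ^~ x)) = (fun x => limn (einfs (f ^~ x))).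
    by apply/funext => x; rewrite limn_einf_lim.
  apply: (emeasurable_fun_cvg (fun n x => einfs (f ^~ x) n)).
    exact: measurable_fun_einfs.
  by move=> x _; exact: is_cvg_einfs.
- by apply: (ae_imp gf) => x gx _; apply/elowP.
Qed.

End FatouPointwise.

(** * Empirical measures as step functions of a uniform variable *)

Section StepFunctions.
Variable R : realType.
Local Open Scope ereal_scope.

Let P : probability (measurableTypeR R) R := uniform_prob (@ltr01 R).

(** For ordered points x_0 < ... < x_(n-1), the map t -> x_(step_index n t) is the quantile function
    of their normalized counting measure; the minimum keeps t = 1 in range. *)
Definition step_index (n : nat) (t : R) : nat :=
  minn (Num.truncn (n%:R * t)%R) n.-1.

Lemma step_index_lt n t : (0 < n)%N -> (step_index n t < n)%N.
Proof. by case: n => // n _; rewrite ltnS geq_minr. Qed.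

Lemma step_index_le n s t : (s <= t)%R -> (step_index n s <= step_index n t)%N.
Proof.
move=> st; rewrite /step_index leq_min geq_minr andbT (leq_trans (geq_minl _ _)) //.
by apply: le_truncn; rewrite ler_wpM2l.
Qed.

Lemma uniform_probE (A : set R) : measurable A ->
  P A = @lebesgue_measure R (A `&` `[0%R, 1%R]).
Proof.
move=> mA.
have m1 : measurable_fun setT (EFin \o \1_A : R -> \bar R).
  exact/measurable_EFinP/measurable_indic.
have p1 (x : R) : 0 <= (EFin \o \1_A : R -> \bar R) x by rewrite lee_fin.
have := integral_uniform (@ltr01 R) m1 p1.
rewrite subr0 invr1 mul1e /= !integral_indic //.
by rewrite setIT.
Qed.

Lemma measurable_step_index n (i : nat) : measurable [set t : R | step_index n t = i].
Proof.
have m : measurable_fun setT (fun t : R => (step_index n t)%:R : R).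
  by apply: nondecreasing_measurable => // s t st; rewrite ler_nat step_index_le.
rewrite (_ : [set t | _] = setT `&` (fun t : R => (step_index n t)%:R : R) @^-1` [set i%:R]).
  exact: m.
rewrite setTI; apply/seteqP; split => t /= => [-> //|/eqP].
by rewrite eqr_nat => /eqP.
Qed.

Lemma step_prob_le n (i : nat) : (0 < n)%N ->
  P [set t | step_index n t = i] <= (n%:R^-1)%:E.
Proof.
move=> n0; rewrite uniform_probE; last exact: measurable_step_index.
have nR : (0 < n%:R :> R)%R by rewrite ltr0n.
apply: (@le_trans _ _ (@lebesgue_measure R `[(i%:R / n%:R)%R, (i.+1%:R / n%:R)%R])).
  apply: le_measure; rewrite ?inE //=; first exact: measurableI (measurable_step_index _ _) _.
  move=> t [/= ti]; rewrite !in_itv /= => /andP[t0 t1].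
  rewrite ler_pdivrMr // ler_pdivlMr // !(mulrC t).
  have nt0 : (0 <= n%:R * t)%R by rewrite mulr_ge0.
  have h1 : ((Num.truncn (n%:R * t))%:R <= n%:R * t)%R by rewrite truncn_le.
  have h2 := truncnS_gt (n%:R * t)%R.
  apply/andP; split.
    by apply: le_trans h1; rewrite ler_nat -ti geq_minl.
  move: ti; rewrite /step_index /minn; case: ifP => _ <-; first exact: ltW.
  by rewrite prednK // ger_pMr.
rewrite lebesgue_measure_itv /= lte_fin ltr_pM2r ?invr_gt0 // ltr_nat ltnSn.
by rewrite -EFinB lee_fin -mulrBl -natrB // subSnn mul1r.
Qed.

Lemma step_decomp n (h : nat -> \bar R) t : (0 < n)%N ->
  h (step_index n t) = \sum_(i < n) (h i * (\1_[set t | step_index n t = i] t)%:E).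
Proof.
move=> n0; rewrite (bigD1 (Ordinal (step_index_lt t n0))) //= big1 => [|i /eqP ne].
  by rewrite adde0 indicE mem_set ?mule1.
rewrite indicE memNset ?mule0 //= => e; apply: ne; apply: val_inj => /=.
by rewrite e.
Qed.

Lemma measurable_step n (h : nat -> \bar R) : (0 < n)%N -> (forall i, 0 <= h i) ->
  measurable_fun setT (fun t : R => h (step_index n t)).
Proof.
move=> n0 h0; rewrite (_ : (fun t : R => h (step_index n t)) = (fun t =>
    \sum_(i < n) (h i * (\1_[set t | step_index n t = i] t)%:E))).
  apply: emeasurable_sum => i; apply: measurable_funeM.
  by apply/measurable_EFinP; apply: measurable_indic; exact: measurable_step_index.
by apply/funext => t; rewrite step_decomp.
Qed.

Lemma integral_step_le n (h : nat -> \bar R) : (0 < n)%N -> (forall i, 0 <= h i) ->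
  \int[P]_t h (step_index n t) <= \sum_(i < n) (h i * (n%:R^-1)%:E).
Proof.
move=> n0 h0; under eq_integral do rewrite (step_decomp h _ n0).
have mi (i : 'I_n) : measurable_fun setT
    (fun t : R => (\1_[set t | step_index n t = i] t)%:E : \bar R).
  by apply/measurable_EFinP; apply: measurable_indic; exact: measurable_step_index.
rewrite ge0_integral_sum; [|exact: measurableT
  |by move=> i; apply: measurable_funeM; exact: mi
  |by move=> i t _; rewrite mule_ge0 // lee_fin].
apply: lee_sum => i _.
rewrite ge0_integralZl; [|exact: measurableT|exact: mi
  |by move=> t _; rewrite lee_fin|exact: h0].
rewrite lee_wpmul2l // integral_indic ?setIT //; last exact: measurable_step_index.
exact: step_prob_le.
Qed.

End StepFunctions.

(** * A measure of nonpositive energy from separated points *)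

Section LowerBound.
Variable R : realType.

Lemma ln_prod (I : Type) (s : seq I) (Q : pred I) (F : I -> R) :
  (forall i, Q i -> 0 < F i) ->
  ln (\prod_(i <- s | Q i) F i) = \sum_(i <- s | Q i) ln (F i).
Proof.
move=> F0; suff [_ ->] : 0 < \prod_(i <- s | Q i) F i /\
  ln (\prod_(i <- s | Q i) F i) = \sum_(i <- s | Q i) ln (F i) by [].
elim/big_rec2: _ => [|i y z Qi [z0 zE]]; first by rewrite ltr01 ln1.
by rewrite mulr_gt0 ?F0 // lnM ?posrE ?F0 // zE.
Qed.

Lemma sum_offdiag_sym (n : nat) (L : 'I_n -> 'I_n -> R) :
  (forall i j, L i j = L j i) ->
  \sum_(i < n) \sum_(j < n | j != i) L i j =
  2 * \sum_(i < n) \sum_(j < n | (i < j)%N) L i j.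
Proof.
move=> Ls.
have -> : \sum_(i < n) \sum_(j < n | j != i) L i j =
    \sum_(i < n) \sum_(j < n | (i < j)%N) L i j + \sum_(i < n) \sum_(j < n | (j < i)%N) L i j.
  rewrite -big_split; apply: eq_bigr => i _ /=.
  rewrite (bigID (fun j : 'I_n => (i < j)%N)) /=; congr (_ + _); apply: eq_bigl => j.
    by rewrite -val_eqE /=; case: ltngtP.
  by rewrite -val_eqE /=; case: ltngtP.
have -> : \sum_(i < n) \sum_(j < n | (j < i)%N) L i j =
    \sum_(i < n) \sum_(j < n | (i < j)%N) L i j.
  rewrite (exchange_big_dep xpredT) //=; apply: eq_bigr => i _.
  by apply: eq_bigr => j _; rewrite Ls.
by rewrite mulr2n mulrDl mul1r.
Qed.

Lemma sum_ln_vandermonde n (x : nat -> R) : (forall i j, (i < j < n)%N -> x i < x j) ->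
  \sum_(i < n) \sum_(j < n | j != i) ln `|x i - x j| =
  2 * ln (\prod_(i < n) \prod_(j < n | (i < j)%N) (x j - x i)).
Proof.
move=> xlt.
rewrite sum_offdiag_sym => [|i j]; last by rewrite distrC.
have p (i j : 'I_n) : (i < j)%N -> 0 < x j - x i.
  by move=> ij; rewrite subr_gt0 xlt // ij ltn_ord.
rewrite ln_prod => [|i _]; last by apply: prodr_gt0 => j; exact: p.
congr (_ * _); apply: eq_bigr => i _; rewrite ln_prod => [|j]; last exact: p.
by apply: eq_bigr => j ij; rewrite distrC gtr0_norm // p.
Qed.

Lemma step_index_gap n (m : nat) (s t : R) : 0 <= s -> t < 1 ->
  m%:R <= n%:R * (t - s) -> (0 < n)%N -> (step_index n s + m <= step_index n t)%N.
Proof.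
move=> s0 t1 mn n0; have nR : 0 < n%:R :> R by rewrite ltr0n.
have ns0 : 0 <= n%:R * s by rewrite mulr_ge0 // ltW.
have hs : (Num.truncn (n%:R * s))%:R <= n%:R * s by rewrite truncn_le.
have h0 : 0 <= m%:R :> R by [].
have nt0 : 0 <= n%:R * t by move: mn; rewrite mulrBr; lra.
have tn : (Num.truncn (n%:R * t) <= n.-1)%N.
  by rewrite truncn_le_nat prednK // gtr_pMr.
rewrite {2}/step_index (minn_idPl tn) truncn_ge_nat // natrD.
apply: (@le_trans _ _ ((Num.truncn (n%:R * s))%:R + m%:R)).
  by rewrite lerD2r ler_nat geq_minl.
by move: mn; rewrite mulrBr; lra.
Qed.

Lemma elow_le (a : \bar R) (b : nat -> \bar R) (c : R) : elow a b ->
  (forall k, (b k <= c%:E)%E) -> (a <= c%:E)%E.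
Proof.
move=> ab bc; rewrite leNgt; apply/negP => ca.
have [M [cM Ma]] : exists M, c < M /\ (M%:E < a)%E.
  case: a ca {ab} => [r| |] //; last by exists (c + 1); rewrite ltrDl ltry.
  rewrite lte_fin => cr; exists ((c + r) / 2); rewrite lte_fin.
  by rewrite midf_lt // midf_lt.
have [k _ /(_ k (leqnn k))] := ab M Ma.
by move=> /= h; have := le_trans h (bc k); rewrite lee_fin leNgt cM.
Qed.

Variables (S : set R) (C : R) (x : nat -> nat -> R).
Hypothesis xlt : forall n i j, (i < j < n)%N -> x n i < x n j.
Hypothesis xC : forall n i, (i < n)%N -> `|x n i| <= C.
Hypothesis xV : forall n, 1 <= \prod_(i < n) \prod_(j < n | (i < j)%N) (x n j - x n i).
Hypothesis xgap : forall n i (c r : R), (i.+2 < n)%N -> `|x n i - c| <= r ->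
  `|x n i.+1 - c| <= r -> `|x n i.+2 - c| <= r -> exists2 E, S E & `|E - c| <= r.
Hypothesis Scl : forall E : R, (forall e : R, 0 < e -> exists2 E', S E' & `|E' - E| <= e) -> S E.
Hypothesis SC : forall E, S E -> `|E| <= C.

Let P : probability (measurableTypeR R) R := uniform_prob (@ltr01 R).
Let D : R := 2 * C + 1.

Let C_ge0 : 0 <= C.
Proof. exact: le_trans (normr_ge0 _) (@xC 1 0 (ltn0Sn 0)). Qed.

Let D_ge1 : 1 <= D.
Proof. by rewrite /D lerDr mulr_ge0. Qed.

Let x_le n i j : (i <= j < n)%N -> x n i <= x n j.
Proof.
move=> /andP[]; rewrite leq_eqVlt => /predU1P[-> //|ij jn].
by rewrite ltW // xlt // ij.
Qed.

(** Selection is applied to quantile functions, so that the limit measure is the law of their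
    limit. *)
Let f n (t : R) := x n (step_index n t).

Let f_nd n : (0 < n)%N -> nondecreasing_fun (f n).
Proof. by move=> n0 s t st; apply: x_le; rewrite step_index_le // step_index_lt. Qed.

Let f_C n t : (0 < n)%N -> `|f n t| <= C.
Proof. by move=> n0; apply: xC; exact: step_index_lt. Qed.

(** The diagonal, where [kap] is +oo, is removed. For s <> t in (0, 1) the two indices eventually
    differ, so the limit kernel does not notice. *)
Let H n i j : \bar R := if i == j then 0%E else kap D (x n i - x n j).

Let H_ge0 n i j : (0 <= H n i j)%E.
Proof. by rewrite /H; case: ifP => // _; exact: kap_ge0. Qed.

Let A n i : \bar R := (\sum_(j < n) (H n i j * (n%:R^-1)%:E))%E.

Let A_ge0 n i : (0 <= A n i)%E.
Proof. by apply: sume_ge0 => j _; rewrite mule_ge0 // lee_fin. Qed.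

(** The logarithms of the differences add up to twice the logarithm of the Vandermonde product,
    hence to something nonnegative; what remains is at most n^2 ln D. *)
Let A_sum n : (0 < n)%N -> (\sum_(i < n) (A n i * (n%:R^-1)%:E) <= (ln D)%:E)%E.
Proof.
move=> n0; have nR : 0 < n%:R :> R by rewrite ltr0n.
have HE (i j : 'I_n) : H n i j = (if j != i then ln D - ln `|x n i - x n j| else 0)%:E.
  rewrite /H -val_eqE eq_sym; case: eqP => //= /eqP ij.
  rewrite kapE //.
    rewrite subr_eq0; move: ij; rewrite neq_ltn => /orP[h|h].
      by rewrite gt_eqF // xlt // h ltn_ord.
    by rewrite lt_eqF // xlt // h ltn_ord.
  have := xC (ltn_ord i); have := xC (ltn_ord j).
  have := ler_normB (x n i) (x n j); rewrite /D; lra.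
have -> : (\sum_(i < n) (A n i * (n%:R^-1)%:E))%E =
    (\sum_(i < n) (\sum_(j < n) ((if j != i then ln D - ln `|x n i - x n j| else 0) / n%:R)) / n%:R)%:E.
  rewrite -sumEFin; apply: eq_bigr => i _; rewrite EFinM; congr (_ * _)%E.
  by rewrite -sumEFin; apply: eq_bigr => j _; rewrite EFinM HE.
rewrite lee_fin.
have -> : \sum_(i < n) (\sum_(j < n) ((if j != i then ln D - ln `|x n i - x n j| else 0) / n%:R)) / n%:R
   = (\sum_(i < n) \sum_(j < n | j != i) (ln D - ln `|x n i - x n j|)) / n%:R / n%:R.
  rewrite !mulr_suml; apply: eq_bigr => i _; congr (_ / _).
  by rewrite -mulr_suml; congr (_ / _); rewrite -big_mkcond.
have -> : \sum_(i < n) \sum_(j < n | j != i) (ln D - ln `|x n i - x n j|) =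
   \sum_(i < n) \sum_(j < n | j != i) ln D -
   \sum_(i < n) \sum_(j < n | j != i) ln `|x n i - x n j|.
  rewrite -sumrB; apply: eq_bigr => i _; exact: sumrB.
rewrite (sum_ln_vandermonde (fun i j => @xlt n i j)).
have lV : 0 <= ln (\prod_(i < n) \prod_(j < n | (i < j)%N) (x n j - x n i)).
  by apply: ln_ge0.
have lD : 0 <= ln D by apply: ln_ge0.
have le : \sum_(i < n) \sum_(j < n | j != i) ln D <= n%:R * n%:R * ln D.
  apply: (@le_trans _ _ (\sum_(i < n) \sum_(j < n) ln D)).
    apply: ler_sum => i _; rewrite big_mkcond; apply: ler_sum => j _.
    by case: ifP.
  by rewrite !sumr_const !card_ord -mulrnA -[leLHS]mulr_natl natrM.
rewrite !ler_pdivrMr //; move: le lV; set V := ln (\prod_(i < n) _).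
lra.
Qed.

(** The measure is the law of (G(t), 0) for uniform t, with G the limit of the quantile functions.
    Fatou's lemma, used once in each variable, carries the bound of [A_sum] over to [kenergy], and
    subtracting ln D leaves an energy at most 0. *)
Lemma capacity_ge1 :
  (1 <= capacity [set z : R[i]%C | complex.Im z = 0%R /\ S (complex.Re z)])%E.
Proof.
have [G [phi [ndG GC phik fG]]] := helly f_nd f_C.
have phi0 k : (0 < phi k)%N by exact: leq_ltn_trans (phik k).
pose good t := 0 < t < 1 /\ gcont G t.
have goodS t : good t -> S (G t).
  move=> [/andP[t0 t1] gt]; apply: Scl => e e0.
  have e2 : 0 < e / 2 by rewrite divr_gt0.
  have [a [b [at_ tb ab]]] := gt _ e2.
  have [p] : exists p : rat, ratr p \in `]Num.max a 0, t[.
    by apply: rat_in_itvoo; rewrite gt_max at_ t0.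
  have [q] : exists q : rat, ratr q \in `]t, Num.min b 1[.
    by apply: rat_in_itvoo; rewrite lt_min tb t1.
  rewrite !in_itv /= gt_max lt_min => /and3P[tq qb q1] /andP[/andP[ap p0] pt].
  set p' : R := ratr p in ap p0 pt; set q' : R := ratr q in tq qb q1.
  have cp : f (phi k) p' @[k --> \oo] --> G p' by apply: fG; right; exists p.
  have cq : f (phi k) q' @[k --> \oo] --> G q' by apply: fG; right; exists q.
  have qp : 0 < q' - p' by rewrite subr_gt0 (lt_trans pt).
  move/cvgrPdist_lt: cp => /(_ _ e2) [k1 _ cp].
  move/cvgrPdist_lt: cq => /(_ _ e2) [k2 _ cq].
  have [k [kk1 kk2 kk3]] : exists k, [/\ (k1 <= k)%N, (k2 <= k)%N &
      (Num.truncn (2 / (q' - p')) < k)%N].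
    by exists (maxn (maxn k1 k2) (Num.truncn (2 / (q' - p'))).+1);
      split; rewrite !leq_max leqnn ?orbT.
  have hk1 : `|G p' - f (phi k) p'| < e / 2.
    exact: cp.
  have hk2 : `|G q' - f (phi k) q'| < e / 2.
    exact: cq.
  pose n := phi k; pose i := step_index n p'.
  (* Once phi k (q' - p') >= 2, at least three consecutive points of the array lie between the
     quantiles at p' and q', both of which are close to G t. *)
  have gap : (i + 2 <= step_index n q')%N.
    have kn : (k < n)%N by exact: phik.
    apply: (@step_index_gap n 2 p' q'); [exact: ltW|exact: q1| |exact: phi0].
    rewrite -ler_pdivrMr; last exact: qp.
    apply: (@le_trans _ _ (Num.truncn (2 / (q' - p'))).+1%:R); first exact/ltW/truncnS_gt.
    by rewrite ler_nat (leq_trans kk3) // ltnW.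
  have sl : (step_index n q' < n)%N by apply: step_index_lt; exact: phi0.
  have h1 := ndG _ _ (ltW ap); have h2 := ndG _ _ (ltW pt).
  have h3 := ndG _ _ (ltW tq); have h4 := ndG _ _ (ltW qb).
  have hx j : (i <= j)%N -> (j <= step_index n q')%N -> `|x n j - G t| <= e.
    move=> ij jq.
    have l1 : f n p' <= x n j by apply: x_le; rewrite ij (leq_ltn_trans jq).
    have l2 : x n j <= f n q' by apply: x_le; rewrite jq.
    move: hk1 hk2; rewrite -/n !ltr_norml ler_norml; lra.
  have gi : (i.+2 <= step_index n q')%N by rewrite -addn2.
  apply: (@xgap n i (G t) e); first exact: leq_ltn_trans gi sl.
  - by apply: hx; [exact: leqnn|exact: ltnW (ltnW gi)].
  - by apply: hx; [exact: leqnSn|exact: ltnW gi].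
  - by apply: hx; [exact: leqW (leqnSn i)|exact: gi].
have mG : measurable_fun setT (G : measurableTypeR R -> measurableTypeR R).
  exact: nondecreasing_measurable.
have nullc (B : set R) : countable B -> P.-negligible B.
  move=> cB; have mB : measurable B by exact: countable_measurable.
  exists B; split => //; apply/eqP; rewrite eq_le measure_ge0 andbT uniform_probE //.
  rewrite -[leRHS](countable_lebesgue_measure0 cB); apply: le_measure; rewrite ?inE //.
  exact: measurableI.
have aegood : {ae P, forall t, good t}.
  have n1 : P.-negligible [set t | ~ gcont G t] by exact/nullc/countable_not_gcont.
  have n2 : P.-negligible (~` `[0%R, 1%R]).
    exists (~` `[0%R, 1%R]); split => //; first exact: measurableC.
    by rewrite uniform_probE ?setICl ?measure0 //; exact: measurableC.
  have n3 : P.-negligible [set 0; 1] by apply: nullc; exact: finite_set_countable.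
  apply: (negligibleS _ (negligibleU n1 (negligibleU n2 n3))).
  move=> t /= /not_andP[t01|gt]; last by left.
  right; have [t0|t0] := eqVneq t 0; first by right; left.
  have [t1|t1] := eqVneq t 1; first by right; right.
  left; rewrite in_itv /= => /andP[h0 h1]; apply: t01.
  by rewrite !lt_def h0 h1 t0 eq_sym t1.
pose X (t : measurableTypeR R) : plane R := (G t, 0%R).
have mX : measurable_fun [set: measurableTypeR R] X by exact: measurable_fun_pair.
pose X' : {mfun measurableTypeR R >-> plane R} :=
  @mfun_Sub _ _ (measurableTypeR R) (plane R) X (mem_set mX).
pose mu : probability (plane R) R := distribution P X'.
have muE (B : set (plane R)) : mu B = P (X @^-1` B) by [].
have intE (g : plane R -> \bar R) : measurable_fun setT g -> (forall z, 0 <= g z)%E ->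
    (\int[mu]_z g z = \int[P]_t g (X t))%E.
  by move=> mg g0; rewrite ge0_integral_distribution.
pose K : set (R * R) := S `*` [set 0].
have clS : closed S.
  move=> E clE; apply: Scl => e e0.
  have [E' [SE' /= EE']] := clE _ (nbhsx_ballx E e e0).
  by exists E' => //; rewrite distrC ltW.
have cK : compact K.
  apply: compact_setX; last exact: compact_set1.
  apply: (subclosed_compact clS (@segment_compact R (- C) C)) => E /SC.
  by rewrite /= in_itv /= -ler_norml.
have mK : measurable (K : set (plane R)).
  by apply: measurableX => //; exact: closed_measurable.
have mu1 : mu K = 1%E.
  rewrite muE.
  have mXK : measurable (X @^-1` K) by have := mX measurableT _ mK; rewrite setTI.
  have : P (~` (X @^-1` K)) = 0%E.
    apply/negligibleP; first exact: measurableC.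
    by apply: negligibleS aegood => t /= nK gt; apply: nK; split => //; exact: goodS.
  rewrite probability_setC //; have := fin_num_measure P _ mXK.
  case: (P _) => // r _; rewrite -EFinB => -[] /eqP; rewrite subr_eq0 => /eqP <-.
  by [].
have KC z : K z -> z.2 = 0 /\ `|z.1| <= C by move=> [/= /SC h ->].
have ken : (kenergy D mu <= (ln D)%:E)%E.
  rewrite /kenergy intE; [|exact: measurable_kap_int|by move=> z; apply: integral_ge0 => w _; exact: kap_ge0].
  under eq_integral => s _.
    rewrite intE; [|exact: (measurable_section_l (X s) (measurable_kap2 D))|by move=> w; exact: kap_ge0].
    over.
  have mk2 : measurable_fun setT (fun st : measurableTypeR R * measurableTypeR R => kap D (G st.1 - G st.2)).
    apply: (measurableT_comp (measurable_kap D)); apply: measurable_funB.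
      exact: (measurableT_comp mG).
    exact: (measurableT_comp mG).
  apply: (@elow_le _ (fun k => \sum_(i < phi k) (A (phi k) i * ((phi k)%:R^-1)%:E))%E); last first.
    by move=> k; exact: A_sum.
  apply: (@fatou_elow _ _ _ P _ (fun k s => A (phi k) (step_index (phi k) s))).
  - have := @measurable_fun_fubini_tonelli_F _ _ _ _ _ P (fun st => kap D (G st.1 - G st.2)) mk2.
    by apply => st; exact: kap_ge0.
  - by move=> k; apply: measurable_step.
  - by move=> s; apply: integral_ge0 => t _; exact: kap_ge0.
  - by [].
  - apply: (ae_imp aegood) => s gs.
    apply: (@fatou_elow _ _ _ P _ (fun k t => H (phi k) (step_index (phi k) s) (step_index (phi k) t))).
    + exact: (measurableT_comp mk2 (measurable_pair1 s)).
    + by move=> k; apply: (measurable_step (h := H (phi k) (step_index (phi k) s))).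
    + by move=> t; exact: kap_ge0.
    + by [].
    + have aes : {ae P, forall t, good t /\ t <> s}.
        have ns : P.-negligible [set s] by apply: nullc; exact: finite_set_countable.
        apply: (negligibleS _ (negligibleU aegood ns)) => t /= /not_andP[h|/contrapT h].
          by left.
        by right.
      apply: (ae_imp aes) => t [gt ts] M Mk.
      have cs : f (phi k) s @[k --> \oo] --> G s by apply: fG; left; exact: gs.2.
      have ct : f (phi k) t @[k --> \oo] --> G t by apply: fG; left; exact: gt.2.
      have D0 : 0 < D by exact: lt_le_trans D_ge1.
      (* For M > 0, [kap] exceeds M exactly at distances below D exp(-M), including distance 0. This
         open condition passes to the approximating points. *)
      have lt : `|G s - G t| < D * expR (- M) \/ M <= 0.
        have [M0|M0] := leP M 0; [by right|left].
        have [->|ne] := eqVneq (G s - G t) 0.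
          by rewrite normr0 mulr_gt0 ?expR_gt0.
        move: Mk; rewrite kapE //; last first.
          have := GC s; have := GC t; have := ler_normB (G s) (G t); rewrite /D; lra.
        rewrite lte_fin => h.
        rewrite -ltr_ln ?posrE ?normr_gt0 ?mulr_gt0 ?expR_gt0 //.
        rewrite lnM ?posrE ?expR_gt0 // expRK.
        by move: h; move: (ln (Num.norm _)) => l; lra.
      case: lt => [lt|M0]; last first.
        by apply: nearW => k; apply: le_trans (H_ge0 _ _ _); rewrite lee_fin.
      have cst : `|f (phi k) s - f (phi k) t| @[k --> \oo] --> `|G s - G t|.
        by apply: cvg_norm; exact: cvgB.
      have st0 : 0 < `|s - t| by rewrite normr_gt0 subr_eq0; apply/eqP => h; apply: ts.
      have near1 : \forall k \near \oo, `|f (phi k) s - f (phi k) t| < D * expR (- M).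
        exact: (cvgr_lt _ cst).
      have near2 : \forall k \near \oo, 1 <= (phi k)%:R * `|s - t|.
        exists (Num.truncn (`|s - t|^-1)).+1 => // k /= hk.
        rewrite -ler_pdivrMr // div1r ltW // (lt_le_trans (truncnS_gt _)) //.
        by rewrite ler_nat (leq_trans hk) // ltnW.
      move: near1 near2; apply: filterS2 => k h1 h2.
      have ine : step_index (phi k) s != step_index (phi k) t.
        case: gs gt => [/andP[s0 s1] _] [/andP[t0 t1] _].
        have [st|st|e] := ltgtP s t; last by case: ts.
          have := @step_index_gap (phi k) 1 s t (ltW s0) t1.
          rewrite distrC gtr0_norm ?subr_gt0 // in h2.
          by move=> /(_ h2 (phi0 k)); rewrite addn1 neq_ltn => ->.
        have := @step_index_gap (phi k) 1 t s (ltW t0) s1.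
        rewrite gtr0_norm ?subr_gt0 // in h2.
        by move=> /(_ h2 (phi0 k)); rewrite addn1 neq_ltn orbC => ->.
      rewrite /H (negbTE ine) -/(f (phi k) s) -/(f (phi k) t).
      have fne : f (phi k) s - f (phi k) t != 0.
        rewrite subr_eq0 /f; move: ine; rewrite neq_ltn => /orP[h|h].
          by rewrite lt_eqF // xlt // h step_index_lt.
        by rewrite gt_eqF // xlt // h step_index_lt.
      rewrite kapE //; last first.
        have := f_C s (phi0 k); have := f_C t (phi0 k).
        have := ler_normB (f (phi k) s) (f (phi k) t); rewrite /D; lra.
      rewrite lee_fin.
      have : ln `|f (phi k) s - f (phi k) t| <= ln (D * expR (- M)).
        by rewrite ler_ln ?posrE ?normr_gt0 ?mulr_gt0 ?expR_gt0 // ltW.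
      rewrite lnM ?posrE ?expR_gt0 // expRK; move: (ln (Num.norm _)) => l; lra.
    + move=> k; exact: (integral_step_le (h := H (phi k) (step_index (phi k) s))).
  - move=> k; exact: (integral_step_le (h := A (phi k))).
have en : (energy mu <= 0)%E.
  rewrite (@energy_kenergy _ D C mu K) //; last by rewrite /D; lra.
  by rewrite leeBlDr // add0e.
apply: (@le_trans _ _ (expeR (- energy mu))).
  by rewrite -expeR0 lee_expeR leeNr oppe0.
apply: ereal_sup_ubound; exists mu => //; exists K; split => //.
by move=> z [/= Sz ->].
Qed.

End LowerBound.

Section CapacityOfSpectrum.
Variable R : realType.

(** The points are the eigenvalues of the truncations to the sites 0, ..., n - 1. The constant K + 3
    + B bounds both these eigenvalues and the spectrum. *)
Lemma capacity_spectrum_ge1 (V : int -> R) (K : R) : (forall n, `|V n| <= K) ->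
  (1 <= capacity (l2_spectrum (cop V)))%E.
Proof.
move=> VK; have K0 : 0 <= K by exact: le_trans (normr_ge0 _) (VK 0).
pose B : R := 2 * (3 * (2 + K ^+ 2)) + 2.
have B0 : 0 <= B by rewrite addr_ge0 // !mulr_ge0 // addr_ge0 // sqr_ge0.
pose W k : R := V k%:Z.
have -> : l2_spectrum (cop V) =
    [set z : R[i]%C | complex.Im z = 0 /\ rspec V (complex.Re z)].
  by apply/seteqP; split => z; rewrite /= (l2_spectrumP z VK).
apply: (@capacity_ge1 _ _ (K + 3 + B) (fun n i => nth 0 (jroots W n) i)).
- move=> n i j /andP[ij jn].
  exact: (@jroots_lt _ W n (Ordinal (ltn_trans ij jn)) (Ordinal jn)).
- move=> n i i_n; have WK k : `|W k| <= K by exact: VK.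
  have := jroots_bound WK (@jroots_mem _ W n (Ordinal i_n)); rewrite /=; lra.
- by move=> n; exact: jroots_vandermonde.
- move=> n i c r i_n h0 h1 h2.
  have lt1 := @jroots_lt _ W n (Ordinal (ltnW (ltnW i_n))) (Ordinal (ltnW i_n)) (ltnSn i).
  have lt2 := @jroots_lt _ W n (Ordinal (ltnW i_n)) (Ordinal i_n) (ltnSn i.+1).
  apply: (@rspec_near_roots _ V K n c r _ _ _ VK
    (@jroots_mem _ W n (Ordinal (ltnW (ltnW i_n))))
    (@jroots_mem _ W n (Ordinal (ltnW i_n))) (@jroots_mem _ W n (Ordinal i_n))) => //.
  - by rewrite lt_eqF.
  - by rewrite lt_eqF // (lt_trans lt1).
  - by rewrite lt_eqF.
- by move=> E; exact: rspec_closed.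
- move=> E /(rspec_bounded VK); rewrite -/B => EB.
  have : (`|E| - 1) ^+ 2 >= 0 by rewrite sqr_ge0.
  rewrite sqrrB real_normK ?num_real // expr1n mulr1; lra.
Qed.

End CapacityOfSpectrum.

(** * Capacity of sets on which a monic polynomial is small *)

Section VandermondeBound.
Variable R : realType.

Lemma prod_tri (n : nat) (F : nat -> nat -> R) :
  \prod_(i < n) \prod_(j < n | (i < j)%N) F i j = \prod_(j < n) \prod_(i < j) F i j.
Proof.
rewrite (exchange_big_dep xpredT) //=; apply: eq_bigr => j _.
by rewrite (big_ord_widen n (fun i => F i j) (ltnW (ltn_ord j))).
Qed.

(** The Leibniz formula loses a factor n!, whose logarithm is negligible against n^2. *)
Lemma det_le (n : nat) (M : 'M[R]_n) (b : 'I_n -> R) :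
  (forall k i, `|M k i| <= b k) -> `|\det M| <= n`!%:R * \prod_(k < n) b k.
Proof.
move=> Mb; rewrite /determinant; apply: le_trans (ler_norm_sum _ _ _) _.
apply: (@le_trans _ _ (\sum_(s : 'S_n) \prod_(k < n) b k)).
  apply: ler_sum => s _; rewrite normrM normrX normrN1 expr1n mul1r normr_prod.
  by apply: ler_prod => k _; rewrite normr_ge0 Mb.
by rewrite sumr_const card_Sn mulr_natl.
Qed.

Lemma ln_fact_le (n : nat) : (0 < n)%N -> ln (n`!%:R : R) <= n%:R * ln n%:R.
Proof.
move=> n0; rewrite [leRHS]mulr_natl -lnXn ?ltr0n //.
rewrite ler_ln ?posrE ?exprn_gt0 ?ltr0n ?fact_gt0 // -natrX ler_nat.
elim: n {n0} => // -[//|n] IH; rewrite factS expnS leq_mul //.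
by rewrite (leq_trans IH) // leq_exp2r.
Qed.

(* Vandermonde determinant in the monic basis Q^a X^b with b < deg Q. *)
Lemma ln_vandermonde_le (Q : {poly R}) (d n : nat) (e C : R) (x : nat -> R) :
  Q \is monic -> size Q = d.+1 -> (0 < d)%N -> (0 < n)%N -> 0 <= e -> 1 <= C ->
  (forall i, (i < n)%N -> `|x i| <= C /\ `|Q.[x i]| <= expR (e * d%:R)) ->
  (forall i j, (i < j < n)%N -> x i != x j) ->
  2 * \sum_(j < n) \sum_(i < j) ln `|x i - x j| <=
  n%:R * (2 * ln n%:R + 2 * d%:R * ln C + e * n%:R).
Proof.
move=> Qm Qs d0 n0 e0 C1 xP xne.
have C0 : 0 < C by exact: lt_le_trans C1.
have -> : \sum_(j < n) \sum_(i < j) ln `|x i - x j| =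
    ln `|\prod_(i < n) \prod_(j < n | (i < j)%N) (x j - x i)|.
  rewrite (prod_tri n (fun i j => x j - x i)) normr_prod ln_prod => [|j _].
    apply: eq_bigr => j _; rewrite normr_prod ln_prod => [|i _].
      by apply: eq_bigr => i _; rewrite distrC.
    by rewrite normr_gt0 subr_eq0 eq_sym xne // !ltn_ord.
  rewrite normr_gt0; apply/prodf_neq0 => i _.
  by rewrite subr_eq0 eq_sym xne // !ltn_ord.
pose p (k : 'I_n) : {poly R} := Q ^+ (k %/ d) * 'X^(k %% d).
have pm k : p k \is monic by rewrite rpredM ?rpredX ?monicX.
have ps k : size (p k) = k.+1.
  have Qa : Q ^+ (k %/ d) \is monic by rewrite rpredX.
  have Qp : (0 < size (Q ^+ (k %/ d)))%N by rewrite size_poly_gt0 monic_neq0.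
  rewrite size_monicM // ?monic_neq0 ?monicXn // size_polyXn.
  rewrite -(prednK Qp) size_exp Qs /=; have := divn_eq k d; lia.
have dE : \det (\matrix_(k, i) (p k).[x i]) =
    \prod_(i < n) \prod_(j < n | (i < j)%N) (x j - x i).
  exact: (det_monic_family (fun i : 'I_n => x i) pm ps).
have dn0 : 0 < `|\det (\matrix_(k, i) (p k).[x (i : 'I_n)])|.
  rewrite dE normr_gt0; apply/prodf_neq0 => i _; apply/prodf_neq0 => j ij.
  by rewrite subr_eq0 eq_sym xne // ij ltn_ord.
rewrite -dE.
(* Row k has entries Q^a X^b with a d <= k and b < d: e >= 0 gives |Q|^a <= exp(e k), and C >= 1
   gives |x|^b <= C^d. *)
have le1 : `|\det (\matrix_(k, i) (p k).[x (i : 'I_n)])| <=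
    n`!%:R * \prod_(k < n) (expR (e * k%:R) * C ^+ d).
  apply: det_le => k i; rewrite mxE /p hornerM horner_exp hornerXn normrM !normrX.
  have [xi Qi] := xP i (ltn_ord i).
  apply: ler_pM; rewrite ?exprn_ge0 //.
    apply: (@le_trans _ _ (expR (e * d%:R) ^+ (k %/ d))).
      by rewrite lerXn2r ?nnegrE ?expR_ge0.
    rewrite -expRM_natl ler_expR mulrCA ler_wpM2l // -natrM ler_nat.
    exact: leq_trunc_div.
  apply: (@le_trans _ _ (C ^+ (k %% d))).
    by rewrite lerXn2r ?nnegrE // ltW.
  by rewrite ler_weXn2l // ltnW // ltn_mod.
have pos : 0 < n`!%:R * \prod_(k < n) (expR (e * k%:R) * C ^+ d) :> R.
  by rewrite mulr_gt0 ?ltr0n ?fact_gt0 // prodr_gt0 // => k _; rewrite mulr_gt0 ?expR_gt0 ?exprn_gt0.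
have le2 : ln `|\det (\matrix_(k, i) (p k).[x (i : 'I_n)])| <=
   ln (n`!%:R * \prod_(k < n) (expR (e * k%:R) * C ^+ d)).
  by rewrite ler_ln ?posrE.
rewrite lnM ?posrE ?ltr0n ?fact_gt0 // in le2; last first.
  by rewrite prodr_gt0 // => k _; rewrite mulr_gt0 ?expR_gt0 ?exprn_gt0.
rewrite ln_prod in le2; last by move=> k _; rewrite mulr_gt0 ?expR_gt0 ?exprn_gt0.
have E : \sum_(k < n) ln (expR (e * k%:R) * C ^+ d) <= e * (n%:R * n%:R / 2) + n%:R * (d%:R * ln C).
  have -> : \sum_(k < n) ln (expR (e * k%:R) * C ^+ d) =
     \sum_(k < n) (e * k%:R) + \sum_(k < n) (d%:R * ln C).
    rewrite -big_split; apply: eq_bigr => k _ /=.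
    by rewrite lnM ?posrE ?expR_gt0 ?exprn_gt0 // expRK lnXn // mulr_natl.
  rewrite sumr_const card_ord -[X in _ + X <= _]mulr_natl lerD2r -mulr_sumr ler_wpM2l //.
  rewrite ler_pdivlMr //; elim: (n) => [|m IH]; first by rewrite big_ord0 !mul0r.
  rewrite big_ord_recr /= mulrDl -natr1.
  apply: (le_trans (lerD IH (lexx _))); nra.
have := ln_fact_le n0; move: le2 E; move: (ln `|_|) => v; lra.
Qed.

End VandermondeBound.

(** * Well-spread points from a measure of finite energy *)

Section UpperBound.
Variable R : realType.
Variables (mu : probability (plane R) R) (K : set (R * R)) (D I : R).
Hypothesis mK : measurable (K : set (plane R)).
Hypothesis mu1 : mu K = 1%E.
Hypothesis kenI : kenergy D mu = I%:E.

Let Phi (z : R * R) : \bar R := (\int[mu]_w kap D (z.1 - w.1))%E.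

Let Phi_ge0 z : (0 <= Phi z)%E.
Proof. by apply: integral_ge0 => w _; exact: kap_ge0. Qed.

Let mPhi : measurable_fun [set: plane R] Phi.
Proof. exact: measurable_kap_int. Qed.

Let aeG : {ae mu, forall z, K z /\ Phi z \is a fin_num}.
Proof.
have aeK : {ae mu, forall z, K z}.
  exists (~` K); split; [exact: measurableC| |by []].
  by rewrite probability_setC // mu1 subee.
have iPhi : mu.-integrable [set: plane R] Phi.
  apply/integrableP; split => //.
  under eq_integral do rewrite gee0_abs //.
  by move: kenI; rewrite /kenergy -/Phi => ->; rewrite ltry.
have aeP := integrable_ae measurableT iPhi.
case: aeK => N1 [mN1 N10 H1]; case: aeP => N2 [mN2 N20 H2].
exists (N1 `|` N2); split; [exact: measurableU|by rewrite measureU0|].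
move=> z /= /not_andP[h|h]; first by left; apply: H1.
by right; apply: H2 => /= /(_ Logic.I).
Qed.

Let mkap (z : R * R) : measurable_fun [set: plane R] (fun w : plane R => kap D (z.1 - w.1)).
Proof. exact: (measurable_section_l z (measurable_kap2 D)). Qed.

Let krl (z w : R * R) : R := fine (kap D (z.1 - w.1)).
Let Phir (z : R * R) : R := fine (Phi z).

(* A point where the integrand does not exceed its mean by more than 1. *)
Let pick_point (k : nat) (x : nat -> R * R) (c : R) : 0 <= c ->
  (forall i, (i < k)%N -> Phi (x i) \is a fin_num) ->
  exists z, [/\ K z, Phi z \is a fin_num,
    forall i, (i < k)%N -> kap D ((x i).1 - z.1) \is a fin_num &
    \sum_(i < k) krl (x i) z + c * Phir z <= \sum_(i < k) Phir (x i) + c * I + 1].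
Proof.
move=> c0 xf.
pose g (z : plane R) : \bar R := (\sum_(i < k) kap D ((x i).1 - z.1) + c%:E * Phi z)%E.
pose B := \sum_(i < k) Phir (x i) + c * I.
have ms : measurable_fun [set: plane R] (fun z : plane R => \sum_(i < k) kap D ((x i).1 - z.1))%E.
  by apply: emeasurable_sum => i; exact: mkap.
have mcP : measurable_fun [set: plane R] (fun z => c%:E * Phi z)%E by exact: measurable_funeM.
have s0 z : (0 <= \sum_(i < k) kap D ((x i).1 - z.1))%E.
  by apply: sume_ge0 => i _; exact: kap_ge0.
have cP0 z : (0 <= c%:E * Phi z)%E by rewrite mule_ge0 // lee_fin.
have gB : (\int[mu]_z g z = B%:E)%E.
  rewrite /g ge0_integralD //.
  rewrite ge0_integral_sum; [|exact: measurableT|by move=> i; exact: mkap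
    |by move=> i z _; exact: kap_ge0].
  rewrite ge0_integralZl; [|exact: measurableT|exact: mPhi|by move=> z _; exact: Phi_ge0|by rewrite lee_fin].
  rewrite -[X in (_ + _ * X)%E]/(kenergy D mu) kenI -EFinM /B EFinD; congr (_ + _)%E.
  rewrite -sumEFin; apply: eq_bigr => i _; rewrite /Phir fineK ?xf //.
have [z [Kz Pz gz]] : exists z, [/\ K z, Phi z \is a fin_num & (g z <= (B + 1)%:E)%E].
  apply: contrapT => H.
  have aeg : {ae mu, forall z, setT z -> (cst (B + 1)%:E z <= g z)%E}.
    apply: (ae_imp aeG) => z [Kz Pz] _ /=; rewrite leNgt; apply/negP => lt.
    by apply: H; exists z; split => //; exact: ltW.
  have B0 : 0 <= B.
    rewrite addr_ge0 ?sumr_ge0 // => [i _|]; first by rewrite fine_ge0.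
    by rewrite mulr_ge0 // -lee_fin -kenI; apply: integral_ge0 => z _; exact: Phi_ge0.
  have : (\int[mu]_z cst (B + 1)%:E z <= \int[mu]_z g z)%E.
    apply: ae_ge0_le_integral => //.
    - by move=> z _; rewrite lee_fin addr_ge0.
    - by move=> z _; rewrite adde_ge0.
    - by apply: emeasurable_funD.
  rewrite gB integral_cst; last exact: measurableT.
  have -> : ((B + 1)%:E * mu setT = (B + 1)%:E)%E.
    by rewrite -[RHS]mule1; congr (_ * _)%E; exact: probability_setT.
  by rewrite lee_fin gerDl ler10.
have kf i : (i < k)%N -> kap D ((x i).1 - z.1) \is a fin_num.
  move=> ik; rewrite ge0_fin_numE ?kap_ge0 //.
  apply: (@le_lt_trans _ _ (B + 1)%:E); last by rewrite ltry.
  apply: le_trans gz; rewrite /g (bigD1 (Ordinal ik)) //= -addeA leeDl //.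
  by rewrite adde_ge0 // sume_ge0 // => j _; exact: kap_ge0.
exists z; split => //.
rewrite -lee_fin -/B; apply: le_trans gz; rewrite /g EFinD EFinM /Phir fineK //.
rewrite leeD2r // -sumEFin; apply: lee_sum => i _.
by rewrite /krl fineK // kf.
Qed.

(** Derandomization: the left side is the expected sum of the kernel over ordered pairs of N
    independent points, given the first k; at k = 0 it is N (N - 1) I. Each choice by [pick_point],
    with c = N - k - 1, raises it by at most 2. *)
Let pick_points (N k : nat) : (k <= N)%N -> exists x : nat -> R * R,
  [/\ forall i, (i < k)%N -> K (x i),
      forall i, (i < k)%N -> Phi (x i) \is a fin_num,
      forall i j, (i < j < k)%N -> kap D ((x i).1 - (x j).1) \is a fin_num &
      2 * \sum_(j < k) \sum_(i < j) krl (x i) (x j) +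
        2 * (N%:R - k%:R) * \sum_(i < k) Phir (x i) +
        (N%:R - k%:R) * (N%:R - k%:R - 1) * I <=
      N%:R * (N%:R - 1) * I + 2 * k%:R].
Proof.
elim: k => [_|k IH kN].
  exists (fun=> (0, 0)); split => // [i j|]; first by rewrite ltn0 andbF.
  by rewrite !big_ord0 !subr0 !mulr0 !addr0 add0r.
have [x [xK xP xd xs]] := IH (ltnW kN).
have c0 : 0 <= N%:R - k%:R - 1 :> R.
  by rewrite -addrA -opprD subr_ge0 natr1 ler_nat.
have [z [Kz Pz zk zs]] := pick_point c0 xP.
pose x' i := if (i < k)%N then x i else z.
have x'l i : (i < k)%N -> x' i = x i by rewrite /x' => ->.
have x'k : x' k = z by rewrite /x' ltnn.
exists x'; split.
- by move=> i _; rewrite /x'; case: ifP => // /xK.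
- by move=> i _; rewrite /x'; case: ifP => // /xP.
- move=> i j /andP[ij]; rewrite ltnS leq_eqVlt => /orP[/eqP jk|jk].
    by rewrite jk x'k x'l -?jk //; apply: zk; rewrite -jk.
  by rewrite !x'l ?(ltn_trans ij jk) //; apply: xd; rewrite ij.
have -> : \sum_(j < k.+1) \sum_(i < j) krl (x' i) (x' j) =
    \sum_(j < k) \sum_(i < j) krl (x i) (x j) + \sum_(i < k) krl (x i) z.
  rewrite big_ord_recr /= x'k; congr (_ + _); last first.
    by apply: eq_bigr => i _; rewrite x'l.
  apply: eq_bigr => j _; apply: eq_bigr => i _.
  by rewrite !x'l // (ltn_trans (ltn_ord i)).
have -> : \sum_(i < k.+1) Phir (x' i) = \sum_(i < k) Phir (x i) + Phir z.
  rewrite big_ord_recr /= x'k; congr (_ + _).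
  by apply: eq_bigr => i _; rewrite x'l.
rewrite -natr1.
move: xs zs; set T := \sum_(j < k) _; set S := \sum_(i < k) krl _ _; set U := \sum_(i < k) Phir _.
set n : R := N%:R; set l : R := k%:R => xs zs.
have h := xs; nra.
Qed.

Hypothesis D_ge1 : 1 <= D.
Hypothesis KD : forall z w, K z -> K w -> `|z.1 - w.1| <= D.

Lemma energy_points (N : nat) : exists x : nat -> R,
  [/\ forall i, (i < N)%N -> exists2 z, K z & x i = z.1,
      forall i j, (i < j < N)%N -> x i != x j &
      N%:R * (N%:R - 1) * (ln D - I) - 2 * N%:R <=
      2 * \sum_(j < N) \sum_(i < j) ln `|x i - x j|].
Proof.
have [x [xK xP xd]] := pick_points (leqnn N).
rewrite subrr mulr0 !mul0r !addr0 => xs.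
have xne i j : (i < j < N)%N -> (x i).1 - (x j).1 != 0.
  by move=> /xd; rewrite /kap; case: ifP.
exists (fun i => (x i).1); split.
- by move=> i iN; exists (x i) => //; exact: xK.
- by move=> i j ij; rewrite -subr_eq0 xne.
have E : \sum_(j < N) \sum_(i < j) krl (x i) (x j) =
    \sum_(j < N) \sum_(i < j) ln D - \sum_(j < N) \sum_(i < j) ln `|(x i).1 - (x j).1|.
  rewrite -sumrB; apply: eq_bigr => j _; rewrite -sumrB; apply: eq_bigr => i _.
  have jN := ltn_ord j; have ij := ltn_ord i.
  rewrite /krl kapE ?xne ?ij //.
  by apply: KD; apply: xK => //; exact: ltn_trans ij jN.
have E2 : 2 * \sum_(j < N) \sum_(i < j) ln D = N%:R * (N%:R - 1) * ln D.
  elim: (N) => [|m IH]; first by rewrite big_ord0 mulr0 !mul0r.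
  rewrite big_ord_recr /= mulrDr IH sumr_const card_ord -[X in _ + _ * X]mulr_natl -natr1; ring.
move: xs; rewrite E mulrBr E2; set X := 2 * \sum_(j < N) _; lra.
Qed.

End UpperBound.

(** If the energy were below -e, [energy_points] and [ln_vandermonde_le] for the same n points would
    give (n - 1) del <= O(ln n) with del > 0. The unknown set carries no measurability; it enters
    through the compact K on which the measure lives. *)
Lemma capacity_le (R : realType) (S : set R[i]%C) (Q : {poly R}) (d : nat) (C e : R) :
  Q \is monic -> size Q = d.+1 -> (0 < d)%N -> 0 <= e ->
  (forall z, S z -> [/\ complex.Im z = 0, `|complex.Re z| <= C &
     `|Q.[complex.Re z]| <= expR (e * d%:R)]) ->
  (capacity S <= (expR e)%:E)%E.
Proof.
move=> Qm Qs d0 e0 SP; apply: ge_ereal_sup => _ [mu /= [K [cK KS mu1]] <-].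
pose C1 := Num.max C 1.
have C11 : 1 <= C1 by rewrite le_max lexx orbT.
pose D : R := 2 * C1 + 1.
have D1 : 1 <= D by rewrite /D; lra.
have KP z : K z -> [/\ z.2 = 0, `|z.1| <= C1 & `|Q.[z.1]| <= expR (e * d%:R)].
  move=> /KS /= /SP; rewrite /to_complex /= => -[z2 zC zQ]; split => //.
  by rewrite le_max zC.
(* K lies on the real axis, so it is the product of its closed projection with {0}. *)
have mK : measurable (K : set (plane R)).
  have -> : K = [set z.1 | z in K] `*` [set 0].
    apply/seteqP; split => [z Kz|[z1 z2] [/= [w Kw <-] ->]].
      by have [z2 _ _] := KP z Kz; split => //; exists z.
    by have [w2 _ _] := KP w Kw; rewrite -w2 -surjective_pairing.
  apply: measurableX => //; apply: closed_measurable.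
  apply: compact_closed; first exact: norm_hausdorff.
  apply: continuous_compact => //; apply: continuous_subspaceT => z; exact: cvg_fst.
have KD z w : K z -> K w -> `|z.1 - w.1| <= D.
  move=> /KP[_ h1 _] /KP[_ h2 _]; apply: le_trans (ler_normB _ _) _; rewrite /D; lra.
have en : energy mu = (kenergy D mu - (ln D)%:E)%E.
  apply: (@energy_kenergy _ D C1 mu K) => //; first by rewrite /D; lra.
  by move=> z /KP[].
have k0 : (0 <= kenergy D mu)%E.
  by apply: integral_ge0 => z _; apply: integral_ge0 => w _; exact: kap_ge0.
rewrite -[(expR e)%:E]/(expeR e%:E) lee_expeR en.
suff : ((ln D - e)%:E <= kenergy D mu)%E.
  case: (kenergy D mu) k0 => [r| |] //= _; first by rewrite !lee_fin; lra.
  by rewrite leNye.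
rewrite leNgt; apply/negP => lt.
have [I kI] : exists I, kenergy D mu = I%:E.
  by case: (kenergy D mu) k0 lt => [r| |] //; exists r.
rewrite kI lte_fin in lt.
pose del := ln D - I - e; have del0 : 0 < del by rewrite /del; lra.
have main n : (0 < n)%N -> (n%:R - 1) * del <= 2 + e + 2 * ln n%:R + 2 * d%:R * ln C1 :> R.
  move=> n0; have [x [xK xne xs]] := energy_points mK mu1 kI KD n.
  have := @ln_vandermonde_le R Q d n e C1 x Qm Qs d0 n0 e0 C11.
  move=> /(_ _ xne); have xP i : (i < n)%N -> `|x i| <= C1 /\ `|Q.[x i]| <= expR (e * d%:R).
    by move=> /xK[z /KP[_ h1 h2] ->].
  move=> /(_ xP) le; have n1 : 0 < n%:R :> R by rewrite ltr0n.
  rewrite -(ler_pM2l n1).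
  move: xs le; set X := 2 * \sum_(j < n) _; set l := ln n%:R; set lc := ln C1.
  rewrite /del; nra.
pose c := 2 + e + 2 * d%:R * ln C1 + del.
have c0 : 0 < c.
  have : 0 <= 2 * d%:R * ln C1 by rewrite mulr_ge0 // ?ln_ge0 // mulr_ge0.
  by rewrite /c; lra.
(* Used with n = m^2, so that ln n = 2 ln m <= 2 (m - 1) is linear in m, while m del > c + 4 gives
   m^2 del > c + 4 m. *)
pose m := (Num.truncn ((c + 4) / del)).+1.
have mR : 1 <= m%:R :> R by rewrite ler1n.
have := main (m ^ 2)%N; rewrite expn_gt0 /= => /(_ isT).
have -> : ln ((m ^ 2)%:R) = ln m%:R *+ 2 :> R by rewrite natrX lnXn // (lt_le_trans ltr01).
have lm : ln m%:R <= m%:R - 1 :> R.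
  have := @le_ln1Dx R (m%:R - 1); rewrite (_ : 1 + (m%:R - 1) = m%:R); last by ring.
  by apply; lra.
have mc : c + 4 < m%:R * del by rewrite -ltr_pdivrMr // truncnS_gt.
rewrite natrX; move: mc lm c0; rewrite /c; set M : R := m%:R in mR *; set l := ln M; set cc := ln C1.
nra.
Qed.

(** * Cocycles and small monic polynomials *)

Section OperatorNorm.
Variable R : realType.
Local Notation C := R[i]%C.
Local Notation normc := Normc.normc.
Implicit Types (A B : 'M[C]_2) (x y : 'cV[C]_2).

Lemma normc_ge0 (z : C) : 0 <= normc z.
Proof. by case: z => a b; rewrite sqrtr_ge0. Qed.

Lemma eucl_norm2 x : eucl_norm x = Num.sqrt (normc (x 0 0) ^+ 2 + normc (x 1 0) ^+ 2).
Proof. by rewrite /eucl_norm !big_ord_recl big_ord0 addr0; congr (Num.sqrt (_ + normc (x _ _) ^+ 2)); apply: val_inj. Qed.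

Lemma eucl_norm_ge0 x : 0 <= eucl_norm x.
Proof. exact: sqrtr_ge0. Qed.

Lemma le_sqrt_sq (a b : R) : 0 <= b -> a ^+ 2 <= b ^+ 2 -> a <= b.
Proof.
move=> b0 ab; apply: le_trans (ler_norm a) _.
by rewrite -(ger0_norm b0) -(@ler_pXn2r _ 2) ?nnegrE // !real_normK ?num_real.
Qed.

Lemma eucl_norm_sqr x : eucl_norm x ^+ 2 = normc (x 0 0) ^+ 2 + normc (x 1 0) ^+ 2.
Proof. by rewrite eucl_norm2 sqr_sqrtr // addr_ge0 // sqr_ge0. Qed.

Lemma eucl_normD x y : eucl_norm (x + y) <= eucl_norm x + eucl_norm y.
Proof.
apply: le_sqrt_sq; first by rewrite addr_ge0 ?eucl_norm_ge0.
rewrite sqrrD !eucl_norm_sqr !mxE.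
set a := normc (x 0 0); set b := normc (x 1 0).
set c := normc (y 0 0); set d := normc (y 1 0).
have h0 := le_normcD (x 0 0) (y 0 0); have h1 := le_normcD (x 1 0) (y 1 0).
have cs : a * c + b * d <= eucl_norm x * eucl_norm y.
  apply: le_sqrt_sq; first by rewrite mulr_ge0 ?eucl_norm_ge0.
  rewrite exprMn !eucl_norm_sqr -/a -/b -/c -/d.
  have := sqr_ge0 (a * d - b * c); nra.
have g0 : normc (x 0 0 + y 0 0) ^+ 2 <= (a + c) ^+ 2.
  by rewrite lerXn2r ?nnegrE ?addr_ge0 ?normc_ge0.
have g1 : normc (x 1 0 + y 1 0) ^+ 2 <= (b + d) ^+ 2.
  by rewrite lerXn2r ?nnegrE ?addr_ge0 ?normc_ge0.
rewrite mulr2n; nra.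
Qed.

Lemma normc_le_eucl x (i : 'I_2) : normc (x i 0) <= eucl_norm x.
Proof.
apply: le_sqrt_sq; first exact: eucl_norm_ge0.
rewrite eucl_norm_sqr; case: i => [[|[|//]]] p.
  by rewrite (_ : Ordinal p = 0) ?lerDl ?sqr_ge0 //; apply: val_inj.
by rewrite (_ : Ordinal p = 1) ?lerDr ?sqr_ge0 //; apply: val_inj.
Qed.

Lemma eucl_le_sum x : eucl_norm x <= normc (x 0 0) + normc (x 1 0).
Proof.
apply: le_sqrt_sq; first by rewrite addr_ge0 ?normc_ge0.
rewrite eucl_norm_sqr; have := mulr_ge0 (normc_ge0 (x 0 0)) (normc_ge0 (x 1 0)).
nra.
Qed.

Lemma eucl_normZ (t : R) x : eucl_norm (t%:C%C *: x) = `|t| * eucl_norm x.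
Proof.
rewrite !eucl_norm2 !mxE !Normc.normcM.
have -> : normc t%:C%C = `|t| by rewrite /= expr0n addr0 sqrtr_sqr.
rewrite !exprMn -mulrDr sqrtrM ?sqr_ge0 // sqrtr_sqr normr_id //.
Qed.

(** A submultiplicative norm dominating [op_norm], used for differences of matrix products. *)
Definition entsum A : R := \sum_(i < 2) \sum_(j < 2) normc (A i j).

Lemma entsum4 A : entsum A = (normc (A 0 0) + normc (A 0 1)) + (normc (A 1 0) + normc (A 1 1)).
Proof.
rewrite /entsum !big_ord_recl !big_ord0 !addr0.
by rewrite (_ : lift ord0 ord0 = 1) //; apply: val_inj.
Qed.

Lemma entsum_ge0 A : 0 <= entsum A.
Proof. by rewrite entsum4 !addr_ge0 ?normc_ge0. Qed.

Lemma mulmx2 (n : nat) A (B : 'M[C]_(2, n)) i j : (A *m B) i j = A i 0 * B 0 j + A i 1 * B 1 j.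
Proof.
rewrite mxE !big_ord_recl big_ord0 addr0.
by rewrite (_ : lift ord0 ord0 = 1) //; apply: val_inj.
Qed.

Lemma eucl_mul_le A x : eucl_norm (A *m x) <= entsum A * eucl_norm x.
Proof.
apply: le_trans (eucl_le_sum _) _; rewrite !mulmx2 entsum4.
have h i : normc (A i 0 * x 0 0 + A i 1 * x 1 0) <= (normc (A i 0) + normc (A i 1)) * eucl_norm x.
  apply: le_trans (le_normcD _ _) _; rewrite !Normc.normcM mulrDl.
  by apply: lerD; apply: ler_wpM2l; rewrite ?normc_ge0 ?normc_le_eucl.
by rewrite (mulrDl (_ + _)); apply: lerD.
Qed.

Lemma op_norm_has_sup A : has_sup [set eucl_norm (A *m x) | x in [set x | eucl_norm x <= 1]].
Proof.
split.
  exists (eucl_norm (A *m 0)), 0 => //=.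
  by rewrite eucl_norm2 !mxE /= expr0n /= addr0 sqrtr0 expr0n /= addr0 sqrtr0 ler01.
exists (entsum A) => _ [x /= x1 <-]; apply: le_trans (eucl_mul_le _ _) _.
by rewrite -[leRHS]mulr1 ler_wpM2l ?entsum_ge0.
Qed.

Lemma op_norm_ub A x : eucl_norm x <= 1 -> eucl_norm (A *m x) <= op_norm A.
Proof. by move=> x1; apply: (sup_upper_bound (op_norm_has_sup A)); exists x. Qed.

Lemma op_norm_ge0 A : 0 <= op_norm A.
Proof.
apply: le_trans (eucl_norm_ge0 (A *m 0)) _; apply: op_norm_ub.
by rewrite eucl_norm2 !mxE /= expr0n /= addr0 sqrtr0 expr0n /= addr0 sqrtr0 ler01.
Qed.

Lemma op_normP A x : eucl_norm (A *m x) <= op_norm A * eucl_norm x.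
Proof.
have [x0|x0] := eqVneq (eucl_norm x) 0.
  by rewrite x0 mulr0; have := eucl_mul_le A x; rewrite x0 mulr0.
have xp : 0 < eucl_norm x by rewrite lt_def x0 eucl_norm_ge0.
pose t := (eucl_norm x)^-1.
have := @op_norm_ub A (t%:C%C *: x); rewrite -scalemxAr !eucl_normZ.
have -> : `|t| = t by rewrite ger0_norm // invr_ge0 ltW.
by rewrite /t mulVf // lexx => /(_ isT); rewrite mulrC ler_pdivrMr.
Qed.

Lemma op_norm_le A (M : R) : (forall x, eucl_norm (A *m x) <= M * eucl_norm x) -> 0 <= M ->
  op_norm A <= M.
Proof.
move=> AM M0; apply: sup_le_ub; first by have [] := op_norm_has_sup A.
move=> _ [x /= x1 <-]; apply: le_trans (AM x) _.
by rewrite -[leRHS]mulr1 ler_wpM2l.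
Qed.

Lemma op_norm_lip A B : op_norm A <= op_norm B + entsum (A - B).
Proof.
apply: op_norm_le; last by rewrite addr_ge0 ?op_norm_ge0 ?entsum_ge0.
move=> x; rewrite -{1}(subrK B A) mulmxDl addrC mulrDl.
apply: le_trans (eucl_normD _ _) _.
by apply: lerD; [exact: op_normP|exact: eucl_mul_le].
Qed.

Lemma entry_le_op A i j : normc (A i j) <= op_norm A.
Proof.
pose x : 'cV[C]_2 := delta_mx j 0.
have n0 : normc (0 : C) = 0 by rewrite /= expr0n addr0 sqrtr0.
have n1 : normc (1 : C) = 1 by rewrite /= expr1n expr0n addr0 sqrtr1.
have x1 : eucl_norm x <= 1.
  rewrite eucl_norm2 !mxE !eqxx !andbT.
  case: j {x} => [[|[|//]]] p /=; rewrite ?expr0n ?expr1n ?addr0 ?add0r ?sqrtr0 ?sqrtr1 ?expr0n ?expr1n /= ?addr0 ?add0r ?sqrtr1 //.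
apply: le_trans (op_norm_ub A x1); apply: le_trans (normc_le_eucl _ i).
by rewrite -colE mxE.
Qed.

Lemma det_2x2 A : \det A = A 0 0 * A 1 1 - A 0 1 * A 1 0.
Proof.
rewrite (expand_det_row _ 0) !big_ord_recl big_ord0 addr0 /cofactor !det_mx11 !mxE /=.
rewrite expr0 expr1 mul1r mulN1r mulrN.
have o0 : ord0 = 0 :> 'I_2 by apply: val_inj.
have o1 : lift 0 0 = 1 :> 'I_2 by apply: val_inj.
have o2 : lift (lift ord0 ord0) 0 = 0 :> 'I_2 by apply: val_inj.
by rewrite o2 o0 (_ : lift ord0 ord0 = 1 :> 'I_2) ?o1 //; apply: val_inj.
Qed.

(** All entries are bounded by the norm, so 1 = |det A| is at most twice its square. The crude value
    1/2 keeps [ln] in a range where it is 2-Lipschitz. *)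
Lemma op_norm_det1 A : \det A = 1 -> 2^-1 <= op_norm A.
Proof.
move=> d1; have n1 : normc (1 : C) = 1 by rewrite /= expr1n expr0n addr0 sqrtr1.
have := n1; rewrite -{1}d1 det_2x2 => e1.
have : normc (A 0 0 * A 1 1 - A 0 1 * A 1 0) <= op_norm A * op_norm A + op_norm A * op_norm A.
  apply: le_trans (le_normcD _ _) _; rewrite normcN !Normc.normcM.
  by apply: lerD; apply: ler_pM; rewrite ?normc_ge0 ?entry_le_op.
rewrite e1 => h; rewrite leNgt; apply/negP => lt.
have := op_norm_ge0 A; move: lt h; move: (op_norm A) => r; nra.
Qed.

Lemma entsumD A B : entsum (A + B) <= entsum A + entsum B.
Proof.
rewrite !entsum4 !mxE.
have := le_normcD (A 0 0) (B 0 0); have := le_normcD (A 0 1) (B 0 1).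
have := le_normcD (A 1 0) (B 1 0); have := le_normcD (A 1 1) (B 1 1).
lra.
Qed.

Lemma entsumM A B : entsum (A *m B) <= entsum A * entsum B.
Proof.
rewrite !entsum4 !mulmx2.
have h i j : normc (A i 0 * B 0 j + A i 1 * B 1 j) <=
    normc (A i 0) * normc (B 0 j) + normc (A i 1) * normc (B 1 j).
  by apply: le_trans (le_normcD _ _) _; rewrite !Normc.normcM.
have p (i j i' j' : 'I_2) : 0 <= normc (A i j) * normc (B i' j').
  by rewrite mulr_ge0 ?normc_ge0.
have := h 0 0; have := h 0 1; have := h 1 0; have := h 1 1.
have := p 0 0 1 0; have := p 0 0 1 1; have := p 0 1 0 0; have := p 0 1 0 1.
have := p 1 0 1 0; have := p 1 0 1 1; have := p 1 1 0 0; have := p 1 1 0 1.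
lra.
Qed.

Lemma ln_le_lip (a b s : R) : 2^-1 <= a -> 2^-1 <= b -> a <= b + s -> 0 <= s ->
  ln a <= ln b + 2 * s.
Proof.
move=> a2 b2 L s0.
have a0 : 0 < a by lra.
have b0 : 0 < b by lra.
rewrite -lerBlDl -ln_div ?posrE //.
have r0 : 0 < a / b by rewrite divr_gt0.
have := @le_ln1Dx R (a / b - 1).
rewrite (_ : 1 + (_ - 1) = a / b); last by ring.
move=> /(_ _) h; apply: le_trans (h _) _; first lra.
rewrite lerBlDr ler_pdivrMr //; move: L b2 s0; nra.
Qed.

Lemma ln_op_le A B : \det A = 1 -> \det B = 1 ->
  ln (op_norm A) <= ln (op_norm B) + 2 * entsum (A - B).
Proof.
move=> dA dB; apply: ln_le_lip; [exact: op_norm_det1|exact: op_norm_det1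
  |exact: op_norm_lip|exact: entsum_ge0].
Qed.

End OperatorNorm.

Section Cocycle.
Variable R : realType.
Local Notation C := R[i]%C.
Local Notation normc := Normc.normc.
Variables (v : R -> R) (alpha : R).
Implicit Types (E t s : R) (m n k : nat).

Definition tmx (E t : R) : 'M[C]_2 := transfer v (E%:C)%C t.

Definition tprod (E : R) (n : nat) (t : R) : 'M[C]_2 := transfer_iter v alpha (E%:C)%C n t.

Lemma tprodS E n t : tprod E n.+1 t = tmx E (t + n%:R * alpha) *m tprod E n t.
Proof. by []. Qed.

Lemma tmxE E t : [/\ tmx E t 0 0 = ((E - v t)%:C)%C, tmx E t 0 1 = -1,
  tmx E t 1 0 = 1 & tmx E t 1 1 = 0].
Proof. by split; rewrite mxE //= rmorphB. Qed.

Lemma det_tprod E n t : \det (tprod E n t) = 1.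
Proof.
elim: n => [|n IH]; first by rewrite det1.
rewrite tprodS det_mulmx IH mulr1 det_2x2.
by have [_ -> -> ->] := tmxE E (t + n%:R * alpha); rewrite mulr0 mulr1 opprK add0r.
Qed.

Lemma tprodD E m n t : tprod E (m + n) t = tprod E m (t + n%:R * alpha) *m tprod E n t.
Proof.
elim: m => [|m IH]; first by rewrite mul1mx.
rewrite addSn !tprodS IH mulmxA; congr (tmx E _ *m _ *m _).
by rewrite natrD; ring.
Qed.

(** P_n is the characteristic polynomial of a truncation, so bounds on the cocycle become bounds on
    these polynomials. *)
Lemma tprod_col E n t :
  tprod E n t 0 0 = (((jval (fun k => v (t + k%:R * alpha)) E n).1)%:C)%C /\
  tprod E n t 1 0 = (((jval (fun k => v (t + k%:R * alpha)) E n).2)%:C)%C.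
Proof.
elim: n => [|n [h0 h1]]; first by rewrite /tprod /= !mxE.
rewrite tprodS !mulmx2 h0 h1 jvalS.
have [-> -> -> ->] := tmxE E (t + n%:R * alpha).
move: (jval _ _ _) => [a b] /=; rewrite mul1r mul0r addr0 mulN1r; split => //.
by rewrite -rmorphM -rmorphB.
Qed.

(** P_(kn)(E) is an entry of a product of k transfer blocks of length n. *)
Lemma jval_le_prod E n k t :
  `|(jval (fun k => v (t + k%:R * alpha)) E (k * n)).1| <=
  \prod_(b < k) op_norm (tprod E n (t + (b * n)%:R * alpha)).
Proof.
pose e : 'cV[C]_2 := delta_mx 0 0.
have e1 : eucl_norm e = 1.
  rewrite eucl_norm2 !mxE /= expr1n !expr0n /= !addr0 sqrtr1 expr1n sqrtr0 expr0n /=.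
  by rewrite addr0 sqrtr1.
have H : eucl_norm (tprod E (k * n) t *m e) <=
    \prod_(b < k) op_norm (tprod E n (t + (b * n)%:R * alpha)).
  elim: k => [|k IH]; first by rewrite mul0n mul1mx e1 big_ord0.
  rewrite mulSn tprodD -mulmxA big_ord_recr /= [leRHS]mulrC.
  by apply: le_trans (op_normP _ _) _; rewrite ler_wpM2l ?op_norm_ge0.
apply: le_trans H; apply: le_trans (normc_le_eucl _ 0).
rewrite -colE mxE (tprod_col E (k * n) t).1 /= expr0n addr0 sqrtr_sqr //.
Qed.

Hypothesis v_per : torus_fun v.
Hypothesis v_cont : continuous v.

Lemma tprod_per E n t (z : int) : tprod E n (t + z%:~R) = tprod E n t.
Proof.
elim: n => [//|n IH]; rewrite !tprodS IH; congr (_ *m _).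
by rewrite /tmx /transfer; apply/matrixP => i j; rewrite !mxE addrAC torus_fun_int.
Qed.

Lemma tprod_unif (M : R) n e : 0 < e -> exists2 d, 0 < d &
  forall E E' t t', `|E| <= M -> `|E'| <= M -> `|E - E'| < d -> `|t - t'| < d ->
    entsum (tprod E n t - tprod E' n t') < e.
Proof.
have [K vK] := torus_fun_bounded v_per v_cont.
pose B : R := `|M| + `|K| + 2.
have B0 : 0 < B by rewrite ltr_wpDl.
have tB E t : `|E| <= M -> entsum (tmx E t) <= B.
  move=> EM; rewrite entsum4; have [-> -> -> ->] := tmxE E t.
  rewrite /= !expr0n /= oppr0 expr0n /= sqrrN expr1n !addr0 sqrtr1 sqrtr0 addr0 sqrtr_sqr.
  have := ler_normB E (v t); have := vK t; have := ler_norm M; have := ler_norm K.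
  by rewrite /B; lra.
have pB E n' t : `|E| <= M -> entsum (tprod E n' t) <= 2 * B ^+ n'.
  move=> EM; elim: n' => [|n' IH].
    rewrite entsum4 !mxE /= !expr0n /= expr1n !addr0 sqrtr1 sqrtr0; lra.
  rewrite tprodS exprS mulrCA; apply: le_trans (entsumM _ _) _.
  by apply: ler_pM; rewrite ?entsum_ge0 ?tB.
elim: n e => [|n IH] e e0.
  exists 1 => // E E' t t' _ _ _ _; rewrite subrr entsum4 !mxE /= !expr0n /= !addr0 sqrtr0; lra.
have e1 : 0 < e / (2 * B) by rewrite divr_gt0 // mulr_gt0.
have [d1 d10 H1] := IH _ e1.
pose c : R := 2 * B ^+ n; have c0 : 0 < c by rewrite mulr_gt0 // exprn_gt0.
have e2 : 0 < e / (4 * c) by rewrite divr_gt0 // mulr_gt0.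
have [d2 d20 H2] := torus_fun_unif v_per v_cont e2.
exists (Num.min d1 (Num.min d2 (e / (4 * c)))); first by rewrite !lt_min d10 d20 e2.
move=> E E' t t' EM E'M; rewrite !lt_min => /and3P[E1 E2 E3] /and3P[t1 t2 _].
(* Telescoping: one term changes the old product, the other the new factor; [B] bounds a factor and
   [c] a product of n factors. *)
have -> : tprod E n.+1 t - tprod E' n.+1 t' =
    tmx E (t + n%:R * alpha) *m (tprod E n t - tprod E' n t') +
    (tmx E (t + n%:R * alpha) - tmx E' (t' + n%:R * alpha)) *m tprod E' n t'.
  by rewrite !tprodS mulmxBr mulmxBl addrA subrK.
apply: le_lt_trans (entsumD _ _) _.
have h1 : entsum (tmx E (t + n%:R * alpha) *m (tprod E n t - tprod E' n t')) <= e / 2.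
  apply: le_trans (entsumM _ _) _.
  apply: (@le_trans _ _ (B * (e / (2 * B)))).
    by apply: ler_pM; rewrite ?entsum_ge0 ?tB // ltW // H1.
  have -> // : B * (e / (2 * B)) = e / 2 by field; rewrite gt_eqF.
have h2 : entsum ((tmx E (t + n%:R * alpha) - tmx E' (t' + n%:R * alpha)) *m tprod E' n t') < e / 2.
  apply: le_lt_trans (entsumM _ _) _.
  have -> : e / 2 = (e / (2 * c)) * c by field; rewrite gt_eqF.
  apply: (@le_lt_trans _ _ (entsum (tmx E (t + n%:R * alpha) - tmx E' (t' + n%:R * alpha)) * c)).
    by rewrite ler_wpM2l ?entsum_ge0 ?pB.
  rewrite ltr_pM2r // entsum4.
  move: (tmxE E (t + n%:R * alpha)) (tmxE E' (t' + n%:R * alpha)).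
  move: (tmx E _) (tmx E' _) => X Y [x0 x1 x2 x3] [y0 y1 y2 y3].
  rewrite !mxE x0 x1 x2 x3 y0 y1 y2 y3 !subrr -rmorphB /= !expr0n /= !addr0 sqrtr0 !addr0 sqrtr_sqr.
  have := H2 (t + n%:R * alpha) (t' + n%:R * alpha).
  rewrite opprD addrACA subrr addr0 => /(_ t2) h.
  set a := v _ in h *; set b := v _ in h *.
  have := ler_normB (E - E') (a - b).
  have -> : e / (2 * c) = e / (4 * c) + e / (4 * c) by field; rewrite gt_eqF.
  rewrite (_ : E - a - (E' - b) = E - E' - (a - b)); last by ring.
  lra.
lra.
Qed.

Definition lnop E n t : R := ln (op_norm (tprod E n t)).

Lemma lnop_unif (M : R) n e : 0 < e -> exists2 d, 0 < d &
  forall E E' t t', `|E| <= M -> `|E'| <= M -> `|E - E'| < d -> `|t - t'| < d ->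
    lnop E n t < lnop E' n t' + e.
Proof.
move=> e0; have [d d0 H] := tprod_unif M n (divr_gt0 e0 (ltr0Sn R 1)).
exists d => // E E' t t' EM E'M Ed td.
have h := H E E' t t' EM E'M Ed td.
apply: le_lt_trans (ln_op_le (det_tprod E n t) (det_tprod E' n t')) _.
rewrite -/(lnop E' n t'); move: (entsum _) h => s h; lra.
Qed.

End Cocycle.

(** * Riemann sums uniform in the phase *)

Section RiemannSums.
Variable R : realType.
Variable g : R -> R.
Hypothesis g_per : torus_fun g.
Hypothesis g_cont : continuous g.
Implicit Types (s t d e : R) (n k : nat).

Lemma riemann_sum_step n s : (0 < n)%N ->
  \sum_(j < n) g (j%:R / n%:R + (s + n%:R^-1)) = \sum_(j < n) g (j%:R / n%:R + s).
Proof.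
case: n => // n _; rewrite big_ord_recr big_ord_recl /= [RHS]addrC; congr (_ + _).
  apply: eq_bigr => i _; congr g; rewrite /bump add1n -[i.+1%:R]natr1 mulrDl mul1r -!addrA.
  by congr (_ + _); rewrite addrC.
rewrite mul0r add0r addrCA (_ : n%:R / n.+1%:R + _ = 1).
  exact: g_per.
by rewrite -natr1; field; rewrite natr1 pnatr_eq0.
Qed.

(* The sum over equally spaced points is invariant under shifts by [1/n], so
   only phases in [[0, 1/n)] matter. *)
Lemma riemann_sum_phase n s : (0 < n)%N -> exists s', [/\ 0 <= s', s' < n%:R^-1 &
  \sum_(j < n) g (j%:R / n%:R + s) = \sum_(j < n) g (j%:R / n%:R + s')].
Proof.
move=> n0; have nR : 0 < n%:R :> R by rewrite ltr0n.
pose z := Num.floor s; pose s1 := s - z%:~R.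
have s10 : 0 <= s1 by rewrite subr_ge0 floor_le_tmp.
pose k := Num.truncn (n%:R * s1).
have nk k' u : \sum_(j < n) g (j%:R / n%:R + (u + k'%:R / n%:R)) =
    \sum_(j < n) g (j%:R / n%:R + u).
  elim: k' => [|k' IH]; first by rewrite mul0r addr0.
  by rewrite -natr1 mulrDl mul1r addrA riemann_sum_step.
have ns : 0 <= n%:R * s1 by rewrite mulr_ge0 // ltW.
have h1 : k%:R <= n%:R * s1 by rewrite truncn_le.
have h2 : n%:R * s1 < k.+1%:R := truncnS_gt _.
exists (s1 - k%:R / n%:R); split.
- by rewrite subr_ge0 ler_pdivrMr // mulrC.
- rewrite ltrBlDl (_ : _ + _ = k.+1%:R / n%:R); last by rewrite -natr1 mulrDl mul1r.
  by rewrite ltr_pdivlMr // mulrC.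
rewrite -[RHS](nk k) subrK; apply: eq_bigr => j _.
by rewrite /s1 addrA -[LHS](torus_fun_int _ (- z)) // rmorphN.
Qed.

(** [n0] is chosen before the phase s, so that one number of sample points serves all shifts along
    the orbit. *)
Lemma riemann_sum_le e : 0 < e -> exists n0, forall n s, (n0 <= n)%N -> (0 < n)%N ->
  \sum_(j < n) g (j%:R / n%:R + s) <=
  n%:R * ((\int[@lebesgue_measure R]_(t in `[0%R, 1%R]) g t) + e).
Proof.
move=> e0; have [d d0 gd] := torus_fun_unif g_per g_cont e0.
have [K gK] := torus_fun_bounded g_per g_cont.
exists (Num.truncn d^-1).+1 => n s0 dn n0.
have nR : 0 < n%:R :> R by rewrite ltr0n.
have nd : n%:R^-1 < d.
  rewrite invf_plt ?posrE //; apply: lt_le_trans (truncnS_gt _) _.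
  by rewrite ler_nat.
have [s [sge0 sn ->]] := riemann_sum_phase s0 n0.
set I := Rintegral _ _ _; set S := \sum_(_ < _) _.
(* Reflection: K + e - g is nonnegative, so [integral_step_le] bounds the integral of its step
   function by its mean, and this bounds the mean of g from above. *)
pose h i : \bar R := (K + e - g (i%:R / n%:R + s))%:E.
have gle t : g t <= K by apply: le_trans (gK t); exact: ler_norm.
have h0 i : (0 <= h i)%E by rewrite lee_fin subr_ge0 (le_trans (gle _)) // lerDl ltW.
have mh := measurable_step n0 h0.
have gint : (@lebesgue_measure R).-integrable `[0, 1] (EFin \o g).
  apply: continuous_compact_integrable; first exact: segment_compact.
  by apply: continuous_subspaceT.
have Kint : (@lebesgue_measure R).-integrable `[0, 1] (EFin \o (fun=> K)).
  apply: continuous_compact_integrable; first exact: segment_compact.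
  by apply: continuous_subspaceT => x; exact: cvg_cst.
have E1 : (\int[@lebesgue_measure R]_(t in `[0%R, 1%R]) (K - g t)%:E = (K - I)%:E)%E.
  have -> : K - I = \int[@lebesgue_measure R]_(t in `[0, 1]) (K - g t).
    rewrite RintegralB //= Rintegral_cst //= lebesgue_measure_itv /= lte_fin ltr01.
    by rewrite sube0 mulr1.
  rewrite /Rintegral fineK //; apply: integrable_fin_num => //.
  apply: (@continuous_compact_integrable _ (fun t => K - g t)); first exact: segment_compact.
  by apply: continuous_subspaceT => x; apply: cvgB; [exact: cvg_cst|exact: g_cont].
have E2 : (\int[@lebesgue_measure R]_(t in `[0%R, 1%R]) (K - g t)%:E <=
    \int[@lebesgue_measure R]_(t in `[0%R, 1%R]) h (step_index n t))%E.
  apply: ge0_le_integral => //.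
  - by move=> t _; rewrite lee_fin subr_ge0.
  - apply/measurable_EFinP; apply: measurable_funB => //.
    by apply: measurable_funTS; exact: continuous_measurable_fun.
  - by apply: measurable_funTS; exact: mh.
  move=> t /=; rewrite in_itv /= => /andP[t0 t1]; rewrite lee_fin -addrA lerD2l.
  have nt0 : 0 <= n%:R * t by rewrite mulr_ge0.
  have a1 : (step_index n t)%:R / n%:R <= t.
    rewrite ler_pdivrMr // mulrC; apply: (@le_trans _ _ (Num.truncn (n%:R * t))%:R).
      by rewrite ler_nat geq_minl.
    by rewrite truncn_le.
  have a2 : t <= (step_index n t)%:R / n%:R + n%:R^-1.
    rewrite -[X in _ + X]mul1r -mulrDl natr1 ler_pdivlMr // mulrC.
    rewrite /step_index /minn; case: ifP => _; first exact/ltW/truncnS_gt.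
    by rewrite prednK // ger_pMr.
  have := gd ((step_index n t)%:R / n%:R + s) t.
  move: (g t) (g _) ((step_index n t)%:R / n%:R) a1 a2 => x y a a1 a2.
  have -> : `|a + s - t| < d by rewrite ltr_norml; apply/andP; split; lra.
  by move=> /(_ isT); rewrite ltr_norml => /andP[]; lra.
have := le_trans E2 _; rewrite E1.
have -> : (\int[@lebesgue_measure R]_(t in `[0%R, 1%R]) h (step_index n t) =
    \int[uniform_prob (@ltr01 R)]_t h (step_index n t))%E.
  by rewrite integral_uniform // ?subr0 ?invr1 ?mul1e.
move=> /(_ _ (integral_step_le n0 h0)).
rewrite /h; under eq_bigr do rewrite -EFinM.
rewrite sumEFin lee_fin -mulr_suml sumrB sumr_const card_ord -/S.
rewrite -[X in X - S]mulr_natr mulrBl mulfK ?gt_eqF // => H.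
have : S / n%:R <= I + e by lra.
by rewrite ler_pdivrMr // mulrC.
Qed.

End RiemannSums.

Lemma rspec_norm_le (R : realType) (W : int -> R) K (E : R) :
  (forall n, `|W n| <= K) -> rspec W E -> `|E| <= 2 * (3 * (2 + K ^+ 2)) + 2.
Proof.
move=> WK /(rspec_bounded WK); have := sqr_ge0 K.
move: (K ^+ 2) => x x0; set C := 2 * _ + 2 => h.
have C1 : 1 <= C by rewrite /C; lra.
rewrite -(@ler_pXn2r _ 2) ?nnegrE ?normr_ge0 //; last by lra.
rewrite real_normK ?num_real // (le_trans h) // expr2 ler_peMl //; lra.
Qed.

(** * A monic polynomial that is small near the spectrum *)

Section SmallPolynomial.
Variable R : realType.
Variables (v : R -> R) (alpha : R).
Hypotheses (v_per : torus_fun v) (v_cont : continuous v).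
Implicit Types (E t s e : R) (n k m : nat).

Local Notation V := (fun n : int => v (alpha * n%:~R)).
Local Notation lnop := (lnop v alpha).

Lemma lnop_per E n : torus_fun (lnop E n).
Proof. by move=> t; rewrite /lnop -[X in t + X]/(1%:~R) tprod_per. Qed.

Lemma lnop_continuous E n : continuous (lnop E n).
Proof.
move=> t; apply/(@cvgrPdist_lt _ R^o) => e e0.
have [d d0 H] := lnop_unif alpha v_per v_cont `|E| n e0.
near=> u.
have ut : `|u - t| < d.
  by rewrite distrC; near: u; apply: (@cvgr_dist_lt _ R^o) => //; exact: cvg_id.
have h1 : lnop E n u < lnop E n t + e by apply: H; rewrite // subrr normr0.
have h2 : lnop E n t < lnop E n u + e by apply: H; rewrite // ?subrr ?normr0 // distrC.
move: (lnop E n t) (lnop E n u) h1 h2 => x y h1 h2.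
by rewrite ltr_norml; apply/andP; split; clear -h1 h2; lra.
Unshelve. all: by end_near. Qed.

(** An infimum equal to 0 provides a length n with mean at most n e/3; the Riemann sum and the
    passage from E0 to E cost e/3 each, which n >= 1 absorbs. The radius is 2 d because E is later
    reached from the centre through a point of the spectrum, in two steps of length at most d. *)
Lemma lyapunov_riemann E0 e : 0 < e -> lyapunov v alpha (E0%:C)%C = 0 ->
  exists n (d : R) m0, [/\ (0 < n)%N, 0 < d & forall E m s, `|E - E0| <= 2 * d ->
    (m0 <= m)%N -> (0 < m)%N ->
    \sum_(j < m) lnop E n (j%:R / m%:R + s) <= m%:R * (n%:R * e)].
Proof.
move=> e0 L0; have e3 : 0 < e / 3 by rewrite divr_gt0.
have [n n0 In] : exists2 n, (0 < n)%N &
    \int[@lebesgue_measure R]_(t in `[0, 1]) lnop E0 n t <= n%:R * (e / 3).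
  apply: contrapT => H; have h : e / 3 <= lyapunov v alpha (E0%:C)%C.
    apply: lb_le_inf.
      by exists (1%N%:R^-1 * \int[@lebesgue_measure R]_(t in `[0, 1]) lnop E0 1 t), 1%N.
    move=> _ [n n0 <-]; rewrite ler_pdivlMl ?ltr0n // leNgt; apply/negP => /ltW h.
    by apply: H; exists n; [exact: n0|exact: h].
  by move: h; rewrite L0 leNgt e3.
clear L0.
have n1 : 1 <= n%:R :> R by rewrite ler1n.
have [m0 Hm] := riemann_sum_le (lnop_per E0 n) (@lnop_continuous E0 n) e3.
move: In Hm; move: (Rintegral _ _ _) => I In Hm.
have [d d0 Hd] := lnop_unif alpha v_per v_cont (`|E0| + 1) n e3.
exists n, (Num.min d 1 / 4), m0; split => //; first by rewrite divr_gt0 // lt_min d0 ltr01.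
move=> E m s Ed mm m1; apply: (@le_trans _ _ (\sum_(j < m) (lnop E0 n (j%:R / m%:R + s) + e / 3))).
  apply: ler_sum => j _; apply/ltW/Hd; rewrite ?subrr ?normr0 //.
  - have := ler_normD (E - E0) E0; rewrite subrK.
    have : Num.min d 1 <= 1 by rewrite ge_min lexx orbT.
    by lra.
  - by rewrite lerDl.
  - by have : Num.min d 1 <= d; [rewrite ge_min lexx|lra].
rewrite big_split /= sumr_const card_ord -[e / 3 *+ m]mulr_natl.
apply: le_trans (lerD (Hm m s mm m1) (lexx _)) _.
rewrite -mulrDr ler_pM2l ?ltr0n //; clear -e3 In n1.
have : e / 3 <= n%:R * (e / 3) by rewrite ler_peMl // ltW.
have -> : n%:R * e = n%:R * (e / 3) + n%:R * (e / 3) + n%:R * (e / 3) by field.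
lra.
Qed.

Lemma monic_prod_size (F : nat -> {poly R}) N m :
  (forall j, F j \is monic /\ size (F j) = N.+1) ->
  \prod_(j < m) F j \is monic /\ size (\prod_(j < m) F j) = (N * m).+1.
Proof.
move=> HF; elim: m => [|m [IH1 IH2]]; first by rewrite big_ord0 monic1 size_poly1 muln0.
have [F1 F2] := HF m; rewrite big_ord_recr /= monicMl //; split => //.
by rewrite size_monicM ?monic_neq0 // F2 IH2 addSn addnS /= mulnS addnC.
Qed.

(** After exchanging the products, block b involves the phases j/m + b n alpha, again equally
    spaced, and the hypothesis applies with s = b n alpha. *)
Lemma jpol_prod_le E n k m e :
  (0 < m)%N ->
  (forall s, \sum_(j < m) lnop E n (j%:R / m%:R + s) <= m%:R * (n%:R * e)) ->
  `|(\prod_(j < m) jpol (fun i => v (j%:R / m%:R + i%:R * alpha)) (k * n)).[E]| <=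
  expR (e * (k * n * m)%:R).
Proof.
move=> m0 H; rewrite horner_prod normr_prod.
have op0 i t : 0 < op_norm (tprod v alpha E i t).
  by apply: lt_le_trans (op_norm_det1 (det_tprod _ _ _ _ _)); rewrite invr_gt0.
apply: (@le_trans _ _ (\prod_(j < m) \prod_(b < k)
    op_norm (tprod v alpha E n (j%:R / m%:R + (b * n)%:R * alpha)))).
  apply: ler_prod => j _; rewrite normr_ge0 jpol_horner.
  exact: jval_le_prod.
rewrite exchange_big /=.
apply: (@le_trans _ _ (\prod_(b < k) expR (m%:R * (n%:R * e)))).
  apply: ler_prod => b _; rewrite prodr_ge0 => [|j _]; last exact: ltW.
  rewrite -ler_ln ?posrE ?expR_gt0 ?prodr_gt0 // expRK ln_prod //.
  exact: H.
rewrite prodr_const card_ord -expRM_natl !natrM.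
by rewrite ler_expR le_eqVlt; apply/orP; left; apply/eqP; ring.
Qed.

(** The good length n depends on the energy. On a finite cover of an interval containing the
    spectrum, N is the product of all local lengths, so P_N splits into blocks of whichever length
    suits the given energy; m exceeds all local thresholds and eta is the least radius. *)
Lemma small_monic e : 0 < e -> (forall E, rspec V E -> lyapunov v alpha (E%:C)%C = 0) ->
  exists (Q : {poly R}) (d : nat) (eta : R), [/\ Q \is monic, size Q = d.+1, (0 < d)%N,
    0 < eta & forall E E0, rspec V E0 -> `|E0 - E| <= eta -> `|Q.[E]| <= expR (e * d%:R)].
Proof.
move=> e0 L0; have [K vK] := torus_fun_bounded v_per v_cont.
have VK (n : int) : `|V n| <= K by exact: vK.
pose C := 2 * (3 * (2 + K ^+ 2)) + 2.
have loc (x : R) : exists y : nat * R * nat, [/\ (0 < y.1.1)%N, 0 < y.1.2 &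
    forall E0, rspec V E0 -> `|E0 - x| < y.1.2 -> forall E m s, `|E0 - E| <= y.1.2 ->
    (y.2 <= m)%N -> (0 < m)%N ->
    \sum_(j < m) lnop E y.1.1 (j%:R / m%:R + s) <= m%:R * (y.1.1%:R * e)].
  have [xV|xV] := pselect (rspec V x).
    have [n [d [m0 [n0 d0 H]]]] := lyapunov_riemann e0 (L0 _ xV).
    exists (n, d, m0); split=> //= E0 _ E0x E m s E0E; apply: H.
    have := ler_normB (E0 - x) (E0 - E); have -> : E0 - x - (E0 - E) = E - x by ring.
    lra.
  (* Centres off the spectrum get a radius that isolates them from it, which makes their requirement
     vacuous. *)
  have [d d0 H] : exists2 d, 0 < d & forall E0, rspec V E0 -> d <= `|E0 - x|.
    apply: contrapT => H; apply: xV; apply: rspec_closed => d d0.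
    apply: contrapT => H'; apply: H; exists d => // E0 E0V.
    by rewrite leNgt; apply/negP => /ltW h; apply: H'; exists E0.
  by exists (1%N, d, 0%N); split=> //= E0 /H h; rewrite ltNge h.
have [f Hf] := choice loc.
have f0 x : 0 < (f x).1.2 by have [] := Hf x.
have [s sC] := segment_finite_cover (- C) C f0.
have [eta eta0 etas] := seq_min_pos s f0.
pose N := (\prod_(x <- s) (f x).1.1)%N.
pose m := (\max_(x <- s) (f x).2).+1.
have N0 : (0 < N)%N by apply: prodn_gt0 => x; have [] := Hf x.
have js j : jpol (fun i => v (j%:R / m%:R + i%:R * alpha)) N \is monic /\
    size (jpol (fun i => v (j%:R / m%:R + i%:R * alpha)) N) = N.+1.
  by have [h1 [_ h2]] := jpol_size (fun i => v (j%:R / m%:R + i%:R * alpha)) N.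
have [Q1 Q2] := monic_prod_size m js.
exists (\prod_(j < m) jpol (fun i => v (j%:R / m%:R + i%:R * alpha)) N), (N * m)%N, eta.
split=> //; first by rewrite muln_gt0 N0.
move=> E E0 E0V E0E.
have [x xs E0x] : exists2 x, x \in s & `|E0 - x| < (f x).1.2.
  by apply: sC; rewrite -ler_norml; exact: rspec_norm_le VK E0V.
have [n0 _ H] := Hf x.
have nN : ((f x).1.1 %| N)%N by rewrite /N (big_rem x) //= dvdn_mulr.
rewrite -(divnK nN); apply: jpol_prod_le => // u; apply: (H E0) => //.
  by apply: le_trans E0E _; exact: etas.
by apply: leqW; exact: (@leq_bigmax_seq _ s xpredT (fun x => (f x).2) x).
Qed.

End SmallPolynomial.

(** * Squeezing the capacities *)

Section CapacitySqueeze.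
Variable R : realType.
Implicit Types (S T : set R[i]%C) (v : R -> R) (alpha beta theta e : R).

Lemma le_capacity S T : S `<=` T -> (capacity S <= capacity T)%E.
Proof.
move=> ST; apply: ereal_sup_le => _ [mu [K [Kc KS K1]] <-].
by exists mu => //; exists K; split => // z /KS /ST.
Qed.

Lemma spectrumP v beta theta (z : R[i]%C) : torus_fun v -> continuous v ->
  spectrum v beta theta z <->
  complex.Im z = 0 /\ rspec (fun n => v (beta * n%:~R + theta)) (complex.Re z).
Proof.
move=> vp vc; have [K vK] := torus_fun_bounded vp vc.
exact: (l2_spectrumP _ (fun n => vK _)).
Qed.

(** A single phase already has capacity at least 1, whatever the frequency. *)
Lemma capacity_S_plus_ge1 v beta : torus_fun v -> continuous v ->
  (1 <= capacity (S_plus v beta))%E.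
Proof.
move=> vp vc; have [K vK] := torus_fun_bounded vp vc.
apply: le_trans (capacity_spectrum_ge1 (fun n : int => vK (beta * n%:~R + 0))) _.
by apply: le_capacity => z zs; exists 0.
Qed.

Lemma capacity_Sigma_ge1 v alpha : torus_fun v -> continuous v ->
  (1 <= capacity (Sigma v alpha))%E.
Proof.
move=> vp vc; have [K vK] := torus_fun_bounded vp vc.
exact: (capacity_spectrum_ge1 (fun n : int => vK (alpha * n%:~R + 0))).
Qed.

Lemma capacity_le_near v alpha e : torus_fun v -> continuous v -> irrational alpha ->
  (forall E : R[i]%C, Sigma v alpha E -> lyapunov v alpha E = 0) -> 0 < e ->
  exists2 d, 0 < d & forall beta, (exists k : int, `|beta - alpha - k%:~R| < d) ->
    (capacity (S_plus v beta) <= (expR e)%:E)%E.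
Proof.
move=> vp vc ai L0 e0; have [K vK] := torus_fun_bounded vp vc.
have L1 E : rspec (fun n : int => v (alpha * n%:~R)) E -> lyapunov v alpha (E%:C)%C = 0.
  move=> rE; apply: L0; apply/(spectrumP _ _ _ vp vc); split => //=.
  by under eq_fun do rewrite addr0.
have [Q [d [eta [Q1 Q2 d0 eta0 QE]]]] := small_monic vp vc e0 L1.
have [del del0 H] := rspec_semicont vp vc ai eta0.
exists del => // beta bk; apply: (capacity_le Q1 Q2 d0 (ltW e0)).
move=> z [theta _ /(spectrumP _ _ _ vp vc)[z0 zr]]; split => //.
  exact: rspec_norm_le (fun n => vK _) zr.
by have [E0 E0r E0z] := H _ _ bk _ zr; exact: QE E0z.
Qed.

(** Sigma is contained in [S_plus] at the frequency alpha itself, to which [capacity_le_near]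
    applies for every e. *)
Lemma capacity_Sigma_le1 v alpha : torus_fun v -> continuous v -> irrational alpha ->
  (forall E : R[i]%C, Sigma v alpha E -> lyapunov v alpha E = 0) ->
  (capacity (Sigma v alpha) <= 1)%E.
Proof.
move=> vp vc ai L0; apply/lee_addgt0Pr => e e0.
have l0 : 0 < ln (1 + e) by rewrite ln_gt0 // ltrDl.
have [d d0 H] := capacity_le_near vp vc ai L0 l0.
apply: le_trans (_ : (capacity (S_plus v alpha) <= _)%E).
  by apply: le_capacity => z zs; exists 0.
rewrite -EFinD -[(1 + e)%R]lnK ?posrE ?addr_gt0 //; apply: H.
by exists 0; rewrite subrr subr0 normr0.
Qed.

End CapacitySqueeze.

Theorem theorem4p3 (R : realType) (v : R -> R) (alpha : R)
    (p : nat -> int) (q : nat -> nat)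
    (v_per : torus_fun v) (v_cont : continuous v)
    (alpha_irr : irrational alpha)
    (q_gt0 : forall n, (0 < q n)%N)
    (pq_coprime : forall n, coprime `|p n|%N (q n))
    (pq_cvg : torus_cvg (fun n => (p n)%:~R / (q n)%:R) alpha)
    (L0 : forall E : R[i]%C, Sigma v alpha E -> lyapunov v alpha E = 0) :
  capacity (S_plus v ((p n)%:~R / (q n)%:R)) @[n --> \oo]
    --> capacity (Sigma v alpha).
Proof.
have -> : capacity (Sigma v alpha) = 1%E.
  apply/eqP; rewrite eq_le capacity_Sigma_ge1 // andbT.
  exact: capacity_Sigma_le1.
have near1 e : 0 < e -> \forall n \near \oo,
    (1 <= capacity (S_plus v ((p n)%:~R / (q n)%:R)) <= (1 + e)%:E)%E.
  move=> e0; have l0 : 0 < ln (1 + e) by rewrite ln_gt0 // ltrDl.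
  have [d d0 H] := capacity_le_near v_per v_cont alpha_irr L0 l0.
  apply: filterS (pq_cvg d d0) => n /H.
  by rewrite lnK ?posrE ?addr_gt0 // => ->; rewrite andbT capacity_S_plus_ge1.
(* Capacities live in the extended reals; the bounds by 1 and 1 + e first give finiteness, then
   convergence of the real values. *)
apply/fine_cvgP; split.
  apply: filterS (near1 1 ltr01) => n /andP[h1 h2].
  by rewrite fin_numElt (lt_le_trans _ h1) ?ltNyr // (le_lt_trans h2) ?ltry.
apply/(@cvgrPdist_le _ R^o) => e e0; apply: filterS (near1 e e0) => n /=.
case: (capacity _) => [r| |] /andP[] //; rewrite !lee_fin => h1 h2.
by rewrite ler_norml /=; apply/andP; split; lra.
Qed.
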